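(* Let $(X_1,d_1,\mu_1)$ and $(X_2,d_2,\mu_2)$ be spaces of homogeneous type, $\vec X=X_1\times X_2$, $\vec\mu=\mu_1\times\mu_2$. Let $T$ be a bi-parameter Journé operator on $\vec X$ with kernel $K$, and suppose $T$ satisfies the following homogeneous condition: there exist positive constants $c_0$ and $\overline C$ such that for every $x_1\in X_1$, $x_2\in X_2$ and $r_1,r_2>0$ there exist $y_1\in B_1(x_1,\overline Cr_1)\setminus B_1(x_1,r_1)$ and $y_2\in B_2(x_2,\overline Cr_2)\setminus B_2(x_2,r_2)$ with $$|K(x_1,y_1;x_2,y_2)|\ge\frac1{c_0\,\mu_1(B_1(x_1,r_1))\,\mu_2(B_2(x_2,r_2))}.$$ Let $1<p<\infty$ and $\lambda_1,\lambda_2\in A_p(\vec X)$, and define $\nu:=\lambda_1^{1/p}\lambda_2^{-1/p}$. Suppose that $b\in L^1_{\rm loc}(\vec X)$ and that $\|[b,T]:L^p_{\lambda_1}(\vec X)\to L^p_{\lambda_2}(\vec X)\|<\infty$. Then $b\in\mathrm{bmo}_\nu(\vec X)$ with $$\|b\|_{\mathrm{bmo}_\nu(\vec X)}\lesssim\|[b,T]:L^p_{\lambda_1}(\vec X)\to L^p_{\lambda_2}(\vec X)\|.$$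
   Context: Each $(X_i,d_i,\mu_i)$ is a space of homogeneous type: $d_i$ is a quasi-metric with $d_i(x,y)\le A_0[d_i(x,z)+d_i(z,y)]$, $\mu_i$ is nonzero and doubling ($\mu_i(B_i(x,2r))\le C\mu_i(B_i(x,r))<\infty$), $\mu_i(X_i)=\infty$, $\mu_i(\{x\})=0$ for all $x$; balls $B_i(x,r)=\{y\in X_i:d_i(x,y)<r\}$. It is assumed that $d_i$ has regularity: $|d_i(x,y)-d_i(x',y)|\le C\,d_i(x,x')^{\theta_i}[d_i(x,y)+d_i(x',y)]^{1-\theta_i}$ for some $\theta_i\in(0,1)$. Points: $\vec x=(x_1,x_2)$; $K(x_1,y_1;x_2,y_2)$ means $K(\vec x,\vec y)$. $\lesssim$ means inequality up to a constant independent of $b$. $[b,T]f=bT(f)-T(bf)$. Weights and bmo. A rectangle is $R=B_1\times B_2$, $B_i\subset X_i$ a ball. $w\in A_p(\vec X)$ ($1<p<\infty$) if $w\ge0$ is locally integrable and $\sup_R\big(\frac1{\vec\mu(R)}\int_Rw\,d\vec\mu\big)\big(\frac1{\vec\mu(R)}\int_Rw^{-1/(p-1)}d\vec\mu\big)^{p-1}<\infty$. $L^p_w(\vec X)$ has norm $(\int|f|^pw\,d\vec\mu)^{1/p}$; $w(R)=\int_Rw\,d\vec\mu$. $\mathrm{bmo}_w(\vec X)$ is the space of locally integrable $b$ with $\|b\|_{\mathrm{bmo}_w(\vec X)}=\sup_R\frac1{w(R)}\int_R|b-b_R|\,d\vec\mu<\infty$, $b_R=\frac1{\vec\mu(R)}\int_Rb\,d\vec\mu$.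 Bi-parameter Journé operator. Write $C_0^{\eta_i}(X_i)$, $\eta_i\in(0,\theta_i]$, for the continuous functions of bounded support with $\sup_{x\ne y}|f(x)-f(y)|/d_i(x,y)^{\eta_i}<\infty$. Put $V_i=\mu_i(B_i(x_i,d_i(x_i,y_i)))$ and $D_i=d_i(x_i,y_i)$; $\delta>0$ is a fixed exponent. $T$ is a linear operator satisfying I and II. I. Structure. For $f=f_1\otimes f_2$, $g=g_1\otimes g_2$ with $f_i,g_i\in C_0^{\eta_i}(X_i)$ and $\mathrm{supp}f_i\cap\mathrm{supp}g_i=\emptyset$ ($i=1,2$), $\langle Tf,g\rangle=\int_{\vec X}\int_{\vec X}K(\vec x,\vec y)f(\vec y)g(\vec x)\,d\vec\mu(\vec y)d\vec\mu(\vec x)$, where $K$ is defined off $\{x_1=y_1\text{ or }x_2=y_2\}$ with values in $\mathbb C$ and satisfies: 1. Size: $|K(\vec x,\vec y)|\le\frac C{V_1V_2}$. 2. Hölder: whenever the displaced variables satisfy the smallness conditions $d_i(\cdot,\cdot')\le\frac1{2A_0}D_i$, (2a) $|K(\vec x,\vec y)-K(\vec x,(y_1,y_2'))-K(\vec x,(y_1',y_2))+K(\vec x,\vec y')|\le C\frac{d_1(y_1,y_1')^\delta d_2(y_2,y_2')^\delta}{V_1D_1^\delta V_2D_2^\delta}$; (2b) $|K(\vec x,\vec y)-K((x_1,x_2'),\vec y)-K((x_1',x_2),\vec y)+K(\vec x',\vec y)|\le C\frac{d_1(x_1,x_1')^\delta d_2(x_2,x_2')^\delta}{V_1D_1^\delta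 V_2D_2^\delta}$; (2c) $|K(\vec x,\vec y)-K((x_1,x_2'),\vec y)-K(\vec x,(y_1',y_2))+K((x_1,x_2'),(y_1',y_2))|\le C\frac{d_1(y_1,y_1')^\delta d_2(x_2,x_2')^\delta}{V_1D_1^\delta V_2D_2^\delta}$; (2d) $|K(\vec x,\vec y)-K(\vec x,(y_1,y_2'))-K((x_1',x_2),\vec y)+K((x_1',x_2),(y_1,y_2'))|\le C\frac{d_1(x_1,x_1')^\delta d_2(y_2,y_2')^\delta}{V_1D_1^\delta V_2D_2^\delta}$. 3. Mixed size and Hölder: under the same smallness condition on the single displaced variable, $|K(\vec x,\vec y)-K((x_1',x_2),\vec y)|\le C\frac{d_1(x_1,x_1')^\delta}{V_1D_1^\delta V_2}$, $|K(\vec x,\vec y)-K(\vec x,(y_1',y_2))|\le C\frac{d_1(y_1,y_1')^\delta}{V_1D_1^\delta V_2}$, $|K(\vec x,\vec y)-K((x_1,x_2'),\vec y)|\le C\frac{d_2(x_2,x_2')^\delta}{V_1V_2D_2^\delta}$, $|K(\vec x,\vec y)-K(\vec x,(y_1,y_2'))|\le C\frac{d_2(y_2,y_2')^\delta}{V_1V_2D_2^\delta}$. 4. Calderón–Zygmund structure in each variable: if $\mathrm{supp}f_1\cap\mathrm{supp}g_1=\emptyset$, then $\langle Tf,g\rangle=\int_{X_1}\int_{X_1}K_{f_2,g_2}(x_1,y_1)f_1(y_1)g_1(x_1)\,d\mu_1(x_1)d\mu_1(y_1)$ with $|K_{f_2,g_2}(x_1,y_1)|\le C(f_2,g_2)/V_1$;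 $|K_{f_2,g_2}(x_1,y_1)-K_{f_2,g_2}(x_1',y_1)|\le C(f_2,g_2)\frac{d_1(x_1,x_1')^\delta}{V_1D_1^\delta}$ if $d_1(x_1,x_1')\le\frac1{2A_0}D_1$; $|K_{f_2,g_2}(x_1,y_1)-K_{f_2,g_2}(x_1,y_1')|\le C(f_2,g_2)\frac{d_1(y_1,y_1')^\delta}{V_1D_1^\delta}$ if $d_1(y_1,y_1')\le\frac1{2A_0}D_1$; and $C(\chi_{Q_2},\chi_{Q_2})+C(\chi_{Q_2},u_{Q_2})+C(u_{Q_2},\chi_{Q_2})\le C\mu_2(Q_2)$ for all cubes $Q_2\subset X_2$ and all $Q_2$-adapted zero-mean functions $u_{Q_2}$, i.e. $\mathrm{supp}\,u_{Q_2}\subset Q_2$, $|u_{Q_2}|\le1$, $\int u_{Q_2}d\mu_2=0$. The symmetric representation, with kernel $K_{f_1,g_1}$, is assumed if $\mathrm{supp}f_2\cap\mathrm{supp}g_2=\emptyset$. II. Boundedness and cancellation. Let $T_1$ be the partial adjoint, $\langle T_1(f_1\otimes f_2),g_1\otimes g_2\rangle=\langle T(g_1\otimes f_2),f_1\otimes g_2\rangle$. Assume: 1. $T1,T^*1,T_11,T_1^*1$ belong to product $\mathrm{BMO}(\vec X)$ (the Chang–Fefferman type product BMO space on $X_1\times X_2$). 2. $|\langle T_1(\chi_{Q_1}\otimes\chi_{Q_2}),\chi_{Q_1}\otimes\chi_{Q_2}\rangle|\le C\mu_1(Q_1)\mu_2(Q_2)$ for all cubes $Q_i\subset X_i$. 3.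 For all cubes $Q_i\subset X_i$ and all zero-mean functions $a_{Q_1}$, $b_{Q_2}$ that are $Q_1$- and $Q_2$-adapted respectively, each of $|\langle T_1(a_{Q_1}\otimes\chi_{Q_2}),\chi_{Q_1}\otimes\chi_{Q_2}\rangle|$, $|\langle T_1(\chi_{Q_1}\otimes\chi_{Q_2}),a_{Q_1}\otimes\chi_{Q_2}\rangle|$, $|\langle T_1(\chi_{Q_1}\otimes b_{Q_2}),\chi_{Q_1}\otimes\chi_{Q_2}\rangle|$, $|\langle T_1(\chi_{Q_1}\otimes\chi_{Q_2}),\chi_{Q_1}\otimes b_{Q_2}\rangle|$ is at most $C\mu_1(Q_1)\mu_2(Q_2)$. Cubes are dyadic cubes in $X_i$. *)

(* Defs.v *)
From HB Require Import structures.
From mathcomp Require Import all_boot all_order all_algebra.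
From mathcomp Require Import complex.
From mathcomp Require Import all_classical all_reals all_analysis.

Set Implicit Arguments.
Unset Strict Implicit.
Unset Printing Implicit Defensive.

Import Order.TTheory GRing.Theory Num.Theory.
Import numFieldNormedType.Exports.

Local Open Scope classical_set_scope.
Local Open Scope ring_scope.
Local Open Scope complex_scope.

Definition cabs (R : realType) (z : R[i]) : R := ComplexField.Normc.normc z.

Definition ccvg (R : realType) (u : nat -> R[i]) (l : R[i]) : Prop :=
  (fun n => cabs (u n - l)) @ \oo --> (0 : R).

Section ComplexFunctions.
Context (R : realType) (disp : measure_display) (X : measurableType disp).
Implicit Types (mu : {measure set X -> \bar R}) (f : X -> R[i]) (A : set X).

Definition cmeasurable_on A f : Prop :=
  measurable_fun A (fun x => complex.Re (f x)) /\
  measurable_fun A (fun x => complex.Im (f x)).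

Definition cmeasurable f : Prop := cmeasurable_on setT f.

Definition cintegrable mu A f : Prop :=
  mu.-integrable A (fun x => (complex.Re (f x))%:E) /\
  mu.-integrable A (fun x => (complex.Im (f x))%:E).

Definition cintegral mu A f : R[i] :=
  Rintegral mu A (fun x => complex.Re (f x)) +i*
  Rintegral mu A (fun x => complex.Im (f x)).

Definition cmean mu A f : R[i] := ((fine (mu A))^-1)%:C * cintegral mu A f.

Definition cind A (x : X) : R[i] := (\1_A x)%:C.

Definition bounded_on A (M : R) f : Prop :=
  [/\ cmeasurable f, (forall x, cabs (f x) <= M) &
      (forall x, ~ A x -> f x = 0)].

(* Bounded measurable functions vanishing outside a member of [G]; with [G]
   the balls or the rectangles, these are the bounded functions of bounded
   support. *)
Definition bounded_supp (G : set (set X)) f : Prop :=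
  exists A M, G A /\ bounded_on A M f.

Definition adapted0 mu A f : Prop :=
  bounded_on A 1 f /\ cintegral mu setT f = 0.

End ComplexFunctions.

Section Homogeneous.
Context (R : realType) (disp : measure_display) (X : measurableType disp).
Variable dist : X -> X -> R.

Definition qball (x : X) (r : R) : set X := [set y | dist x y < r].

Definition balls : set (set X) :=
  [set B | exists x r, 0 < r /\ B = qball x r].

Definition qopen : set (set X) :=
  [set U | forall x, U x -> exists2 r, 0 < r & qball x r `<=` U].

Record quasi_metric (A0 : R) : Prop := {
  qm_ge0 : forall x y, 0 <= dist x y ;
  qm_eq0 : forall x y, dist x y = 0 <-> x = y ;
  qm_sym : forall x y, dist x y = dist y x ;
  qm_triangle : forall x y z, dist x y <= A0 * (dist x z + dist z y) }.

Definition dist_regular (theta : R) : Prop :=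
  exists C : R, forall x x' y,
    `|dist x y - dist x' y| <=
    C * dist x x' `^ theta * (dist x y + dist x' y) `^ (1 - theta).

Definition doubling (mu : {measure set X -> \bar R}) : Prop :=
  exists C : R, forall x r, 0 < r ->
    (mu (qball x (2 * r)) <= C%:E * mu (qball x r))%E /\
    (mu (qball x r) < +oo)%E.

(* [mu] is a Borel measure: the measurable sets are those generated by the
   topology of [dist].  That [mu] is nonzero is contained in [mu X = +oo]. *)
Record homogeneous_space (mu : {measure set X -> \bar R}) (A0 theta : R) :
    Prop := {
  hs_quasi_metric : quasi_metric A0 ;
  hs_theta : 0 < theta < 1 ;
  hs_regular : dist_regular theta ;
  hs_borel : measurable = <<s qopen >> :> set (set X) ;
  hs_doubling : doubling mu ;
  hs_infinite : mu setT = +oo%E ;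
  hs_atomless : forall x, mu [set x] = 0%E }.

(* Closure of [f <> 0] in the topology of [dist]. *)
Definition qsupp (f : X -> R[i]) : set X :=
  [set x | forall r, 0 < r -> exists2 y, qball x r y & f y <> 0].

Definition disjoint_supp (f g : X -> R[i]) : Prop :=
  qsupp f `&` qsupp g = set0.

(* Bounded support and finite [eta]-Hölder seminorm; the latter already gives
   continuity. *)
Definition C0 (eta : R) (f : X -> R[i]) : Prop :=
  (exists2 B, balls B & forall x, ~ B x -> f x = 0) /\
  (exists C : R, forall x y, cabs (f x - f y) <= C * dist x y `^ eta).

(* Dyadic system in the sense of Christ and Hytönen-Kairema: for each level
   [k] the sets in [D k] partition [X], different levels are nested, and cubes
   of level [k] contain and are contained in balls of radius ~ [rho ^ k]. *)
Record dyadic_system (D : int -> set (set X)) : Prop := {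
  ds_measurable : forall k Q, D k Q -> measurable Q ;
  ds_cover : forall k x, exists2 Q, D k Q & Q x ;
  ds_nested : forall k l P Q, k <= l -> D k P -> D l Q ->
    Q `<=` P \/ Q `&` P = set0 ;
  ds_size : exists rho c C : R, [/\ 0 < rho < 1, 0 < c, 0 < C &
    forall k Q, D k Q -> exists z,
      qball z (c * rho ^ k) `<=` Q /\ Q `<=` qball z (C * rho ^ k)] }.

Definition cube (D : int -> set (set X)) : set (set X) :=
  [set Q | exists k, D k Q].

Definition child (D : int -> set (set X)) (Q P : set X) : Prop :=
  exists k, [/\ D k Q, D (k + 1) P & P `<=` Q].

Definition vol (mu : {measure set X -> \bar R}) (x y : X) : R :=
  fine (mu (qball x (dist x y))).

Definition near (A0 : R) (x y z z' : X) : Prop :=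
  dist z z' <= (2 * A0)^-1 * dist x y.

Definition gain (mu : {measure set X -> \bar R}) (delta : R) (x y z z' : X) : R :=
  dist z z' `^ delta / (vol mu x y * dist x y `^ delta).

Definition haar (mu : {measure set X -> \bar R}) (Q P : set X) (x : X) : R[i] :=
  ((fine (mu P))^-1)%:C * cind R P x - ((fine (mu Q))^-1)%:C * cind R Q x.

End Homogeneous.

Section Forms.
Context (R : realType) (X1 X2 : Type).

Definition tensor (f1 : X1 -> R[i]) (f2 : X2 -> R[i]) (x : X1 * X2) : R[i] :=
  f1 x.1 * f2 x.2.

(* [L f1 f2 g1 g2] stands for <T (f1 (x) f2), g1 (x) g2>. *)
Definition form : Type :=
  (X1 -> R[i]) -> (X2 -> R[i]) -> (X1 -> R[i]) -> (X2 -> R[i]) -> R[i].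

Definition adj (L : form) : form := fun f1 f2 g1 g2 => L g1 g2 f1 f2.

Definition padj (L : form) : form := fun f1 f2 g1 g2 => L g1 f2 f1 g2.

End Forms.

Definition swap_form (R : realType) (X1 X2 : Type) (L : form R X1 X2) :
  form R X2 X1 := fun f2 f1 g2 g1 => L f1 f2 g1 g2.

Section PartialKernel.
Context (R : realType) (disp disp' : measure_display).
Context (X : measurableType disp) (Y : measurableType disp').
Variables (dist : X -> X -> R) (dist' : Y -> Y -> R).
Variables (mu : {measure set X -> \bar R}) (mu' : {measure set Y -> \bar R}).
Variables (A0 delta : R).

Record cz_kernel (C : R) (K : X -> X -> R[i]) : Prop := {
  cz_measurable :
    cmeasurable_on [set z : X * X | z.1 <> z.2] (fun z => K z.1 z.2) ;
  cz_size : forall x y, x <> y -> cabs (K x y) <= C / vol dist mu x y ;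
  cz_holder_x : forall x x' y, x <> y -> near dist A0 x y x x' ->
    cabs (K x y - K x' y) <= C * gain dist mu delta x y x x' ;
  cz_holder_y : forall x y y', x <> y -> near dist A0 x y y y' ->
    cabs (K x y - K x y') <= C * gain dist mu delta x y y y' }.

(* The pairs of functions of the other variable for which a partial kernel is
   required: Hölder functions, and the pairs occurring in the bound on
   [C(f,g)]. *)
Definition partial_pair (eta' : R) (D' : int -> set (set Y))
    (f g : Y -> R[i]) : Prop :=
  (C0 dist' eta' f /\ C0 dist' eta' g) \/
  exists2 Q, cube D' Q &
    (f = cind R Q /\ g = cind R Q) \/
    (f = cind R Q /\ adapted0 mu' Q g) \/
    (adapted0 mu' Q f /\ g = cind R Q).

Definition partial_cz (eta eta' : R) (D' : int -> set (set Y))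
    (L : form R X Y) : Prop :=
  exists (K : (Y -> R[i]) -> (Y -> R[i]) -> X -> X -> R[i])
         (C : (Y -> R[i]) -> (Y -> R[i]) -> R),
    (forall f2 g2, partial_pair eta' D' f2 g2 ->
       cz_kernel (C f2 g2) (K f2 g2) /\
       forall f1 g1, C0 dist eta f1 -> C0 dist eta g1 ->
         disjoint_supp dist f1 g1 ->
         L f1 f2 g1 g2 =
         cintegral mu setT (fun y => cintegral mu setT (fun x =>
           K f2 g2 x y * f1 y * g1 x))) /\
    (exists C' : R, forall Q, cube D' Q -> forall u, adapted0 mu' Q u ->
       C (cind R Q) (cind R Q) + C (cind R Q) u + C u (cind R Q) <=
       C' * fine (mu' Q)).

End PartialKernel.

Section Product.
Context (R : realType) (disp1 disp2 : measure_display).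
Context (X1 : measurableType disp1) (X2 : measurableType disp2).
Variables (d1 : X1 -> X1 -> R) (d2 : X2 -> X2 -> R).
Variables (mu1 : {sigma_finite_measure set X1 -> \bar R}).
Variables (mu2 : {sigma_finite_measure set X2 -> \bar R}).

Local Notation XX := (X1 * X2)%type.
Local Notation mu := (mu1 \x mu2)%E.

Definition rectangles : set (set XX) :=
  [set Q | exists B1 B2, [/\ balls d1 B1, balls d2 B2 & Q = B1 `*` B2]].

Definition popen : set (set XX) :=
  [set U | forall x, U x ->
    exists2 r, 0 < r & qball d1 x.1 r `*` qball d2 x.2 r `<=` U].

Definition L1loc (b : XX -> R[i]) : Prop :=
  forall Q, rectangles Q -> cintegrable mu Q b.

Definition mean_ge0 (Q : set XX) (w : XX -> R) : \bar R :=
  ((mu Q)^-1 * \int[mu]_(x in Q) (w x)%:E)%E.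

Definition Ap_const (p : R) (w : XX -> R) : \bar R :=
  ereal_sup [set (mean_ge0 Q w *
    poweR (mean_ge0 Q (fun x => (w x `^ (- (p - 1)^-1))%R)) (p - 1)%R)%E |
    Q in rectangles].

(* Positivity a.e. is implicit in the finiteness of the integrals of
   [w ^ (-1/(p-1))]; it has to be explicit here because [0 `^ a = 0] for
   [a < 0] in the library. *)
Record Ap_weight (p : R) (w : XX -> R) : Prop := {
  Ap_ge0 : forall x, 0 <= w x ;
  Ap_loc : forall Q, rectangles Q -> mu.-integrable Q (fun x => (w x)%:E) ;
  Ap_gt0 : {ae mu, forall x, 0 < w x} ;
  Ap_fin : (Ap_const p w < +oo)%E }.

Definition wLp_norm (p : R) (w : XX -> R) (f : XX -> R[i]) : \bar R :=
  poweR (\int[mu]_x (cabs (f x) `^ p * w x)%:E) p^-1.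

Definition bmo_norm (w : XX -> R) (b : XX -> R[i]) : \bar R :=
  ereal_sup [set ((\int[mu]_(x in Q) (w x)%:E)^-1 *
    \int[mu]_(x in Q) (cabs (b x - cmean mu Q b))%:E)%E | Q in rectangles].

Definition bmo (w : XX -> R) (b : XX -> R[i]) : Prop :=
  L1loc b /\ (bmo_norm w b < +oo)%E.

(* Bilinear pairing, without conjugation. *)
Definition pairing (f g : XX -> R[i]) : R[i] :=
  cintegral mu setT (fun x => f x * g x).

(* [T] is a linear operator, defined up to a.e. equality on a space [dom] of
   functions that contains the bounded functions of bounded support (so that
   it can be applied to indicators of cubes, and the commutator is densely
   defined), and weakly sequentially continuous on the latter.  The extension
   of a Journé operator given by the T1 theorem, which is bounded on L^2, has
   these properties. *)
Record linear_operator (dom : set (XX -> R[i]))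
    (T : (XX -> R[i]) -> XX -> R[i]) : Prop := {
  lo_dom_measurable : forall f, dom f -> cmeasurable f ;
  lo_dom_linear : forall (a : R[i]) f g, dom f -> dom g ->
    dom (fun x => a * f x + g x) ;
  lo_dom_bounded : forall f, bounded_supp rectangles f -> dom f ;
  lo_measurable : forall f, dom f -> cmeasurable (T f) ;
  lo_ae : forall f g, dom f -> dom g -> {ae mu, forall x, f x = g x} ->
    {ae mu, forall x, T f x = T g x} ;
  lo_linear : forall (a : R[i]) f g, dom f -> dom g ->
    {ae mu, forall x, T (fun y => a * f y + g y) x = a * T f x + T g x} ;
  lo_L1loc : forall f, bounded_supp rectangles f -> L1loc (T f) ;
  lo_continuous : forall (Q : set XX) (M : R) (f_ : nat -> XX -> R[i]) f g,
    rectangles Q -> (forall n, bounded_on Q M (f_ n)) -> bounded_on Q M f ->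
    {ae mu, forall x, ccvg (fun n => f_ n x) (f x)} ->
    bounded_supp rectangles g ->
    ccvg (fun n => pairing (T (f_ n)) g) (pairing (T f) g) }.

Definition commutator (b : XX -> R[i]) (T : (XX -> R[i]) -> XX -> R[i])
    (f : XX -> R[i]) (x : XX) : R[i] :=
  b x * T f x - T (fun y => b y * f y) x.

(* Norm from L^p_w to L^p_w' of the operator [b,T], whose domain consists of
   the [f] such that both [T f] and [T (b f)] are defined. *)
Definition commutator_norm (p : R) (w w' : XX -> R) (dom : set (XX -> R[i]))
    (T : (XX -> R[i]) -> XX -> R[i]) (b : XX -> R[i]) : \bar R :=
  ereal_sup [set wLp_norm p w' (commutator b T f) | f in
    [set f | [/\ dom f, dom (fun x => b x * f x) & (wLp_norm p w f <= 1)%E]]].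

(* Chang-Fefferman Carleson condition for a functional [beta] on tensors of
   zero-mean functions.  For cubes Q1, Q2 the sum over the children P1, P2
   is the squared L^2 norm of the martingale difference
   Delta_Q1 (x) Delta_Q2 of beta, i.e. the sum of the squares of its
   coefficients on all Haar functions of Q1 x Q2. *)
Definition product_BMO (beta : (X1 -> R[i]) -> (X2 -> R[i]) -> R[i]) : Prop :=
  forall D1 D2, dyadic_system d1 D1 -> dyadic_system d2 D2 ->
  exists C : R, forall Omega, popen Omega -> (mu Omega < +oo)%E ->
    (\esum_(q in [set q : (set X1 * set X1) * (set X2 * set X2) |
        [/\ child D1 q.1.1 q.1.2, child D2 q.2.1 q.2.2 &
            q.1.1 `*` q.2.1 `<=` Omega]])
       (fine (mu1 q.1.2) * fine (mu2 q.2.2) *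
        cabs (beta (haar mu1 q.1.1 q.1.2) (haar mu2 q.2.1 q.2.2)) ^+ 2)%:E
     <= C%:E * mu Omega)%E.

(* The functional T1: <T1, g1 (x) g2> is the limit of
   <T (chi_B1 (x) chi_B2), g1 (x) g2> as the balls B1, B2 exhaust X1, X2, for
   g1, g2 bounded with bounded support and zero mean. *)
Definition image_of_one (L : form R X1 X2)
    (beta : (X1 -> R[i]) -> (X2 -> R[i]) -> R[i]) : Prop :=
  forall o1 o2 g1 g2,
    bounded_supp (balls d1) g1 -> cintegral mu1 setT g1 = 0 ->
    bounded_supp (balls d2) g2 -> cintegral mu2 setT g2 = 0 ->
    ccvg (fun n => L (cind R (qball d1 o1 n%:R)) (cind R (qball d2 o2 n%:R))
                     g1 g2) (beta g1 g2).

Definition one_in_BMO (L : form R X1 X2) : Prop :=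
  exists2 beta, image_of_one L beta & product_BMO beta.

Section Journe.
Variables (A0 delta : R).

Local Notation V1 := (vol d1 mu1).
Local Notation V2 := (vol d2 mu2).
Local Notation near1 := (near d1 A0).
Local Notation near2 := (near d2 A0).
Local Notation gain1 := (gain d1 mu1 delta).
Local Notation gain2 := (gain d2 mu2 delta).

Definition off_diagonal : set (XX * XX) :=
  [set z | z.1.1 <> z.2.1 /\ z.1.2 <> z.2.2].

Record journe_kernel (C : R) (K : XX -> XX -> R[i]) : Prop := {
  jk_measurable : cmeasurable_on off_diagonal (fun z => K z.1 z.2) ;
  jk_size : forall x1 x2 y1 y2, x1 <> y1 -> x2 <> y2 ->
    cabs (K (x1, x2) (y1, y2)) <= C / (V1 x1 y1 * V2 x2 y2) ;
  jk_holder_yy : forall x1 x2 y1 y2 y1' y2', x1 <> y1 -> x2 <> y2 ->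
    near1 x1 y1 y1 y1' -> near2 x2 y2 y2 y2' ->
    cabs (K (x1, x2) (y1, y2) - K (x1, x2) (y1, y2')
          - K (x1, x2) (y1', y2) + K (x1, x2) (y1', y2')) <=
    C * (gain1 x1 y1 y1 y1' * gain2 x2 y2 y2 y2') ;
  jk_holder_xx : forall x1 x2 y1 y2 x1' x2', x1 <> y1 -> x2 <> y2 ->
    near1 x1 y1 x1 x1' -> near2 x2 y2 x2 x2' ->
    cabs (K (x1, x2) (y1, y2) - K (x1, x2') (y1, y2)
          - K (x1', x2) (y1, y2) + K (x1', x2') (y1, y2)) <=
    C * (gain1 x1 y1 x1 x1' * gain2 x2 y2 x2 x2') ;
  jk_holder_yx : forall x1 x2 y1 y2 y1' x2', x1 <> y1 -> x2 <> y2 ->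
    near1 x1 y1 y1 y1' -> near2 x2 y2 x2 x2' ->
    cabs (K (x1, x2) (y1, y2) - K (x1, x2') (y1, y2)
          - K (x1, x2) (y1', y2) + K (x1, x2') (y1', y2)) <=
    C * (gain1 x1 y1 y1 y1' * gain2 x2 y2 x2 x2') ;
  jk_holder_xy : forall x1 x2 y1 y2 x1' y2', x1 <> y1 -> x2 <> y2 ->
    near1 x1 y1 x1 x1' -> near2 x2 y2 y2 y2' ->
    cabs (K (x1, x2) (y1, y2) - K (x1, x2) (y1, y2')
          - K (x1', x2) (y1, y2) + K (x1', x2) (y1, y2')) <=
    C * (gain1 x1 y1 x1 x1' * gain2 x2 y2 y2 y2') ;
  jk_mixed_x1 : forall x1 x2 y1 y2 x1', x1 <> y1 -> x2 <> y2 ->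
    near1 x1 y1 x1 x1' ->
    cabs (K (x1, x2) (y1, y2) - K (x1', x2) (y1, y2)) <=
    C * (gain1 x1 y1 x1 x1' / V2 x2 y2) ;
  jk_mixed_y1 : forall x1 x2 y1 y2 y1', x1 <> y1 -> x2 <> y2 ->
    near1 x1 y1 y1 y1' ->
    cabs (K (x1, x2) (y1, y2) - K (x1, x2) (y1', y2)) <=
    C * (gain1 x1 y1 y1 y1' / V2 x2 y2) ;
  jk_mixed_x2 : forall x1 x2 y1 y2 x2', x1 <> y1 -> x2 <> y2 ->
    near2 x2 y2 x2 x2' ->
    cabs (K (x1, x2) (y1, y2) - K (x1, x2') (y1, y2)) <=
    C * ((V1 x1 y1)^-1 * gain2 x2 y2 x2 x2') ;
  jk_mixed_y2 : forall x1 x2 y1 y2 y2', x1 <> y1 -> x2 <> y2 ->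
    near2 x2 y2 y2 y2' ->
    cabs (K (x1, x2) (y1, y2) - K (x1, x2) (y1, y2')) <=
    C * ((V1 x1 y1)^-1 * gain2 x2 y2 y2 y2') }.

Variables (eta1 eta2 : R).
Variables (D1 : int -> set (set X1)) (D2 : int -> set (set X2)).

Definition operator_form (T : (XX -> R[i]) -> XX -> R[i]) : form R X1 X2 :=
  fun f1 f2 g1 g2 => pairing (T (tensor f1 f2)) (tensor g1 g2).

Definition full_kernel_representation (K : XX -> XX -> R[i])
    (L : form R X1 X2) : Prop :=
  forall f1 f2 g1 g2,
    C0 d1 eta1 f1 -> C0 d2 eta2 f2 -> C0 d1 eta1 g1 -> C0 d2 eta2 g2 ->
    disjoint_supp d1 f1 g1 -> disjoint_supp d2 f2 g2 ->
    L f1 f2 g1 g2 =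
    cintegral mu setT (fun x => cintegral mu setT (fun y =>
      K x y * tensor f1 f2 y * tensor g1 g2 x)).

Definition weak_boundedness (L : form R X1 X2) : Prop :=
  exists C : R, forall Q1 Q2, cube D1 Q1 -> cube D2 Q2 ->
    cabs (L (cind R Q1) (cind R Q2) (cind R Q1) (cind R Q2)) <=
    C * (fine (mu1 Q1) * fine (mu2 Q2)).

Definition diagonal_BMO (L : form R X1 X2) : Prop :=
  exists C : R, forall Q1 Q2 a b, cube D1 Q1 -> cube D2 Q2 ->
    adapted0 mu1 Q1 a -> adapted0 mu2 Q2 b ->
    [/\ cabs (L a (cind R Q2) (cind R Q1) (cind R Q2)) <=
          C * (fine (mu1 Q1) * fine (mu2 Q2)),
        cabs (L (cind R Q1) (cind R Q2) a (cind R Q2)) <=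
          C * (fine (mu1 Q1) * fine (mu2 Q2)),
        cabs (L (cind R Q1) b (cind R Q1) (cind R Q2)) <=
          C * (fine (mu1 Q1) * fine (mu2 Q2)) &
        cabs (L (cind R Q1) (cind R Q2) (cind R Q1) b) <=
          C * (fine (mu1 Q1) * fine (mu2 Q2))].

Record journe_operator (dom : set (XX -> R[i]))
    (T : (XX -> R[i]) -> XX -> R[i]) (K : XX -> XX -> R[i]) : Prop := {
  jo_linear : linear_operator dom T ;
  jo_kernel : exists C : R, journe_kernel C K ;
  jo_representation : full_kernel_representation K (operator_form T) ;
  jo_partial1 :
    partial_cz d1 d2 mu1 mu2 A0 delta eta1 eta2 D2 (operator_form T) ;
  jo_partial2 :
    partial_cz d2 d1 mu2 mu1 A0 delta eta2 eta1 D1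
      (swap_form (operator_form T)) ;
  jo_BMO_T : one_in_BMO (operator_form T) ;
  jo_BMO_Tadj : one_in_BMO (adj (operator_form T)) ;
  jo_BMO_T1 : one_in_BMO (padj (operator_form T)) ;
  jo_BMO_T1adj : one_in_BMO (adj (padj (operator_form T))) ;
  jo_weak_boundedness : weak_boundedness (padj (operator_form T)) ;
  jo_diagonal_BMO : diagonal_BMO (padj (operator_form T)) }.

Definition homogeneous_condition (K : XX -> XX -> R[i]) : Prop :=
  exists c0 Cbar : R, [/\ 0 < c0, 0 < Cbar &
    forall x1 x2 r1 r2, 0 < r1 -> 0 < r2 ->
    exists y1 y2,
      [/\ (qball d1 x1 (Cbar * r1) `\` qball d1 x1 r1) y1,
          (qball d2 x2 (Cbar * r2) `\` qball d2 x2 r2) y2 &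
          (c0 * fine (mu1 (qball d1 x1 r1)) * fine (mu2 (qball d2 x2 r2)))^-1
          <= cabs (K (x1, x2) (y1, y2))]].

End Journe.

End Product.

(* Main.v *)
Require Import Defs.
From HB Require Import structures.
From mathcomp Require Import all_boot all_order all_algebra.
From mathcomp Require Import complex ring lra.
From mathcomp Require Import all_classical all_reals all_analysis.
From mathcomp Require Import measurable_realfun.

(** The commutator [b, T] has kernel [(b x - b y) K x y] off the diagonal, and
    the theorem inverts this formula on pairs of separated rectangles.

    Given a rectangle [Q] with centre [c], the homogeneous condition at a large
    multiple of the radii provides a second centre [c'], hence a translate [Q']
    of [Q], far away but of comparable measure, where [K c c'] is as large as
    the size condition allows. If the separation is large, the Hölder estimates
    make [K] equal to [K c c'] on [Q x Q'] up to a small relative error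
    ([kernel_nearly_constant]). Up to that error, pairing [b, T] applied to the
    indicator of a subset of [Q'] with the indicator of a subset of [Q]
    therefore gives the integral of [b x - b y] over the product of the two
    sets, times [K c c'].

    Such tests control the deviation of [b] from its mean on each of the two
    rectangles, and the difference of the two means, hence the mean value of [|b
    x - b y|] over [Q x Q']; the error is a small multiple of this same mean
    value and is absorbed ([absorption]). This requires the mean value to be
    finite, so [b] is first truncated to the sets where it is bounded, which
    also puts the test functions into the domain of the commutator; monotone
    convergence removes the truncation ([sublevel_limit]). The method works for
    complex-valued [b] and [K] alike, as no sign of the kernel is used.

    Two points need preparation. First, the kernel formula is assumed for
    tensors of Hölder functions, whereas the tests use [b] itself on arbitrary
    measurable sets: both sides of the formula are linear and continuous under
    bounded convergence in each function, so a functional monotone class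
    argument extends it to all bounded functions on the two rectangles
    ([class_holder_tensor], [kernel_representation]). For the kernel side to be
    an integral of a measurable function the diagonal has to be measurable,
    which follows from separability in the form of the countability of dyadic
    cubes ([measurable_diagonal]).

    Second, the norm inequality for the commutator bounds a test by the norm
    times a power of the first weight on [Q'] and of the dual of the second
    weight on [Q]. The A_p conditions and Hölder's inequality turn this product
    into the integral of [nu] over [Q] ([weights_bloom]). *)

Set Implicit Arguments.
Unset Strict Implicit.
Unset Printing Implicit Defensive.

Import Order.TTheory GRing.Theory Num.Theory.
Import numFieldNormedType.Exports.

Local Open Scope classical_set_scope.
Local Open Scope ring_scope.
Local Open Scope complex_scope.

(** * Complex-valued functions: modulus, measurability, integrals *)

Section ComplexModulus.
Context {R : realType}.
Implicit Types z w : R[i].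

Lemma cabs0 : cabs (0 : R[i]) = 0.
Proof. exact: ComplexField.Normc.normc0. Qed.

Lemma cabs_ge0 z : 0 <= cabs z.
Proof. by case: z => a b; exact: sqrtr_ge0. Qed.

Lemma cabsM z w : cabs (z * w) = cabs z * cabs w.
Proof. exact: ComplexField.Normc.normcM. Qed.

Lemma cabsV z : cabs z^-1 = (cabs z)^-1.
Proof. exact: ComplexField.Normc.normcV. Qed.

Lemma ler_cabsD z w : cabs (z + w) <= cabs z + cabs w.
Proof. exact: le_normcD. Qed.

Lemma cabsN z : cabs (- z) = cabs z.
Proof. exact: normcN. Qed.

Lemma cabs_real (r : R) : cabs r%:C = `|r|.
Proof. by rewrite /cabs /= expr0n /= addr0 sqrtr_sqr. Qed.

Lemma Re_le_cabs z : `|complex.Re z| <= cabs z.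
Proof.
case: z => a b; rewrite /cabs /= -sqrtr_sqr ler_sqrt; last first.
  by rewrite addr_ge0 // sqr_ge0.
by rewrite lerDl sqr_ge0.
Qed.

Lemma Im_le_cabs z : `|complex.Im z| <= cabs z.
Proof.
case: z => a b; rewrite /cabs /= -sqrtr_sqr ler_sqrt; last first.
  by rewrite addr_ge0 // sqr_ge0.
by rewrite lerDr sqr_ge0.
Qed.

Lemma cabs_le_ReIm z : cabs z <= `|complex.Re z| + `|complex.Im z|.
Proof.
case: z => a b; rewrite /cabs /=.
rewrite -[leRHS]ger0_norm ?addr_ge0 // -sqrtr_sqr ler_sqrt ?sqr_ge0 //.
rewrite sqrrD !real_normK ?num_real // lerD2r lerDl.
by rewrite mulrn_wge0 // mulr_ge0.
Qed.

Lemma ReD z w : complex.Re (z + w) = complex.Re z + complex.Re w.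
Proof. by case: z => a b; case: w. Qed.

Lemma ImD z w : complex.Im (z + w) = complex.Im z + complex.Im w.
Proof. by case: z => a b; case: w. Qed.

Lemma ReM z w : complex.Re (z * w) =
  complex.Re z * complex.Re w - complex.Im z * complex.Im w.
Proof. by case: z => a b; case: w. Qed.

Lemma ImM z w : complex.Im (z * w) =
  complex.Re z * complex.Im w + complex.Im z * complex.Re w.
Proof. by case: z => a b; case: w. Qed.

Lemma ReB z w : complex.Re (z - w) = complex.Re z - complex.Re w.
Proof. by case: z => a b; case: w. Qed.

Lemma ImB z w : complex.Im (z - w) = complex.Im z - complex.Im w.
Proof. by case: z => a b; case: w. Qed.

Lemma complex_eq z w :
  complex.Re z = complex.Re w -> complex.Im z = complex.Im w -> z = w.
Proof. by case: z => a b; case: w => c d /= -> ->. Qed.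

Lemma ccvgP (u : nat -> R[i]) (l : R[i]) : ccvg u l <->
  ((fun n => complex.Re (u n)) @ \oo --> complex.Re l) /\
  ((fun n => complex.Im (u n)) @ \oo --> complex.Im l).
Proof.
split=> [ul|[ure uim]].
  split; apply/cvgrPdistC_lt => e e0; move/cvgrPdistC_lt : ul => /(_ e e0);
    apply: filterS => n; rewrite subr0 ger0_norm ?cabs_ge0 //;
    apply: le_lt_trans.
  - by rewrite -ReB Re_le_cabs.
  - by rewrite -ImB Im_le_cabs.
apply/cvgrPdistC_lt => e e0.
have e2 : 0 < e / 2 by rewrite divr_gt0.
move/cvgrPdistC_lt : ure => /(_ _ e2); move/cvgrPdistC_lt : uim => /(_ _ e2).
apply: filterS2 => n him hre; rewrite subr0 ger0_norm ?cabs_ge0 //.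
apply: le_lt_trans (cabs_le_ReIm _) _; rewrite ReB ImB.
by rewrite (splitr e) ltrD.
Qed.

Lemma ccvg_unique (u : nat -> R[i]) (l l' : R[i]) :
  ccvg u l -> ccvg u l' -> l = l'.
Proof.
move=> /ccvgP[r i] /ccvgP[r' i']; apply: complex_eq.
- exact: (cvg_unique _ r r').
- exact: (cvg_unique _ i i').
Qed.

Lemma ccvgM (u v : nat -> R[i]) (l m : R[i]) :
  ccvg u l -> ccvg v m -> ccvg (fun n => u n * v n) (l * m).
Proof.
move=> /ccvgP[ur ui] /ccvgP[vr vi]; apply/ccvgP; rewrite ReM ImM.
split.
- under eq_fun do rewrite ReM.
  by apply: cvgB; exact: cvgM.
- under eq_fun do rewrite ImM.
  by apply: cvgD; exact: cvgM.
Qed.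

Lemma ccvg_cst (l : R[i]) : ccvg (fun=> l) l.
Proof. by rewrite /ccvg subrr cabs0; exact: cvg_cst. Qed.

Lemma ccvg_real (u : nat -> R) (l : R) :
  u @ \oo --> l -> ccvg (fun n => (u n)%:C) l%:C.
Proof. by move=> ul; apply/ccvgP; split => //=; exact: cvg_cst. Qed.

End ComplexModulus.

Section ComplexMeasurable.
Context {R : realType} {disp : measure_display} {X : measurableType disp}.
Implicit Types (f g : X -> R[i]) (A : set X).

Lemma cmeasurableD f g :
  cmeasurable f -> cmeasurable g -> cmeasurable (fun x => f x + g x).
Proof.
move=> [fr fi] [gr gi]; split.
- by under eq_fun do rewrite ReD; exact: measurable_funD.
- by under eq_fun do rewrite ImD; exact: measurable_funD.
Qed.

Lemma cmeasurableM f g :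
  cmeasurable f -> cmeasurable g -> cmeasurable (fun x => f x * g x).
Proof.
move=> [fr fi] [gr gi]; split.
- under eq_fun do rewrite ReM.
  by apply: measurable_funB; exact: measurable_funM.
- under eq_fun do rewrite ImM.
  by apply: measurable_funD; exact: measurable_funM.
Qed.

Lemma cmeasurable_cst (z : R[i]) : cmeasurable (fun _ : X => z).
Proof. by split; exact: measurable_cst. Qed.

Lemma cmeasurable_real (u : X -> R) :
  measurable_fun setT u -> cmeasurable (fun x => (u x)%:C).
Proof. by move=> mu; split => //=; exact: measurable_cst. Qed.

Lemma cmeasurable_cind A : measurable A -> cmeasurable (cind R A).
Proof. by move=> mA; apply: cmeasurable_real; exact: measurable_indic. Qed.

Lemma cmeasurableB f g :
  cmeasurable f -> cmeasurable g -> cmeasurable (fun x => f x - g x).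
Proof.
move=> [fr fi] [gr gi]; split.
- by under eq_fun do rewrite ReB; exact: measurable_funB.
- by under eq_fun do rewrite ImB; exact: measurable_funB.
Qed.

Lemma measurable_cabs A f : cmeasurable_on A f ->
  measurable_fun A (fun x => cabs (f x)).
Proof.
move=> [fr fi].
have -> : (fun x => cabs (f x)) =
    (fun x => (complex.Re (f x) ^+ 2 + complex.Im (f x) ^+ 2) `^ 2^-1).
  apply/funext => x; rewrite powR12_sqrt; last by rewrite addr_ge0 // sqr_ge0.
  by case: (f x).
apply: (measurableT_comp (measurable_powR _)).
by apply: measurable_funD; exact: measurable_funX.
Qed.

(** Outside [A] the product is the constant zero, so only the measurability of
    [f] on [A] matters. *)
Lemma cmeasurable_mul_cind A f : measurable A -> cmeasurable_on A f ->
  cmeasurable (fun x => f x * cind R A x).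
Proof.
move=> mA [fr fi]; split.
- rewrite (_ : (fun x => _) = (fun x => complex.Re (f x)) \_ A); last first.
    apply/funext => x; rewrite /cind /patch indicE ReM /= mulr0 subr0.
    by case: (x \in A); rewrite ?mulr1 ?mulr0.
  exact/(measurable_restrictT _ mA).1.
- rewrite (_ : (fun x => _) = (fun x => complex.Im (f x)) \_ A); last first.
    apply/funext => x; rewrite /cind /patch indicE ImM /= mulr0 add0r.
    by case: (x \in A); rewrite ?mulr1 ?mulr0.
  exact/(measurable_restrictT _ mA).1.
Qed.

Lemma cmeasurable_onS A B f : measurable B -> A `<=` B ->
  cmeasurable_on B f -> cmeasurable_on A f.
Proof. by move=> mB AB [? ?]; split; exact: (measurable_funS mB AB). Qed.

Lemma cmeasurable_cvg (f_ : nat -> X -> R[i]) f :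
  (forall n, cmeasurable (f_ n)) ->
  (forall x, ccvg (fun n => f_ n x) (f x)) -> cmeasurable f.
Proof.
move=> mf fl; split.
- apply: (@measurable_fun_cvg _ _ _ _ (fun n x => complex.Re (f_ n x))).
  + by move=> n; case: (mf n).
  + by move=> x _; case: (ccvgP (fun n => f_ n x) (f x)).1.
- apply: (@measurable_fun_cvg _ _ _ _ (fun n x => complex.Im (f_ n x))).
  + by move=> n; case: (mf n).
  + by move=> x _; case: (ccvgP (fun n => f_ n x) (f x)).1.
Qed.

End ComplexMeasurable.

Section ComplexIntegral.
Context {R : realType} {disp : measure_display} {X : measurableType disp}.
Variable mu : {measure set X -> \bar R}.
Implicit Types (f g : X -> R[i]) (A D : set X).

Lemma cintegrable_le D f (h : X -> R) : measurable D -> cmeasurable_on D f ->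
  mu.-integrable D (EFin \o h) -> (forall x, D x -> cabs (f x) <= h x) ->
  cintegrable mu D f.
Proof.
move=> mD [mr mi] ih fh; split.
- apply: (le_integrable mD _ _ ih).
  + exact/measurable_EFinP.
  + move=> x Dx /=; rewrite lee_fin (le_trans (Re_le_cabs _))//.
    by rewrite (le_trans (fh x Dx)) // ler_norm.
- apply: (le_integrable mD _ _ ih).
  + exact/measurable_EFinP.
  + move=> x Dx /=; rewrite lee_fin (le_trans (Im_le_cabs _))//.
    by rewrite (le_trans (fh x Dx)) // ler_norm.
Qed.

Lemma cintegrable_cabs D f : measurable D -> cintegrable mu D f ->
  mu.-integrable D (EFin \o (fun x => cabs (f x))).
Proof.
move=> mD [ir ii].
have mf : cmeasurable_on D f.
  by split; apply/measurable_EFinP;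
    [exact: measurable_int ir|exact: measurable_int ii].
apply: (le_integrable mD _ _ (integrableD mD (integrable_norm ir)
  (integrable_norm ii))).
- exact/measurable_EFinP/measurable_cabs.
- move=> x Dx /=; rewrite lee_fin (ger0_norm (cabs_ge0 _)) ger0_norm ?addr_ge0
  //.
  exact: cabs_le_ReIm.
Qed.

Lemma cintegrableD D f g : measurable D -> cintegrable mu D f ->
  cintegrable mu D g -> cintegrable mu D (fun x => f x + g x).
Proof.
move=> mD [fr fi] [gr gi]; split.
- by apply: eq_integrable (integrableD mD fr gr) => // x _ /=; rewrite ReD.
- by apply: eq_integrable (integrableD mD fi gi) => // x _ /=; rewrite ImD.
Qed.

Lemma cintegrableZ D f (z : R[i]) : measurable D -> cintegrable mu D f ->
  cintegrable mu D (fun x => z * f x).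
Proof.
move=> mD [fr fi]; split.
- apply: eq_integrable (integrableB mD (integrableZl mD (complex.Re z) fr)
    (integrableZl mD (complex.Im z) fi)) => //.
  by move=> x _ /=; rewrite ReM.
- apply: eq_integrable (integrableD mD (integrableZl mD (complex.Re z) fi)
    (integrableZl mD (complex.Im z) fr)) => //.
  by move=> x _ /=; rewrite ImM.
Qed.

Lemma cintegralD D f g : measurable D -> cintegrable mu D f ->
  cintegrable mu D g ->
  cintegral mu D (fun x => f x + g x) = cintegral mu D f + cintegral mu D g.
Proof.
move=> mD [fr fi] [gr gi]; apply: complex_eq; rewrite ?ReD ?ImD /cintegral /=.
- by under eq_Rintegral do rewrite ReD; exact: RintegralD.
- by under eq_Rintegral do rewrite ImD; exact: RintegralD.
Qed.

Lemma cintegralZ D f (z : R[i]) : measurable D -> cintegrable mu D f ->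
  cintegral mu D (fun x => z * f x) = z * cintegral mu D f.
Proof.
move=> mD [fr fi]; apply: complex_eq; rewrite ?ReM ?ImM /cintegral /=.
- under eq_Rintegral do rewrite ReM.
  have [iZr iZi] := (integrableZl mD (complex.Re z) fr,
    integrableZl mD (complex.Im z) fi).
  rewrite (RintegralB mD iZr iZi) ?RintegralZl //.
- under eq_Rintegral do rewrite ImM.
  have [iZi iZr] := (integrableZl mD (complex.Re z) fi,
    integrableZl mD (complex.Im z) fr).
  rewrite (RintegralD mD iZi iZr) ?RintegralZl //.
Qed.

Lemma eq_cintegral D f g : (forall x, D x -> f x = g x) ->
  cintegral mu D f = cintegral mu D g.
Proof.
move=> fg; rewrite /cintegral; congr (_ +i* _);
  by apply: eq_Rintegral => x; rewrite inE => Dx; rewrite fg.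
Qed.

Lemma eq_cintegrable D f g : measurable D -> (forall x, D x -> f x = g x) ->
  cintegrable mu D f -> cintegrable mu D g.
Proof.
move=> mD fg [fr fi]; split;
  [apply: eq_integrable fr|apply: eq_integrable fi] => //;
  by move=> x; rewrite inE => Dx; rewrite fg.
Qed.

Lemma cintegralB D f g : measurable D -> cintegrable mu D f ->
  cintegrable mu D g ->
  cintegral mu D (fun x => f x - g x) = cintegral mu D f - cintegral mu D g.
Proof.
move=> mD fi gi; rewrite -[- cintegral mu D g]mulN1r -cintegralZ // -cintegralD
  //.
  by apply: eq_cintegral => x _; rewrite mulN1r.
exact: cintegrableZ.
Qed.

Lemma cintegrableB D f g : measurable D -> cintegrable mu D f ->
  cintegrable mu D g -> cintegrable mu D (fun x => f x - g x).
Proof.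
move=> mD fi gi.
apply: (@eq_cintegrable D (fun x => f x + -1 * g x)) => //.
  by move=> x _; rewrite mulN1r.
by apply: cintegrableD => //; exact: cintegrableZ.
Qed.

(** Bounding the real and the imaginary part separately avoids rotating the
    integral to the real axis, at the price of the factor 2. *)
Lemma cabs_cintegral D f : measurable D -> cintegrable mu D f ->
  cabs (cintegral mu D f) <= 2 * Rintegral mu D (fun x => cabs (f x)).
Proof.
move=> mD fi; have [ir ii] := fi; have ia := cintegrable_cabs mD fi.
apply: le_trans (cabs_le_ReIm _) _; rewrite /cintegral /= mulr2n mulrDl mul1r.
apply: lerD.
- apply: le_trans (le_normr_Rintegral mD ir) _.
  apply: le_Rintegral => //; first exact: integrable_norm.
  by move=> x _; exact: Re_le_cabs.
- apply: le_trans (le_normr_Rintegral mD ii) _.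
  apply: le_Rintegral => //; first exact: integrable_norm.
  by move=> x _; exact: Im_le_cabs.
Qed.


Lemma Rintegral_dominated (f_ : nat -> X -> R) (f h : X -> R) :
  (forall n, measurable_fun setT (f_ n)) -> measurable_fun setT f ->
  mu.-integrable setT (EFin \o h) ->
  (forall n x, `|f_ n x| <= h x) ->
  (forall x, (fun n => f_ n x) @ \oo --> f x) ->
  (fun n => Rintegral mu setT (f_ n)) @ \oo --> Rintegral mu setT f.
Proof.
move=> mf_ mf ih fh fl; rewrite /Rintegral; apply: fine_cvg.
have fle x : (fun n => (f_ n x)%:E) @ \oo --> (f x)%:E.
  by apply: cvg_EFin; [exact: nearW|exact: fl].
have [fint _ cv] := @dominated_convergence _ _ _ mu setT measurableT
    (fun n x => (f_ n x)%:E) (fun x => (f x)%:E) (EFin \o h)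
    (fun n => (measurable_EFinP _ _).2 (mf_ n)) ((measurable_EFinP _ _).2 mf)
    (aeW mu (fun x _ => fle x)) ih
    (aeW mu (fun x n _ => fh n x)).
by rewrite fineK //; exact: integrable_fin_num.
Qed.

Lemma cintegral_dominated (f_ : nat -> X -> R[i]) f (h : X -> R) :
  (forall n, cmeasurable (f_ n)) -> mu.-integrable setT (EFin \o h) ->
  (forall n x, cabs (f_ n x) <= h x) ->
  (forall x, ccvg (fun n => f_ n x) (f x)) ->
  ccvg (fun n => cintegral mu setT (f_ n)) (cintegral mu setT f).
Proof.
move=> mf ih fh fl.
have [mr mi] := cmeasurable_cvg mf fl.
apply/ccvgP; split; rewrite /cintegral /=.
- apply: (Rintegral_dominated _ mr ih).
  + by move=> n; case: (mf n).
  + by move=> n x; exact: le_trans (Re_le_cabs _) (fh n x).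
  + by move=> x; case: (ccvgP (fun n => f_ n x) (f x)).1.
- apply: (Rintegral_dominated _ mi ih).
  + by move=> n; case: (mf n).
  + by move=> n x; exact: le_trans (Im_le_cabs _) (fh n x).
  + by move=> x; case: (ccvgP (fun n => f_ n x) (f x)).1.
Qed.

End ComplexIntegral.

(** * Quasi-metrics with regularity and doubling measures *)

Section QuasiMetric.
Context {R : realType} {disp : measure_display} {X : measurableType disp}.
Variables (d : X -> X -> R) (mu : {measure set X -> \bar R}) (A0 theta : R).
Hypothesis hX : homogeneous_space d mu A0 theta.

Let qm := hs_quasi_metric hX.

Lemma qdist_xx x : d x x = 0.
Proof. exact/(qm_eq0 qm). Qed.

Lemma qdist_gt0 x y : x <> y -> 0 < d x y.
Proof.
move=> xy; rewrite lt_neqAle (qm_ge0 qm) andbT; apply/eqP => d0.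
by apply: xy; apply/(qm_eq0 qm).
Qed.

Lemma qball_center x r : 0 < r -> qball d x r x.
Proof. by move=> r0; rewrite /qball /= qdist_xx. Qed.

Lemma quasi_constant_ge1 : 1 <= A0.
Proof.
have [x _] : [set: X] !=set0.
  by apply/set0P/eqP => X0; have := hs_infinite hX; rewrite X0 measure0.
have [y /eqP yx] : exists y, y != x.
  apply: contrapT => /forallNP h; have := hs_infinite hX.
  rewrite (_ : setT = [set x]) ?(hs_atomless hX)//.
  by apply/seteqP; split => y //= _; apply/eqP/negP/negP/negPn;
    have /negP := h y; rewrite negbK.
have := qm_triangle qm y x y; rewrite qdist_xx add0r.
by rewrite -[leLHS]mul1r ler_pM2r // qdist_gt0.
Qed.

(** A power of the quasi-distance with a small exponent satisfies the triangle
    inequality up to a factor on the increment, globally: for far points this is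
    trivial, and for close points regularity loses only powers of a quantity
    that dominates the displacement. *)
Lemma qdist_powR_holder (eta : R) : 0 < eta <= theta ->
  exists2 H : R, 0 < H & forall x x' y,
    `|d x y `^ eta - d x' y `^ eta| <= H * d x x' `^ eta.
Proof.
move=> /andP[e0 et]; have /andP[t0 t1] := hs_theta hX.
have [C hC] := hs_regular hX.
pose H := 1 + `|C| * 2 `^ (1 - theta).
have H1 : 1 <= H by rewrite lerDl mulr_ge0 ?powR_ge0.
exists H; first exact: lt_le_trans H1.
have dge0 := qm_ge0 qm.
suff main x x' y : d x' y <= d x y ->
    d x y `^ eta - d x' y `^ eta <= H * d x x' `^ eta.
  have mono u v w : d u w <= d v w -> 0 <= d v w `^ eta - d u w `^ eta.
    by move=> le; rewrite subr_ge0 ge0_ler_powR ?nnegrE ?(ltW e0).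
  move=> x x' y; have [le|/ltW le] := leP (d x' y) (d x y).
    by rewrite ger0_norm; [exact: main|exact: mono].
  by rewrite distrC (qm_sym qm x x') ger0_norm; [exact: main|exact: mono].
set a := d x y; set b := d x' y; set t := d x x' => ba.
have a0 : 0 <= a := dge0 _ _; have b0 : 0 <= b := dge0 _ _.
have tt0 : 0 <= t := dge0 _ _.
have [at_|ta] := leP a t.
  apply: (@le_trans _ _ (a `^ eta)); first by rewrite gerBl powR_ge0.
  apply: (@le_trans _ _ (t `^ eta));
    first by rewrite ge0_ler_powR ?nnegrE ?(ltW e0).
  by rewrite ler_peMl ?powR_ge0.
have {}a0 : 0 < a by exact: le_lt_trans ta.
have sle : b / a <= (b / a) `^ eta.
  have [->|bn0] := eqVneq b 0; first by rewrite mul0r powR_ge0.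
  apply: ger1_powR; last exact: le_trans et (ltW t1).
  have bgt0 : 0 < b by rewrite lt_neqAle eq_sym bn0.
  by rewrite divr_gt0 //= ler_pdivrMr // mul1r.
have ->: b `^ eta = a `^ eta * (b / a) `^ eta.
  by rewrite -powRM ?divr_ge0 // ?ltW // mulrC divfK ?gt_eqF.
have step1 : a `^ eta - a `^ eta * (b / a) `^ eta <= a `^ eta * ((a - b) / a).
  rewrite -[X in X - _]mulr1 -mulrBr ler_wpM2l ?powR_ge0 //.
  by rewrite mulrBl divff ?gt_eqF // lerD2l lerN2.
apply: le_trans step1 _.
have step2 : a - b <= `|C| * (t `^ theta * (2 `^ (1 - theta) * a `^ (1 -
  theta))).
  have := hC x x' y; rewrite -/a -/b -/t ger0_norm ?subr_ge0 // => h.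
  apply: le_trans h _; rewrite -mulrA.
  apply: (@le_trans _ _ (`|C| * (t `^ theta * (a + b) `^ (1 - theta)))).
    by rewrite ler_wpM2r ?mulr_ge0 ?powR_ge0 ?ler_norm.
  rewrite !ler_wpM2l ?powR_ge0 // -powRM ?(ltW a0) //.
  have ab2 : a + b <= 2 * a by rewrite mulr2n mulrDl mul1r lerD2l.
  apply: ge0_ler_powR => //; rewrite ?nnegrE ?subr_ge0 ?(ltW t1) //.
  - by rewrite addr_ge0 // ltW.
  - by rewrite mulr_ge0 // ltW.
have tsplit : t `^ theta = t `^ eta * t `^ (theta - eta).
  by rewrite -powRD ?subrKC // gt_eqF.
have asplit : a `^ (1 - theta) * a `^ (theta - eta) * a `^ eta = a.
  rewrite -!powRD ?(gt_eqF a0) ?implybT // subrKA subrK.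
  by rewrite powRr1 // ltW.
have tle : t `^ (theta - eta) <= a `^ (theta - eta).
  by apply: ge0_ler_powR; rewrite ?nnegrE ?subr_ge0 // ltW.
apply: (@le_trans _ _ (`|C| * 2 `^ (1 - theta) * t `^ eta)); last first.
  by rewrite ler_wpM2r ?powR_ge0 // lerDr.
rewrite mulrA ler_pdivrMr //.
apply: (@le_trans _ _ (a `^ eta * (`|C| * (t `^ eta * a `^ (theta - eta) *
    (2 `^ (1 - theta) * a `^ (1 - theta)))))).
  rewrite ler_wpM2l ?powR_ge0 //; apply: le_trans step2 _.
  rewrite tsplit ler_wpM2l // ler_wpM2r ?mulr_ge0 ?powR_ge0 //.
  by rewrite ler_wpM2l ?powR_ge0.
rewrite -[X in _ <= _ * X]asplit; rewrite le_eqVlt; apply/orP; left; apply/eqP;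
  ring.
Qed.

Lemma qball_qopen x r : qopen d (qball d x r).
Proof.
move=> y; rewrite /qball /= => yr.
have /andP[t0 t1] := hs_theta hX.
have [|H H0 hH] := @qdist_powR_holder theta; first by rewrite t0 lexx.
have dge0 := qm_ge0 qm.
have r0 : 0 < r := le_lt_trans (dge0 _ _) yr.
have gap : 0 < r `^ theta - d x y `^ theta.
  by rewrite subr_gt0 gt0_ltr_powR ?nnegrE ?(ltW r0).
exists (((r `^ theta - d x y `^ theta) / H) `^ theta^-1).
  by rewrite powR_gt0 // divr_gt0.
move=> z /= yz.
rewrite ltNge; apply/negP => rz.
have : r `^ theta <= d x z `^ theta
  by rewrite ge0_ler_powR ?nnegrE ?(ltW t0) ?(ltW r0).
apply/negP; rewrite -ltNge.
have yzt : d y z `^ theta < (r `^ theta - d x y `^ theta) / H.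
  have -> : (r `^ theta - d x y `^ theta) / H =
      (((r `^ theta - d x y `^ theta) / H) `^ theta^-1) `^ theta.
    by rewrite -powRrM mulVf ?gt_eqF // powRr1 // divr_ge0 // ltW.
  by rewrite gt0_ltr_powR ?nnegrE ?powR_ge0.
have := hH z y x; rewrite (qm_sym qm z x) (qm_sym qm y x) (qm_sym qm z y) => h.
rewrite ltr_pdivlMr // mulrC in yzt.
have := le_lt_trans (le_trans (ler_norm _) h) yzt.
by rewrite ltrD2r.
Qed.

Lemma measurable_qball x r : measurable (qball d x r).
Proof.
rewrite (hs_borel hX); apply: sub_sigma_algebra; exact: qball_qopen.
Qed.

Lemma qball_fin x r : 0 < r -> (mu (qball d x r) < +oo)%E.
Proof. by move=> r0; have [C /(_ x r r0)[]] := hs_doubling hX. Qed.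

Lemma bigcup_qball x r : 0 < r -> \bigcup_(n : nat) qball d x (n%:R * r) = setT.
Proof.
move=> r0; apply/seteqP; split => // y _.
exists (Num.truncn (d x y / r)).+1 => //; rewrite /qball /= -ltr_pdivrMr //.
exact: truncnS_gt.
Qed.

Lemma iter_doubling (n : nat) : exists2 G : R, 1 <= G &
  forall x r, 0 < r ->
    fine (mu (qball d x (2 ^+ n * r))) <= G * fine (mu (qball d x r)).
Proof.
have [C hC] := hs_doubling hX.
exists ((1 + `|C|) ^+ n); first by rewrite exprn_ege1 // lerDl.
elim: n => [|n IH] x r r0; first by rewrite !expr0 !mul1r.
have r0' : 0 < 2 ^+ n * r by rewrite mulr_gt0 ?exprn_gt0.
have [+ fb] := hC x _ r0'; rewrite mulrA -exprS => le.
have f2 := @qball_fin x (2 ^+ n.+1 * r) _.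
have fb' : mu (qball d x (2 ^+ n * r)) \is a fin_num.
  by rewrite ge0_fin_numE ?fb.
apply: (@le_trans _ _ ((1 + `|C|) * fine (mu (qball d x (2 ^+ n * r)))));
  last first.
  by rewrite [(1 + _) ^+ _]exprS -mulrA ler_wpM2l ?addr_ge0 ?IH.
apply: (@le_trans _ _ (C * fine (mu (qball d x (2 ^+ n * r))))).
  rewrite -lee_fin EFinM fineK ?fineK //.
  by rewrite ge0_fin_numE // f2 // mulr_gt0 // exprn_gt0.
by rewrite ler_wpM2r ?fine_ge0 // (le_trans (ler_norm _)) // lerDr.
Qed.

Lemma qballS x r s : r <= s -> qball d x r `<=` qball d x s.
Proof. by move=> rs y /= /lt_le_trans; apply. Qed.

Lemma le_fine_qball x y r s : 0 < s -> qball d x r `<=` qball d y s ->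
  fine (mu (qball d x r)) <= fine (mu (qball d y s)).
Proof.
move=> s0 sub.
have le : (mu (qball d x r) <= mu (qball d y s))%E.
  by apply: le_measure => //; rewrite inE; exact: measurable_qball.
apply: fine_le => //; rewrite ge0_fin_numE //; last exact: qball_fin.
exact: le_lt_trans le (qball_fin y s0).
Qed.

Lemma doubling_scale (s : R) : exists2 G : R, 1 <= G &
  forall x r, 0 < r ->
    fine (mu (qball d x (s * r))) <= G * fine (mu (qball d x r)).
Proof.
have [n sn] : exists n : nat, s <= 2 ^+ n.
  exists (Num.truncn `|s|).+1; apply: le_trans (ler_norm _) _.
  apply: le_trans (ltW (truncnS_gt _)) _.
  by rewrite -natrX ler_nat ltnW // ltn_expl.
have [G G1 hG] := iter_doubling n; exists G => // x r r0.
apply: le_trans (hG x r r0); apply: le_fine_qball.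
  by rewrite mulr_gt0 // exprn_gt0.
by apply: qballS; rewrite ler_wpM2r // ltW.
Qed.

Lemma qball_gt0 x r : 0 < r -> 0 < fine (mu (qball d x r)).
Proof.
move=> r0; rewrite lt_neqAle fine_ge0 // andbT; apply/eqP => m0.
suff : mu setT = 0%E by rewrite (hs_infinite hX).
have : mu.-negligible (\bigcup_(n : nat) qball d x (n%:R * r)).
  apply: negligible_bigcup => n.
  apply/negligibleP; first exact: measurable_qball.
  have [->|n0] := posnP n.
    rewrite mul0r (_ : qball _ _ _ = set0) ?measure0 //.
    by apply/seteqP; split => // y; rewrite /qball /= ltNge (qm_ge0 qm).
  have [G _ /(_ x r r0)] := doubling_scale n%:R; rewrite -m0 mulr0 => le.
  apply/eqP; rewrite -fine_eq0 ?ge0_fin_numE ?qball_fin ?mulr_gt0 ?ltr0n //.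
  by rewrite eq_le le fine_ge0.
by rewrite bigcup_qball // => /negligibleP; apply.
Qed.

End QuasiMetric.

(** * Separated balls, and the diagonal of the square *)

Section SeparatedBalls.
Context {R : realType} {disp : measure_display} {X : measurableType disp}.
Variables (d : X -> X -> R) (mu : {measure set X -> \bar R}) (A0 theta : R).
Hypothesis hX : homogeneous_space d mu A0 theta.

Let qm := hs_quasi_metric hX.
Let dge0 := qm_ge0 qm.
Let A01 := quasi_constant_ge1 hX.

Local Notation m x r := (fine (mu (qball d x r))).

Lemma qball_comparable (c c' : X) (s t r : R) : 0 < r ->
  d c c' < t * r -> qball d c' (s * r) `<=` qball d c (A0 * (t + s) * r).
Proof.
move=> r0 cc' z /= zc'; have A00 : 0 < A0 by exact: lt_le_trans A01.
apply: le_lt_trans (qm_triangle qm c z c') _.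
by rewrite -mulrA mulrDl ltr_pM2l // ltrD.
Qed.

(** Points of the two balls are at distance comparable to the distance of the
    centres, which makes all kernel bounds uniform over the pair of balls; the
    Hölder gain is then a negative power of the separation. *)
Lemma separated_balls (delta : R) : 0 < delta ->
  exists2 G : R, 1 <= G & forall A c c' r, 4 * A0 ^+ 3 <= A -> 0 < r ->
    A * r <= d c c' -> forall x y, qball d c r x -> qball d c' r y ->
    [/\ x <> y, (vol d mu x y)^-1 <= G / m c (A * r) &
        forall z z', d z z' < r -> Defs.near d A0 x y z z' /\
          gain d mu delta x y z z' <= G * A `^ (- delta) / m c (A * r)].
Proof.
move=> delta0; have A00 : 0 < A0 by exact: lt_le_trans A01.
have A0n0 : A0 != 0 by rewrite gt_eqF.
have [G0 G01 hG0] := doubling_scale hX (4 * A0 ^+ 3).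
pose P := (2 * A0 ^+ 2) `^ delta.
have P0 : 0 <= P := powR_ge0 _ _.
exists (G0 * (1 + P)); first by rewrite mulr_ege1 // lerDl.
move=> A c c' r hA r0 Ar x y cx c'y.
rewrite /qball /= in cx c'y.
have A_ge : 4 * A0 ^+ 2 <= A.
  apply: le_trans hA; rewrite ler_pM2l // (exprS _ 2) ler_peMl //.
  by rewrite exprn_ge0 // ltW.
have A0sq : A0 <= A0 ^+ 2 by rewrite expr2 ler_peMl // ltW.
have Agt0 : 0 < A by apply: lt_le_trans hA; rewrite mulr_gt0 // exprn_gt0.
have Dr : 4 * A0 ^+ 2 * r <= d c c'.
  by apply: le_trans Ar; rewrite ler_wpM2r // ltW.
have Dr3 : 4 * A0 ^+ 3 * r <= d c c'.
  by apply: le_trans Ar; rewrite ler_wpM2r // ltW.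
set D := d c c' in Ar Dr Dr3 *.
have D0 : 0 < D by apply: lt_le_trans Ar; rewrite mulr_gt0.
have dxy : D <= 2 * A0 ^+ 2 * d x y.
  have h1 : D <= A0 * (r + d x c').
    apply: le_trans (qm_triangle qm c c' x) _.
    by rewrite ler_pM2l // lerD2r ltW.
  have h2 : d x c' <= A0 * (d x y + r).
    apply: le_trans (qm_triangle qm x c' y) _.
    by rewrite ler_pM2l // lerD2l (qm_sym qm) ltW.
  have h3 : A0 * d x c' <= A0 * (A0 * (d x y + r)) by rewrite ler_pM2l.
  have h4 : A0 * r <= A0 ^+ 2 * r by rewrite ler_pM2r.
  rewrite -mulrA in Dr; set u := A0 ^+ 2 * r in Dr h4.
  have E : A0 * (A0 * (d x y + r)) = A0 ^+ 2 * d x y + u by rewrite /u; ring.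
  rewrite E in h3; rewrite mulrDr in h1.
  rewrite -mulrA; set v := A0 ^+ 2 * d x y in h3 *; lra.
have xy : x <> y.
  by move=> E; move: dxy; rewrite E (qdist_xx hX) mulr0 leNgt D0.
have dxy0 : 0 < d x y := qdist_gt0 hX xy.
have m0 : 0 < m c (A * r) by apply: (qball_gt0 hX); rewrite mulr_gt0.
have V0 : 0 < vol d mu x y := qball_gt0 hX x dxy0.
have Vle : m c (A * r) <= G0 * vol d mu x y.
  apply: (@le_trans _ _ (m x (4 * A0 ^+ 3 * d x y))); last exact: hG0.
  apply: (le_fine_qball hX); first by rewrite !mulr_gt0 ?exprn_gt0.
  move=> z /=; rewrite /qball /= => cz.
  apply: le_lt_trans (qm_triangle qm x z c) _.
  have cz' : d c z < D by exact: lt_le_trans Ar.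
  apply: (@lt_le_trans _ _ (A0 * (2 * D))).
    rewrite ltr_pM2l // mulr2n mulrDl mul1r ltrD //.
    rewrite (qm_sym qm) (lt_le_trans cx) // (le_trans _ Dr) //.
    rewrite -[leLHS]mul1r ler_pM2r // mulr_ege1 ?exprn_ege1 //.
    by rewrite ler1n.
  have -> : 4 * A0 ^+ 3 * d x y = A0 * (2 * (2 * A0 ^+ 2 * d x y)) by ring.
  by rewrite ler_pM2l // ler_pM2l.
have Vinv : (vol d mu x y)^-1 <= G0 / m c (A * r).
  by rewrite ler_pdivlMr // mulrC ler_pdivrMr.
have Gle : G0 <= G0 * (1 + P).
  by rewrite ler_peMr ?lerDl // (le_trans ler01).
split=> //.
  by apply: le_trans Vinv _; rewrite ler_pM2r ?invr_gt0.
move=> z z' zz'; split.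
  rewrite /Defs.near ler_pdivlMl ?mulr_gt0 //.
  have h : 2 * A0 * r * (2 * A0 ^+ 2) <= 2 * A0 ^+ 2 * d x y.
    apply: le_trans dxy; apply: le_trans Dr3.
    by rewrite le_eqVlt; apply/orP; left; apply/eqP; ring.
  rewrite mulrC ler_pM2l ?mulr_gt0 ?exprn_gt0 // in h.
  by apply: le_trans h; rewrite ler_pM2l ?mulr_gt0 // ltW.
have rd : d z z' / d x y <= 2 * A0 ^+ 2 / A.
  rewrite ler_pdivrMr // mulrAC ler_pdivlMr //.
  apply: le_trans dxy; apply: le_trans Ar; rewrite mulrC.
  by rewrite ler_pM2l // ltW.
have powV a : 0 < a -> a^-1 `^ delta = (a `^ delta)^-1.
  by move=> a0; rewrite -(powR_inv1 (ltW a0)) -powRrM mulN1r powRN.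
rewrite /gain.
have -> : d z z' `^ delta / (vol d mu x y * d x y `^ delta) =
    (d z z' / d x y) `^ delta * (vol d mu x y)^-1.
  by rewrite powRM ?invr_ge0 ?(ltW dxy0) // powV // invfM [_^-1 * _]mulrC mulrA.
apply: (@le_trans _ _ ((2 * A0 ^+ 2 / A) `^ delta * (G0 / m c (A * r)))).
  apply: ler_pM => //; first exact: powR_ge0.
    by rewrite invr_ge0 ltW.
  apply: ge0_ler_powR => //; rewrite ?nnegrE; first exact: ltW.
  - by rewrite divr_ge0.
  - by rewrite ltW // divr_gt0 // mulr_gt0 // exprn_gt0.
rewrite powRM ?invr_ge0 ?(ltW Agt0) ?mulr_ge0 ?exprn_ge0 ?(ltW A00) //.
rewrite powV // -powRN -/P.
have -> : P * A `^ (- delta) * (G0 / m c (A * r)) =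
   G0 * P * (A `^ (- delta) / m c (A * r)) by ring.
rewrite -[leRHS]mulrA ler_wpM2r ?mulr_ge0 ?powR_ge0 ?invr_ge0 ?(ltW m0) //.
by rewrite ler_wpM2l ?(le_trans ler01) // lerDr.
Qed.

(** Two balls of equal radius at bounded relative distance are compared through
    one ball that contains both; the A_p condition will be used on it. *)
Lemma comparable_balls (t : R) : exists s G : R, [/\ 0 < s, 1 <= G &
  forall c c' r, 0 < r -> d c c' < t * r ->
  [/\ qball d c r `<=` qball d c (s * r),
      qball d c' r `<=` qball d c (s * r),
      m c (s * r) <= G * m c r & m c (s * r) <= G * m c' r]].
Proof.
have A00 : 0 < A0 by exact: lt_le_trans A01.
pose s := A0 * (`|t| + 1).
have s1 : 1 <= s by rewrite mulr_ege1 // lerDr.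
have s0 : 0 < s by exact: lt_le_trans s1.
have [G1 G11 h1] := doubling_scale hX s.
have [G2 G21 h2] := doubling_scale hX (A0 * (`|t| + s)).
have G1p : 0 <= G1 by exact: le_trans G11.
have G2p : 0 <= G2 by exact: le_trans G21.
exists s, (G1 + G2); split=> //; first by rewrite -[leLHS]addr0 lerD.
move=> c c' r r0 cc'.
have cc't : d c c' < `|t| * r.
  by apply: lt_le_trans cc' _; rewrite ler_pM2r // ler_norm.
split.
- by apply: qballS; rewrite ler_peMl // ltW.
- by have := qball_comparable r0 cc't (s := 1); rewrite mul1r; exact.
- apply: le_trans (h1 c r r0) _; by rewrite ler_wpM2r ?fine_ge0 ?lerDl.
- have sub := qball_comparable (c := c') (c' := c) (s := s) (t := `|t|) r0.
  apply: (@le_trans _ _ (m c' (A0 * (`|t| + s) * r))).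
    apply: (le_fine_qball hX); last by apply: sub; rewrite (qm_sym qm).
    by rewrite !mulr_gt0 // ltr_wpDl.
  apply: le_trans (h2 c' r r0) _; by rewrite ler_wpM2r ?fine_ge0 ?lerDr.
Qed.

End SeparatedBalls.

(** By disjointness, a set of finite measure can meet only finitely many members
    of the family in measure more than [1/k]. *)
Lemma countable_disjoint_positive {R : realType} {disp : measure_display}
    {X : measurableType disp} (mu : {sigma_finite_measure set X -> \bar R})
    (G : set (set X)) :
  (forall Q, G Q -> measurable Q) -> (forall Q, G Q -> mu Q <> 0%E) ->
  (forall P Q, G P -> G Q -> P `&` Q !=set0 -> P = Q) -> countable G.
Proof.
move=> mG pG dG.
have [F FT mF] := sigma_finiteT mu.
pose H n k := [set Q | G Q /\ (k.+1%:R^-1%:E < mu (Q `&` F n))%E].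
suff finH n k : finite_set (H n k).
  apply: (@sub_countable _ _ _ (\bigcup_n \bigcup_k H n k)).
    apply: subset_card_le => Q GQ.
    have [n Qn] : exists n, mu (Q `&` F n) <> 0%E.
      apply: contrapT => /forallNP h; apply: (pG Q GQ).
      apply/negligibleP; first exact: mG.
      rewrite -(setIT Q) FT setI_bigcupr; apply: negligible_bigcup => n.
      apply/negligibleP; last exact: contrapT (h n).
      by apply: measurableI; [exact: mG|case: (mF n)].
    have Qn0 : (0 < mu (Q `&` F n))%E by rewrite lt0e; apply/andP; split=> //;
      exact/eqP.
    exists n => //.
    have Qf : mu (Q `&` F n) \is a fin_num.
      rewrite ge0_fin_numE //; apply: le_lt_trans (mF n).2.
      apply: le_measure; rewrite ?inE; [|by case: (mF n)|exact: subIsetr].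
      by apply: measurableI; [exact: mG|case: (mF n)].
    have q0 : 0 < fine (mu (Q `&` F n)) by rewrite fine_gt0 // Qn0 ltey_eq Qf.
    exists (Num.truncn (fine (mu (Q `&` F n)))^-1) => //; split => //.
    rewrite -[ltRHS]fineK // lte_fin invf_plt ?posrE ?ltr0n //.
    exact: truncnS_gt.
  apply: bigcup_countable => // n _; apply: bigcup_countable => // k _.
  exact: finite_set_countable.
apply: contrapT => /infiniteP/pcard_leP[f].
have Hf i : H n k (f i) by apply: funS.
have finj : injective f by move=> i j /inj; apply; rewrite inE.
have mfF i : measurable (f i `&` F n).
  by apply: measurableI; [apply: mG; case: (Hf i)|case: (mF n)].
have tf : trivIset setT (fun i => f i `&` F n).
  move=> i j _ _ [x [[fi _] [fj _]]]; apply: finj.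
  by apply: dG; [case: (Hf i)|case: (Hf j)|exists x].
have Ff : mu (F n) \is a fin_num by rewrite ge0_fin_numE //; case: (mF n).
have bnd N : N%:R * k.+1%:R^-1 <= fine (mu (F n)).
  rewrite -lee_fin fineK //.
  have le : (mu (\big[setU/set0]_(i < N) (f i `&` F n)) <= mu (F n))%E.
    apply: le_measure; rewrite ?inE;
      [exact: bigsetU_measurable|by case: (mF n)|].
    by rewrite -(bigcup_mkord N (fun i => f i `&` F n)) => x [i _ []].
  apply: le_trans le; rewrite (measure_bigsetU mu mfF tf).
  elim: N => [|N IH]; first by rewrite big_ord0 mul0r.
  rewrite big_ord_recr /= -natr1 mulrDl mul1r EFinD.
  by apply: leeD => //; apply: ltW; case: (Hf N).
have := bnd (Num.truncn (fine (mu (F n)) * k.+1%:R)).+1.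
by rewrite leNgt ltr_pdivlMr ?ltr0n // truncnS_gt.
Qed.

(** Squares of small dyadic cubes shrink to the diagonal; this is where the
    product sigma-algebra needs separability, and the dyadic system provides it. *)
Lemma measurable_diagonal {R : realType} {disp : measure_display}
    {X : measurableType disp} (d : X -> X -> R)
    (mu : {sigma_finite_measure set X -> \bar R}) (A0 theta : R)
    (D : int -> set (set X)) :
  homogeneous_space d mu A0 theta -> dyadic_system d D ->
  measurable [set z : X * X | z.1 = z.2].
Proof.
move=> hX hD; have qm := hs_quasi_metric hX.
have [rho [c [C [/andP[rho0 rho1] c0 C0 hsz]]]] := ds_size hD.
have rk (k : int) : 0 < rho ^ k by rewrite exprz_gt0.
have cD (k : int) : countable (D k).
  apply: (countable_disjoint_positive (mu := mu)).
  - by move=> Q; exact: ds_measurable hD _ _.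
  - move=> Q DQ Q0; have [z [zQ _]] := hsz k Q DQ.
    have : 0 < fine (mu (qball d z (c * rho ^ k))).
      by apply: (qball_gt0 hX); rewrite mulr_gt0.
    rewrite (_ : mu _ = 0%E) ?ltxx //; apply/eqP; rewrite -measure_le0 -Q0.
    apply: le_measure => //; rewrite inE; first exact: (measurable_qball hX).
    exact: ds_measurable hD _ _ DQ.
  - move=> P Q DP DQ [x [Px Qx]]; apply/seteqP; split.
    + by case: (ds_nested hD (lexx k) DQ DP) => // E; have : (P `&` Q) x by [];
      rewrite E.
    + by case: (ds_nested hD (lexx k) DP DQ) => // E; have : (Q `&` P) x by [];
      rewrite E.
rewrite (_ : [set z | _] =
    \bigcap_(k : nat) \bigcup_(Q in D k%:Z) (Q `*` Q)); last first.
  apply/seteqP; split=> [[x y] /= <- k _|[x y] /= h].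
    by have [Q DQ Qx] := ds_cover hD k%:Z x; exists Q.
  apply: contrapT => xy; have dxy := qdist_gt0 hX xy.
  have A00 : 0 < A0 by exact: lt_le_trans (quasi_constant_ge1 hX).
  have bnd (k : nat) : d x y / (A0 * (C + C)) <= rho ^+ k.
    have [Q DQ [/= Qx Qy]] := h k I.
    have [z [_ Qz]] := hsz k%:Z Q DQ.
    have zx := Qz _ Qx; have zy := Qz _ Qy; rewrite /qball /= in zx zy.
    rewrite ler_pdivrMr ?mulr_gt0 ?addr_gt0 //.
    apply: le_trans (qm_triangle qm x y z) _; rewrite mulrCA ler_pM2l //.
    by rewrite mulrDr lerD // mulrC ltW // (qm_sym qm).
  have : (fun k => rho ^+ k) @ \oo --> (0 : R).
    by apply: cvg_expr; rewrite ger0_norm // ltW.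
  move=> /cvgrPdist_lt /(_ (d x y / (A0 * (C + C)))).
  rewrite divr_gt0 ?mulr_gt0 ?addr_gt0 // => /(_ isT) [N _ /(_ N (leqnn N))].
  rewrite sub0r normrN ger0_norm ?exprn_ge0 ?(ltW rho0) //.
  by rewrite ltNge bnd.
apply: bigcap_measurable => [|k _]; first by exists 0%N.
have [->|/set0P[Q0 DQ0]] := eqVneq (D k%:Z) set0; first by rewrite bigcup_set0.
rewrite bigcup_set_type; apply: countable_bigcupT_measurable.
  by rewrite (eq_countable (card_setT _)).
move=> [Q /set_mem DQ] /=.
by apply: measurableX; exact: ds_measurable hD _ _ DQ.
Qed.

(** * A functional monotone class argument *)

Section HolderApproximation.
Context {R : realType} {disp : measure_display} {X : measurableType disp}.
Variables (d : X -> X -> R) (mu : {measure set X -> \bar R}) (A0 theta eta : R).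
Hypothesis hX : homogeneous_space d mu A0 theta.
Hypothesis heta : 0 < eta <= theta.

Let qm := hs_quasi_metric hX.

Lemma qopenI : setI_closed (qopen d).
Proof.
move=> U V hU hV x [Ux Vx].
have [r r0 rU] := hU x Ux; have [s s0 sV] := hV x Vx.
exists (Num.min r s); first by rewrite lt_min r0 s0.
by move=> y; rewrite /qball /= lt_min => /andP[yr ys]; split;
  [exact: rU|exact: sV].
Qed.

Lemma measurable_qopen U : qopen d U -> measurable U.
Proof. by move=> oU; rewrite (hs_borel hX); exact: sub_sigma_algebra. Qed.

Lemma measurable_holder (f : X -> R) (C : R) :
  (forall x y, `|f x - f y| <= C * d x y `^ eta) -> measurable_fun setT f.
Proof.
move=> hf; have /andP[e0 _] := heta.
apply: (measurability _ (RGenOInfty.measurableE R)) => //.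
move=> _ [_ [a ->] <-]; rewrite setTI; apply: measurable_qopen => x /=;
  rewrite in_itv /= andbT => ax.
have C1 : 0 < 1 + `|C| by rewrite ltr_pwDl.
have gap : 0 < (f x - a) / (1 + `|C|) by rewrite divr_gt0 // subr_gt0.
exists (((f x - a) / (1 + `|C|)) `^ eta^-1); first by rewrite powR_gt0.
move=> y; rewrite /qball /= => xy; rewrite in_itv /= andbT.
have h : d x y `^ eta < (f x - a) / (1 + `|C|).
  have -> : (f x - a) / (1 + `|C|) = (((f x - a) / (1 + `|C|)) `^ eta^-1) `^
    eta.
    by rewrite -powRrM mulVf ?gt_eqF // powRr1 // ltW.
  apply: gt0_ltr_powR => //; rewrite nnegrE ?powR_ge0 //.
  exact: (qm_ge0 qm).
rewrite ltr_pdivlMr // mulrC in h.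
have : f x - f y < f x - a.
  apply: le_lt_trans (ler_norm _) _; apply: le_lt_trans (hf x y) _.
  apply: le_lt_trans h; rewrite ler_wpM2r ?powR_ge0 //.
  by rewrite (le_trans (ler_norm _)) // lerDr.
by rewrite ltrD2l ltrN2.
Qed.

(** The infimum of the truncated functions [n d(., y)^eta] over the points [y]
    outside an open set: a substitute for a multiple of the distance to the
    complement that is Hölder although [d] is only a quasi-metric. *)
Definition open_cutoff (U : set X) (n : nat) (x : X) : R :=
  inf ([set 1] `|` [set n%:R * d x y `^ eta | y in ~` U]).

Let lb0 U n x : lbound ([set 1] `|` [set n%:R * d x y `^ eta | y in ~` U]) 0.
Proof. by move=> _ [->//|[y _ <-]]; rewrite mulr_ge0 ?powR_ge0. Qed.

Let ne U n x : ([set 1] `|` [set n%:R * d x y `^ eta | y in ~` U]) !=set0.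
Proof. by exists 1; left. Qed.

Lemma open_cutoff_ge0 U n x : 0 <= open_cutoff U n x.
Proof. exact: lb_le_inf (ne _ _ _) (@lb0 U n x). Qed.

Lemma open_cutoff_le1 U n x : open_cutoff U n x <= 1.
Proof. by apply: ge_inf; [exists 0; exact: lb0|left]. Qed.

Lemma open_cutoff_out U n x : ~ U x -> open_cutoff U n x = 0.
Proof.
move=> Ux; apply/eqP; rewrite eq_le open_cutoff_ge0 andbT.
apply: ge_inf; first by exists 0; exact: lb0.
have /andP[e0 _] := heta.
by right; exists x => //; rewrite (qdist_xx hX) powR0 ?mulr0 ?gt_eqF.
Qed.

Lemma open_cutoff_cvg U x : qopen d U ->
  (fun n => open_cutoff U n x) @ \oo --> (\1_U x : R).
Proof.
move=> oU; have /andP[e0 _] := heta; rewrite indicE.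
have [Ux|Ux] := pselect (U x); last first.
  rewrite memNset //= (_ : (fun n => _) = fun=> 0); first exact: cvg_cst.
  by apply/funext => n; rewrite open_cutoff_out.
rewrite mem_set //=; have [r r0 rU] := oU x Ux.
have p0 : 0 < r `^ eta by rewrite powR_gt0.
apply: cvg_near_cst; exists (Num.truncn (r `^ eta)^-1).+1 => // n /= hn.
apply/eqP; rewrite eq_le open_cutoff_le1 /=.
apply: lb_le_inf => // _ [->//|[y Uy <-]].
have ry : r <= d x y by rewrite leNgt; apply/negP => /rU.
apply: (@le_trans _ _ (n%:R * r `^ eta)).
  rewrite -ler_pdivrMr // mul1r; apply: le_trans (ltW (truncnS_gt _)) _.
  by rewrite ler_nat.
rewrite ler_wpM2l // ge0_ler_powR // ?nnegrE ?ltW //.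
exact: lt_le_trans ry.
Qed.

Lemma open_cutoff_holder U n : exists C : R, forall x y,
  `|open_cutoff U n x - open_cutoff U n y| <= C * d x y `^ eta.
Proof.
have [H H0 hH] := qdist_powR_holder hX heta.
have half x y : open_cutoff U n x - n%:R * H * d x y `^ eta <= open_cutoff U n
  y.
  apply: lb_le_inf => // _ [->|[z Uz <-]].
    rewrite lerBlDr (le_trans (open_cutoff_le1 _ _ _)) // lerDl.
    by rewrite !mulr_ge0 ?powR_ge0 // ltW.
  rewrite lerBlDr; apply: (@le_trans _ _ (n%:R * d x z `^ eta)).
    by apply: ge_inf; [exists 0; exact: lb0|right; exists z].
  rewrite -mulrA -mulrDr ler_wpM2l // -lerBlDl.
  by rewrite (le_trans (ler_norm _)).
exists (n%:R * H) => x y; have := half y x; have := half x y.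
rewrite (qm_sym qm y x) ler_norml; set w := _ * d x y `^ eta => h1 h2.
by apply/andP; split; lra.
Qed.

End HolderApproximation.

Section BoundedClass.
Context {R : realType} {disp : measure_display} {X : measurableType disp}.
Variables (Q : set X) (P : (X -> R[i]) -> Prop).
Hypothesis mQ : measurable Q.
Hypothesis Plin : forall (a : R[i]) f g, P f -> P g ->
  P (fun x => a * f x + g x).
Hypothesis Plim : forall (M : R) (f_ : nat -> X -> R[i]) f,
  (forall n, bounded_on Q M (f_ n)) -> (forall n, P (f_ n)) ->
  (forall x, ccvg (fun n => f_ n x) (f x)) -> P f.

Lemma bounded_on_cind A : measurable A -> A `<=` Q -> bounded_on Q 1 (cind R A).
Proof.
move=> mA AQ; split.
- exact: cmeasurable_cind.
- by move=> x; rewrite /cind cabs_real indicE; case: (_ \in _);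
  rewrite ?normr1 ?normr0.
- by move=> x Qx; rewrite /cind indicE memNset // => /AQ.
Qed.

Lemma class_eq f g : f =1 g -> P f -> P g.
Proof. by move=> /funext ->. Qed.

(** Stability under linear combinations and bounded limits makes the sets with
    indicator in the class a Dynkin system. *)
Lemma dynkin_indicator (disp' : measure_display) (Y : measurableType disp')
    (G : set (set Y)) (pi : X -> Y) (E : set X) :
  @measurable _ Y = <<s G >> -> setI_closed G -> measurable_fun setT pi ->
  measurable E -> E `<=` Q -> P (cind R E) ->
  (forall A, G A -> P (cind R (pi @^-1` A `&` E))) ->
  forall A, measurable A -> P (cind R (pi @^-1` A `&` E)).
Proof.
move=> YG GI mpi mE EQ PE PG A mA.
have mpre B : measurable B -> measurable (pi @^-1` B `&` E).
  by move=> mB; apply: measurableI => //; rewrite -[_ @^-1` _]setTI; exact: mpi.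
have P0 : P (fun=> 0).
  by apply: class_eq (Plin (-1) PE PE) => x; rewrite mulN1r addNr.
rewrite YG in mA.
apply: (@dynkin_induction _ Y G (fun A => P (cind R (pi @^-1` A `&` E)))) mA =>
  //.
- by rewrite preimage_setT setTI.
- move=> B mB PB; apply: class_eq (Plin (-1) PB PE) => x.
  rewrite /cind !indicE !in_setI.
  have -> : (x \in pi @^-1` (~` B)) = (x \notin pi @^-1` B).
    by rewrite preimage_setC in_setC.
  by case: (x \in _); case: (x \in E);
    rewrite /= ?mulN1r ?addNr ?oppr0 ?add0r ?addr0.
- move=> F mF tF PF.
  pose S n := \big[setU/set0]_(i < n) F i.
  have mS n : measurable (S n) by exact: bigsetU_measurable.
  have PS n : P (cind R (pi @^-1` (S n) `&` E)).
    elim: n => [|n IH].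
      by apply: class_eq P0 => x;
        rewrite /S big_ord0 preimage_set0 set0I /cind indic0.
    apply: class_eq (Plin 1 (PF n) IH) => x.
    rewrite mul1r /cind -rmorphD /=; congr (_%:C).
    rewrite !indicE !in_setI /S big_ord_recr /=.
    have -> : (x \in pi @^-1` (S n `|` F n)) = (x \in pi @^-1` (S n)) || (x \in
      pi @^-1` (F n)).
      by rewrite preimage_setU in_setU.
    case: (boolP (x \in pi @^-1` F n)); rewrite ?inE /= => Fx.
      case: (boolP (x \in pi @^-1` S n)); rewrite ?inE /= => Sx.
        exfalso; move: Sx; rewrite /S -bigcup_mkord => -[i /= ltin Fi].
        have := tF i n I I; move=> /(_ (ex_intro _ (pi x) (conj Fi Fx))) E'.
        by rewrite E' ltnn in ltin.
      by rewrite /= addr0.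
    by rewrite /= add0r orbF.
  apply: (Plim (M := 1) (f_ := fun n => cind R (pi @^-1` (S n) `&` E))) => //.
    by move=> n; apply: bounded_on_cind;
      [exact: mpre|exact: subset_trans (@subIsetr _ _ _) EQ].
  move=> x; apply: ccvg_real.
  have [Ex|Ex] := boolP (x \in E); last first.
    rewrite [X in X @ \oo](_ : _ = fun=> 0).
      by rewrite indicE in_setI (negbTE Ex) andbF; exact: cvg_cst.
    by apply/funext => n; rewrite indicE in_setI (negbTE Ex) andbF.
  apply: cvg_near_cst.
  have [[i _ Fi]|nF] := pselect ((\bigcup_k F k) (pi x)).
    exists i.+1 => // n /= ltin.
    rewrite !indicE !in_setI Ex !andbT !mem_set //=; first by exists i.
    by rewrite /S -bigcup_mkord; exists i.
  apply: nearW => n; rewrite !indicE !in_setI Ex !andbT !memNset //=.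
  by rewrite /S -bigcup_mkord => -[i _ Fi]; apply: nF; exists i.
Qed.

(** Binary expansion: adding greedily [2^-n] times the indicator of the set
    where at least [2^-n] is still missing exhausts a function with values in
    the unit interval. *)
Lemma class_unit_interval (u : X -> R) :
  (forall A, measurable A -> A `<=` Q -> P (cind R A)) ->
  measurable_fun setT u -> (forall x, 0 <= u x <= 1) ->
  (forall x, ~ Q x -> u x = 0) -> P (fun x => (u x)%:C).
Proof.
move=> Pind mu u01 uQ.
(* The expansion up to the digit [n]; [inv] bounds what remains by [2^-n]. *)
pose step (k : nat) (f : X -> R) x : R :=
  f x + 2 ^- k.+1 * \1_[set x | 2 ^- k.+1 <= u x - f x] x.
pose fix f n := if n is k.+1 then step k (f k) else cst 0.
have fS n x : f n.+1 x = f n x + 2 ^- n.+1 * \1_[set x | 2 ^- n.+1 <= u x - f n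
  x] x.
  by [].
have p2 n : 0 < 2 ^- n :> R by rewrite invr_gt0 exprn_gt0.
have f0 n x : 0 <= f n x.
  elim: n => [|n IH]; first by [].
  by rewrite fS addr_ge0 // mulr_ge0 // ltW.
have inv n x : f n x <= u x <= f n x + 2 ^- n.
  elim: n => [|n /andP[l r]]; first by rewrite /= add0r expr0 invr1.
  have e2 : 2 ^- n.+1 + 2 ^- n.+1 = 2 ^- n :> R.
    by rewrite exprS invfM; set t := (2 ^+ n)^-1; lra.
  rewrite fS indicE; have [h|h] := pselect (2 ^- n.+1 <= u x - f n x).
    rewrite mem_set // mulr1; apply/andP; split;
      first by rewrite addrC -lerBrDr.
    by rewrite -addrA e2.
  rewrite memNset // mulr0 addr0 l /= -lerBlDl ltW //.
  by rewrite ltNge; apply/negP.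
have mset n (g : X -> R) : measurable_fun setT g ->
    measurable [set x | 2 ^- n.+1 <= u x - g x].
  move=> mg; have := measurable_fun_ler (@measurable_cst _ _ X R setT (2 ^-
    n.+1)) (measurable_funB mu mg).
  move=> /(_ measurableT [set true] I); rewrite setTI.
  by congr (measurable _); apply/seteqP; split.
have mf n : measurable_fun setT (f n).
  elim: n => [|n IH]; first exact: measurable_cst.
  apply: measurable_funD => //; apply: measurable_funM => //.
  by apply: measurable_indic; exact: mset.
have AQ n : [set x | 2 ^- n.+1 <= u x - f n x] `<=` Q.
  move=> x /= h; apply: contrapT => /uQ ux; move: h.
  by rewrite ux sub0r leNgt (le_lt_trans _ (p2 _)) // oppr_le0.
have mA n := mset n _ (mf n).
have Pf n : P (fun x => (f n x)%:C).
  elim: n => [|n IH].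
    have PE := Pind set0 measurable0 (sub0set _).
    by apply: class_eq (Plin (-1) PE PE) => x; rewrite mulN1r addNr.
  apply: class_eq (Plin (2 ^- n.+1)%:C (Pind _ (mA n) (AQ n)) IH) => x.
  by rewrite /cind -rmorphM -rmorphD /= addrC.
apply: (Plim (M := 1)) Pf _ => [n|x].
  split; first exact: cmeasurable_real.
  - move=> x; rewrite cabs_real ger0_norm //.
    by have /andP[h _] := inv n x; have /andP[_ h'] := u01 x;
      exact: le_trans h h'.
  - move=> x /uQ ux; have /andP[h _] := inv n x; rewrite ux in h.
    by have /eqP -> : f n x == 0 by rewrite eq_le h f0.
apply: ccvg_real.
have h0 : (fun n => 2 ^- n) @ \oo --> (0 : R).
  have -> : (fun n => 2 ^- n) = (fun n => (2^-1) ^+ n) :> (nat -> R).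
    by apply/funext => n; rewrite exprVn.
  by apply: cvg_expr; rewrite ger0_norm // invf_lt1 // ltr1n.
have h1 : (fun n => u x - 2 ^- n) @ \oo --> u x.
  by rewrite -[X in _ --> X]subr0; apply: cvgB => //; exact: cvg_cst.
apply: (squeeze_cvgr _ h1 (cvg_cst (u x))).
by apply: nearW => n; have /andP[h h'] := inv n x; rewrite h lerBlDr h'.
Qed.

Lemma class_bounded (M : R) (f : X -> R[i]) :
  (forall A, measurable A -> A `<=` Q -> P (cind R A)) ->
  bounded_on Q M f -> P f.
Proof.
move=> Pind [[mr mi] fM fQ].
pose N := 1 + `|M|.
have N0 : 0 < N by rewrite ltr_pwDl.
have fN x : cabs (f x) <= N.
  by rewrite (le_trans (fM x)) // (le_trans (ler_norm _)) // lerDr.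
have pos (v : X -> R) : measurable_fun setT v -> (forall x, `|v x| <= N) ->
    (forall x, ~ Q x -> v x = 0) -> P (fun x => (Num.max (v x / N) 0)%:C).
  move=> mv vN vQ; apply: class_unit_interval => //.
  - apply: measurable_maxr => //; apply: measurable_funM => //.
  - move=> x; rewrite le_max lexx orbT ge_max ler01 andbT /=.
    by rewrite ler_pdivrMr // mul1r (le_trans (ler_norm _)).
  - by move=> x /vQ ->; rewrite mul0r maxxx.
have real (v : X -> R) : measurable_fun setT v -> (forall x, `|v x| <= N) ->
    (forall x, ~ Q x -> v x = 0) -> P (fun x => (v x / N)%:C).
  move=> mv vN vQ.
  have P1 := pos v mv vN vQ.
  have P2 : P (fun x => (Num.max (- v x / N) 0)%:C).
    apply: (pos (fun x => - v x)) => [|x|x /vQ ->]; last by rewrite oppr0.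
    - exact: measurable_funN.
    - by rewrite normrN.
  apply: class_eq (Plin (-1) P2 P1) => x; rewrite mulN1r -rmorphN -rmorphD /=.
  congr (_%:C); rewrite mulNr; set w := v x / N.
  rewrite /Order.max oppr_lt0.
  by case: (ltgtP 0 w) => [w0|w0|<-]; rewrite ?oppr0 ?add0r ?opprK ?addr0.
have PR : P (fun x => (complex.Re (f x) / N)%:C).
  apply: (real (fun x => complex.Re (f x))) => // [x|x /fQ -> //].
  exact: le_trans (Re_le_cabs _) (fN x).
have PI : P (fun x => (complex.Im (f x) / N)%:C).
  apply: (real (fun x => complex.Im (f x))) => // [x|x /fQ -> //].
  exact: le_trans (Im_le_cabs _) (fN x).
have P0 : P (fun=> 0).
  by apply: class_eq (Plin (-1) PR PR) => x; rewrite mulN1r addNr.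
apply: class_eq (Plin (N%:C) (Plin 'i PI PR) P0) => x.
have Nn0 : N != 0 by rewrite gt_eqF.
by case: (f x) => a b; apply: complex_eq => /=; field.
Qed.

End BoundedClass.

(** * Bounded functions on rectangles *)

(** Bounded functions on a rectangle are reached from tensors of Hölder
    functions: cut-offs give the products of open sets, and Dynkin systems in
    the first variable, in the second one, and in the product give all
    measurable subsets of the rectangle. *)
Lemma class_holder_tensor {R : realType} {disp1 disp2 : measure_display}
    {X1 : measurableType disp1} {X2 : measurableType disp2}
    (d1 : X1 -> X1 -> R) (d2 : X2 -> X2 -> R)
    (mu1 : {measure set X1 -> \bar R}) (mu2 : {measure set X2 -> \bar R})
    (A0 theta1 theta2 eta1 eta2 : R) (B1 : set X1) (B2 : set X2)
    (P : (X1 * X2 -> R[i]) -> Prop) :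
  homogeneous_space d1 mu1 A0 theta1 -> homogeneous_space d2 mu2 A0 theta2 ->
  0 < eta1 <= theta1 -> 0 < eta2 <= theta2 -> balls d1 B1 -> balls d2 B2 ->
  (forall (a : R[i]) f g, P f -> P g -> P (fun x => a * f x + g x)) ->
  (forall (M : R) (f_ : nat -> X1 * X2 -> R[i]) f,
    (forall n, bounded_on (B1 `*` B2) M (f_ n)) -> (forall n, P (f_ n)) ->
    (forall x, ccvg (fun n => f_ n x) (f x)) -> P f) ->
  (forall (u : X1 -> R) (v : X2 -> R),
    C0 d1 eta1 (fun x => (u x)%:C) -> C0 d2 eta2 (fun x => (v x)%:C) ->
    (forall x, ~ B1 x -> u x = 0) -> (forall x, ~ B2 x -> v x = 0) ->
    bounded_on (B1 `*` B2) 1 (tensor (fun x => (u x)%:C) (fun x => (v x)%:C)) ->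
    P (tensor (fun x => (u x)%:C) (fun x => (v x)%:C))) ->
  forall M f, bounded_on (B1 `*` B2) M f -> P f.
Proof.
move=> hX1 hX2 he1 he2 bB1 bB2 Plin Plim Pten.
have oB1 : qopen d1 B1 by have [c [r [_ ->]]] := bB1;
  exact: qball_qopen hX1 _ _.
have oB2 : qopen d2 B2 by have [c [r [_ ->]]] := bB2;
  exact: qball_qopen hX2 _ _.
have mB1 := measurable_qopen hX1 oB1; have mB2 := measurable_qopen hX2 oB2.
have mQ : measurable (B1 `*` B2) by exact: measurableX.
have Popen U V : qopen d1 U -> qopen d2 V -> U `<=` B1 -> V `<=` B2 ->
    P (cind R (U `*` V)).
  move=> oU oV UB VB.
  pose u n x := open_cutoff d1 eta1 U n x;
    pose v n x := open_cutoff d2 eta2 V n x.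
  have uU n x : ~ B1 x -> u n x = 0.
    by move=> Bx; apply: (open_cutoff_out hX1 he1) => /UB.
  have vV n x : ~ B2 x -> v n x = 0.
    by move=> Bx; apply: (open_cutoff_out hX2 he2) => /VB.
  have Cu n : C0 d1 eta1 (fun x => (u n x)%:C).
    split; first by exists B1 => // x /uU ->.
    have [C hC] := open_cutoff_holder hX1 he1 U n; exists C => x y.
    by rewrite -rmorphB cabs_real.
  have Cv n : C0 d2 eta2 (fun x => (v n x)%:C).
    split; first by exists B2 => // x /vV ->.
    have [C hC] := open_cutoff_holder hX2 he2 V n; exists C => x y.
    by rewrite -rmorphB cabs_real.
  have mu_ n : measurable_fun setT (u n).
    have [C hC] := open_cutoff_holder hX1 he1 U n.
    exact: (measurable_holder hX1 he1 hC).
  have mv_ n : measurable_fun setT (v n).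
    have [C hC] := open_cutoff_holder hX2 he2 V n.
    exact: (measurable_holder hX2 he2 hC).
  have bt n : bounded_on (B1 `*` B2) 1
      (tensor (fun x => (u n x)%:C) (fun x => (v n x)%:C)).
    split.
    - apply: cmeasurableM; apply: cmeasurable_real.
      + exact: (measurableT_comp (mu_ n)).
      + exact: (measurableT_comp (mv_ n)).
    - move=> x; rewrite /tensor cabsM !cabs_real !ger0_norm ?open_cutoff_ge0 //.
      by rewrite mulr_ile1 ?open_cutoff_ge0 ?open_cutoff_le1.
    - move=> [x1 x2] /= /not_andP[/uU|/vV]; rewrite /tensor /= => ->;
        by rewrite ?mulr0 ?mul0r.
  apply: (Plim 1 (fun n => tensor (fun x => (u n x)%:C) (fun x => (v n x)%:C)))
    => //.
    by move=> n; apply: Pten => //; [exact: uU|exact: vV].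
  move=> [x1 x2]; rewrite /tensor /=.
  have -> : cind R (U `*` V) (x1, x2) = (\1_U x1)%:C * (\1_V x2)%:C.
    by rewrite /cind -rmorphM /= !indicE in_setX /=; case: (_ \in _);
      case: (_ \in _); rewrite ?mulr0 ?mulr1.
  apply: ccvgM; apply: ccvg_real.
  - exact: (open_cutoff_cvg hX1 he1).
  - exact: (open_cutoff_cvg hX2 he2).
have step1 A V : measurable A -> qopen d2 V -> V `<=` B2 ->
    P (cind R (fst @^-1` A `&` B1 `*` V)).
  move=> mA oV VB.
  apply: (dynkin_indicator Plin Plim (hs_borel hX1) (@qopenI _ _ _ d1)) mA =>
    //.
  - exact: measurableX mB1 (measurable_qopen hX2 oV).
  - by move=> [x1 x2] [/= ? ?]; split => //; exact: VB.
  - exact: Popen.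
  - move=> U oU; rewrite (_ : _ `&` _ = (U `&` B1) `*` V).
      by apply: Popen => //; exact: qopenI.
    by apply/seteqP; split=> -[x1 x2] /= [] => [? []|[]].
have step2 A B : measurable A -> measurable B ->
    P (cind R (snd @^-1` B `&` (fst @^-1` A `&` B1 `*` B2))).
  move=> mA mB.
  apply: (dynkin_indicator Plin Plim (hs_borel hX2) (@qopenI _ _ _ d2)) mB =>
    //.
  - apply: measurableI; last exact: measurableX.
    by rewrite -[_ @^-1` _]setTI; exact: measurable_fst.
  - exact: step1.
  - move=> U oU.
    have -> : snd @^-1` U `&` (fst @^-1` A `&` B1 `*` B2) =
        fst @^-1` A `&` B1 `*` (U `&` B2).
      apply/seteqP; split=> -[x1 x2] /=; first by move=> [? [? []]].
      by move=> [? [? []]].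
    by apply: step1 => //; exact: qopenI.
move=> M f; apply: (class_bounded Plin Plim) => A mA AQ.
have : P (cind R (id @^-1` A `&` B1 `*` B2)).
  apply: (dynkin_indicator (G :=
    [set A `*` B | A in measurable & B in measurable])
    Plin Plim _ _ _ mQ) mA => //.
  - exact: measurable_prod_measurableType.
  - move=> _ _ [A1 mA1 [A2 mA2 <-]] [A3 mA3 [A4 mA4 <-]].
    by rewrite -setXI; exists (A1 `&` A3);
      [exact: measurableI|exists (A2 `&` A4) => //; exact: measurableI].
  - exact: Popen.
  - move=> _ [A1 mA1 [A2 mA2 <-]].
    have -> : id @^-1` (A1 `*` A2) `&` B1 `*` B2 =
        snd @^-1` A2 `&` (fst @^-1` A1 `&` B1 `*` B2).
      apply/seteqP; split=> -[x1 x2] /=; first by move=> [[? ?] []].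
      by move=> [? [? []]].
    exact: step2.
by rewrite preimage_id; rewrite (setIidl AQ).
Qed.

Section BoundedOn.
Context {R : realType} {disp : measure_display} {X : measurableType disp}.
Variable mu : {measure set X -> \bar R}.
Implicit Types (f g u : X -> R[i]) (A Q : set X).

Lemma integrable_cst_indic Q (M : R) : measurable Q -> (mu Q < +oo)%E ->
  mu.-integrable setT (EFin \o (fun x => M * \1_Q x)).
Proof.
move=> mQ fQ.
have iQ : mu.-integrable setT (fun x => (\1_Q x)%:E).
  apply/integrableP; split; first by apply/measurable_EFinP;
    exact: measurable_indic.
  under eq_integral do rewrite gee0_abs ?lee_fin //.
  by rewrite integral_indic // setIT.
by apply: eq_integrable (integrableZl measurableT M iQ).
Qed.

Lemma bounded_on_le Q M f : bounded_on Q M f ->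
  forall x, cabs (f x) <= M * \1_Q x.
Proof.
move=> [_ fM fQ] x; rewrite indicE.
have [Qx|Qx] := pselect (Q x); first by rewrite mem_set // mulr1.
by rewrite memNset // mulr0 fQ // cabs0.
Qed.

Lemma bounded_on_cintegrable Q M f : measurable Q -> (mu Q < +oo)%E ->
  bounded_on Q M f -> cintegrable mu setT f.
Proof.
move=> mQ fQ bf.
apply: (cintegrable_le _ _ (integrable_cst_indic M mQ fQ)) => //.
- by case: bf.
- by move=> x _; exact: bounded_on_le.
Qed.

Lemma cabs_cintegral_bounded_on Q M f : measurable Q -> (mu Q < +oo)%E ->
  bounded_on Q M f -> cabs (cintegral mu setT f) <= 2 * (M * fine (mu Q)).
Proof.
move=> mQ fQ bf; have fi := bounded_on_cintegrable mQ fQ bf.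
apply: le_trans (cabs_cintegral measurableT fi) _; rewrite ler_pM2l //.
have iQ := integrable_cst_indic M mQ fQ.
apply: le_trans (le_Rintegral measurableT (cintegrable_cabs measurableT fi) iQ
  _) _.
  by move=> x _; exact: bounded_on_le.
have i1 : mu.-integrable setT (EFin \o (\1_Q : X -> R)).
  by apply: eq_integrable (integrable_cst_indic 1 mQ fQ) => // x _ /=;
    rewrite mul1r.
rewrite (RintegralZl _ measurableT i1) /Rintegral integral_indic // setIT.
exact: lexx.
Qed.

Lemma bounded_on_cvg Q M (f_ : nat -> X -> R[i]) f :
  (forall n, bounded_on Q M (f_ n)) ->
    (forall x, ccvg (fun n => f_ n x) (f x)) ->
  bounded_on Q M f.
Proof.
move=> bf fl; split.
- by apply: cmeasurable_cvg fl => n; case: (bf n).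
- move=> x; apply/ler_addgt0Pl => e e0.
  move/cvgrPdistC_lt : (fl x) => /(_ e e0) [N _ /(_ N (leqnn N))].
  rewrite subr0 ger0_norm ?cabs_ge0 // => h.
  have -> : f x = f_ N x - (f_ N x - f x) by rewrite subKr.
  rewrite (le_trans (ler_cabsD _ _)) // cabsN addrC lerD //; first exact: ltW.
  by case: (bf N).
- move=> x Qx; apply: ccvg_unique (fl x) _.
  rewrite (_ : (fun n => f_ n x) = fun=> 0); first exact: ccvg_cst.
  by apply/funext => n; case: (bf n) => _ _ ->.
Qed.

Lemma bounded_onD Q M N (a : R[i]) f g : bounded_on Q M f -> bounded_on Q N g ->
  bounded_on Q (cabs a * M + N) (fun x => a * f x + g x).
Proof.
move=> [mf fM fQ] [mg gM gQ]; split.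
- by apply: cmeasurableD => //; apply: cmeasurableM => //;
  exact: cmeasurable_cst.
- move=> x; rewrite (le_trans (ler_cabsD _ _)) // lerD // cabsM.
  by rewrite ler_wpM2l ?cabs_ge0.
- by move=> x Qx; rewrite fQ // gQ // mulr0 add0r.
Qed.

Lemma bounded_onM Q Q' M N f g : bounded_on Q M f -> bounded_on Q' N g ->
  bounded_on (Q `&` Q') (M * N) (fun x => f x * g x).
Proof.
move=> [mf fM fQ] [mg gM gQ]; split.
- exact: cmeasurableM.
- by move=> x; rewrite cabsM ler_pM ?cabs_ge0.
- by move=> x /not_andP[/fQ|/gQ] ->; rewrite ?mul0r ?mulr0.
Qed.

Lemma cintegrable_mul_bounded Q M f g : measurable Q -> cmeasurable f ->
  cintegrable mu Q f -> bounded_on Q M g ->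
  mu.-integrable setT (EFin \o (fun x => M * (cabs (f x) * \1_Q x))) /\
  cintegrable mu setT (fun x => f x * g x).
Proof.
move=> mQ mf fi bg.
have i1 : mu.-integrable setT (EFin \o (fun x => M * (cabs (f x) * \1_Q x))).
  have h1 : mu.-integrable setT ((EFin \o (fun x => cabs (f x))) \_ Q).
    by apply/integrable_restrict => //; rewrite setTI; exact: cintegrable_cabs.
  apply: eq_integrable (integrableZl measurableT M h1) => // x _ /=.
  rewrite patchE indicE; case: (x \in Q) => /=; first by rewrite mulr1.
  by rewrite mulr0 mule0 mulr0.
split=> //; apply: (cintegrable_le _ _ i1) => //.
  by apply: cmeasurableM => //; case: bg.
move=> x _; rewrite cabsM mulrCA ler_wpM2l ?cabs_ge0 //.
exact: bounded_on_le.
Qed.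

End BoundedOn.

Section WithSigmaFinite.
Context {R : realType} {disp : measure_display} {X : measurableType disp}.
Variables (mu : {measure set X -> \bar R}) (smu : sigma_finite setT mu).

(** The phantom argument lets structure inference find the proof of
    sigma-finiteness. *)
Definition with_sigma_finite (_ : sigma_finite setT mu) : set X -> \bar R := mu.

HB.instance Definition _ := Measure.on (with_sigma_finite smu).
HB.instance Definition _ :=
  Measure_isSigmaFinite.Build disp X R (with_sigma_finite smu) smu.

End WithSigmaFinite.

Lemma cmeasurable_cintegral {R : realType} {disp : measure_display}
    {X : measurableType disp} (mu : {measure set X -> \bar R})
    (h : X * X -> R[i]) : sigma_finite setT mu -> cmeasurable h ->
  cmeasurable (fun x => cintegral mu setT (fun y => h (x, y))).
Proof.
move=> smu.
pose nu : {sigma_finite_measure set X -> \bar R} := with_sigma_finite smu.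
have main (v : X * X -> R) : measurable_fun setT v ->
    measurable_fun setT (fun x => Rintegral mu setT (fun y => v (x, y))).
  move=> mv; apply: (measurableT_comp (fine_measurable measurableT)).
  have mve : measurable_fun setT (EFin \o v) by exact/measurable_EFinP.
  rewrite (_ : (fun x => _) = (fun x => \int[mu]_y (EFin \o v)^\+ (x, y)) \-
     (fun x => \int[mu]_y (EFin \o v)^\- (x, y)))%E.
    apply: emeasurable_funB.
    - by apply: (@measurable_fun_fubini_tonelli_F _ _ _ _ _ nu) => //;
      exact: measurable_funepos.
    - by apply: (@measurable_fun_fubini_tonelli_F _ _ _ _ _ nu) => //;
      exact: measurable_funeneg.
  apply/funext => x; rewrite integralE.
  by congr (_ - _)%E; apply: eq_integral => y _; rewrite ?funeposE ?funenegE.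
move=> [mr mi]; split; rewrite /cintegral /=.
- exact: (main (fun z => complex.Re (h z))).
- exact: (main (fun z => complex.Im (h z))).
Qed.

(** * The kernel formula for bounded functions *)

Lemma cmeasurable_comp {R : realType} {disp disp' : measure_display}
    {X : measurableType disp} {Y : measurableType disp'} (f : Y ->
      R[i]) (h : X -> Y) :
  cmeasurable f -> measurable_fun setT h -> cmeasurable (fun x => f (h x)).
Proof.
move=> [fr fi] mh; split.
- exact: (measurableT_comp fr mh).
- exact: (measurableT_comp fi mh).
Qed.

Section BoundedKernel.
Context {R : realType} {disp : measure_display} {X : measurableType disp}.
Variable mu : {measure set X -> \bar R}.
Variables (Q' : set X) (k : X * X -> R[i]) (Mk : R).
Hypothesis mQ' : measurable Q'.
Hypothesis fQ' : (mu Q' < +oo)%E.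
Hypothesis mk : cmeasurable k.
Hypothesis bk : forall z, cabs (k z) <= Mk.
Implicit Types f g : X -> R[i].

Definition kernel_op (f : X -> R[i]) (x : X) : R[i] :=
  cintegral mu setT (fun y => k (x, y) * f y).

Lemma bounded_on_kernel M f x : bounded_on Q' M f ->
  bounded_on Q' (Mk * M) (fun y => k (x, y) * f y).
Proof.
move=> bf; have bkx : bounded_on setT Mk (fun y => k (x, y)).
  split => //; last by move=> y [].
  by apply: (cmeasurable_comp mk); exact: pair1_measurable.
by have := bounded_onM bkx bf; rewrite setTI.
Qed.

Lemma kernel_op_integrable M f x : bounded_on Q' M f ->
  cintegrable mu setT (fun y => k (x, y) * f y).
Proof. by move=> /(bounded_on_kernel x); exact: bounded_on_cintegrable. Qed.

Lemma kernel_op_bounded M f x : bounded_on Q' M f ->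
  cabs (kernel_op f x) <= 2 * (Mk * M * fine (mu Q')).
Proof. by move=> /(bounded_on_kernel x); exact: cabs_cintegral_bounded_on. Qed.

Lemma kernel_op_linear M N (a : R[i]) f g x : bounded_on Q' M f ->
  bounded_on Q' N g ->
  kernel_op (fun y => a * f y + g y) x = a * kernel_op f x + kernel_op g x.
Proof.
move=> /(kernel_op_integrable x) fi /(kernel_op_integrable x) gi.
rewrite /kernel_op -cintegralZ // -cintegralD //; last exact: cintegrableZ.
by apply: eq_cintegral => y _; rewrite mulrDr mulrCA.
Qed.

Lemma kernel_op_cvg M (f_ : nat -> X -> R[i]) f x :
  (forall n, bounded_on Q' M (f_ n)) ->
    (forall y, ccvg (fun n => f_ n y) (f y)) ->
  ccvg (fun n => kernel_op (f_ n) x) (kernel_op f x).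
Proof.
move=> bf fl.
apply: (@cintegral_dominated _ _ _ _ _ _ (fun y => Mk * M * \1_Q' y)).
- by move=> n; case: (bounded_on_kernel x (bf n)).
- exact: integrable_cst_indic.
- by move=> n y; exact: bounded_on_le (bounded_on_kernel x (bf n)) y.
- by move=> y; apply: ccvgM => //; exact: ccvg_cst.
Qed.

Lemma kernel_op_outer M f g x : bounded_on Q' M f ->
  cintegral mu setT (fun y => k (x, y) * f y * g x) = kernel_op f x * g x.
Proof.
move=> /(kernel_op_integrable x) fi; rewrite mulrC -cintegralZ //.
by apply: eq_cintegral => y _; rewrite mulrC.
Qed.

End BoundedKernel.

Lemma cmeasurable_kernel_op {R : realType} {disp : measure_display}
    {X : measurableType disp} (mu : {measure set X -> \bar R})
    (k : X * X -> R[i]) f : sigma_finite setT mu -> cmeasurable k ->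
      cmeasurable f -> cmeasurable (kernel_op mu k f).
Proof.
move=> smu mk mf; apply: (cmeasurable_cintegral smu (h :=
  fun z => k z * f z.2)).
by apply: cmeasurableM => //; exact: (cmeasurable_comp mf).
Qed.


Section Representation.
Context {R : realType} {disp1 disp2 : measure_display}.
Context {X1 : measurableType disp1} {X2 : measurableType disp2}.
Variables (d1 : X1 -> X1 -> R) (d2 : X2 -> X2 -> R).
Variables (mu1 : {sigma_finite_measure set X1 -> \bar R}).
Variables (mu2 : {sigma_finite_measure set X2 -> \bar R}).
Variables (A0 theta1 theta2 eta1 eta2 : R).
Local Notation XX := (X1 * X2)%type.
Local Notation mu := (mu1 \x mu2)%E.
Hypothesis hX1 : homogeneous_space d1 mu1 A0 theta1.
Hypothesis hX2 : homogeneous_space d2 mu2 A0 theta2.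
Hypothesis he1 : 0 < eta1 <= theta1.
Hypothesis he2 : 0 < eta2 <= theta2.
Variables (dom : set (XX -> R[i])) (T : (XX -> R[i]) -> XX -> R[i]).
Hypothesis hT : linear_operator d1 d2 mu1 mu2 dom T.

Lemma rectangle_measurable Q : rectangles d1 d2 Q -> measurable Q.
Proof.
move=> [_ [_ [[c1 [r1 [r10 ->]]] [c2 [r2 [r20 ->]]] ->]]].
by apply: measurableX; [exact: (measurable_qball hX1)|exact: (measurable_qball
  hX2)].
Qed.

Lemma rectangle_measure c1 c2 r1 r2 : 0 < r1 -> 0 < r2 ->
  mu (qball d1 c1 r1 `*` qball d2 c2 r2) =
  (fine (mu1 (qball d1 c1 r1)) * fine (mu2 (qball d2 c2 r2)))%:E.
Proof.
move=> r10 r20; rewrite product_measure1E; last 2 first.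
- exact: (measurable_qball hX1).
- exact: (measurable_qball hX2).
rewrite EFinM !fineK // ge0_fin_numE //.
- exact: (qball_fin hX2).
- exact: (qball_fin hX1).
Qed.

Lemma rectangle_fin Q : rectangles d1 d2 Q -> (mu Q < +oo)%E.
Proof.
move=> [_ [_ [[c1 [r1 [r10 ->]]] [c2 [r2 [r20 ->]]] ->]]].
by rewrite rectangle_measure // ltry.
Qed.

Lemma bigcup_rectangle (o1 : X1) (o2 : X2) :
  \bigcup_(n : nat) (qball d1 o1 n.+1%:R `*` qball d2 o2 n.+1%:R) = setT.
Proof.
apply/seteqP; split => // -[x1 x2] _.
exists (Num.truncn (Num.max (d1 o1 x1) (d2 o2 x2))) => //.
split; rewrite /qball /=; apply: le_lt_trans (truncnS_gt _);
  by rewrite le_max lexx ?orbT.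
Qed.

Lemma sigma_finite_product : sigma_finite setT mu.
Proof.
have [[[ o1 o2] _]|XX0] := pselect (nonempty [set: XX]); last first.
  exists (fun=> set0); last by move=> n; rewrite measure0.
  by apply/seteqP; split => // x _; exfalso; apply: XX0; exists x.
exists (fun n => qball d1 o1 n.+1%:R `*` qball d2 o2 n.+1%:R).
  by rewrite bigcup_rectangle.
move=> n; split; last by rewrite rectangle_measure // ltry.
by apply: measurableX; [exact: (measurable_qball hX1)|exact: (measurable_qball
  hX2)].
Qed.

Lemma bounded_supp_rectangle Q M (f : XX -> R[i]) : rectangles d1 d2 Q ->
  bounded_on Q M f ->
  bounded_supp (rectangles d1 d2) f.
Proof. by move=> rQ bf; exists Q, M. Qed.

Lemma integrable_operator_mul Q M f g : rectangles d1 d2 Q ->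
  bounded_on Q M g ->
  bounded_supp (rectangles d1 d2) f ->
  mu.-integrable setT (EFin \o (fun x => M * (cabs (T f x) * \1_Q x))) /\
  cintegrable mu setT (fun x => T f x * g x).
Proof.
move=> rQ bg bf; have df := lo_dom_bounded hT bf.
have mQ := rectangle_measurable rQ.
have mf := lo_measurable hT df.
have fi := lo_L1loc hT bf rQ.
exact: cintegrable_mul_bounded.
Qed.

Lemma pairing_linear_right Q M N (a : R[i]) f g h : rectangles d1 d2 Q ->
  bounded_supp (rectangles d1 d2) f -> bounded_on Q M g -> bounded_on Q N h ->
  pairing mu1 mu2 (T f) (fun x => a * g x + h x) =
  a * pairing mu1 mu2 (T f) g + pairing mu1 mu2 (T f) h.
Proof.
move=> rQ bf bg bh.
have [_ ig] := integrable_operator_mul rQ bg bf.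
have [_ ih] := integrable_operator_mul rQ bh bf.
rewrite /pairing -cintegralZ // -cintegralD //; last exact: cintegrableZ.
by apply: eq_cintegral => x _; rewrite mulrDr mulrCA.
Qed.

Lemma ae_eq_cintegral (f g : XX -> R[i]) : cmeasurable f -> cmeasurable g ->
  {ae mu, forall x, f x = g x} -> cintegral mu setT f = cintegral mu setT g.
Proof.
move=> [fr fi] [gr gi] fg; rewrite /cintegral /Rintegral.
congr (_ +i* _); congr fine; apply: ae_eq_integral => //;
  try exact/measurable_EFinP.
- by apply: filterS fg => x -> _.
- by apply: filterS fg => x -> _.
Qed.

Lemma pairing_linear_left Q M (a : R[i]) f g h : rectangles d1 d2 Q ->
  bounded_supp (rectangles d1 d2) f -> bounded_supp (rectangles d1 d2) g ->
  bounded_on Q M h ->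
  pairing mu1 mu2 (T (fun x => a * f x + g x)) h =
  a * pairing mu1 mu2 (T f) h + pairing mu1 mu2 (T g) h.
Proof.
move=> rQ bf bg bh.
have [df dg] := (lo_dom_bounded hT bf, lo_dom_bounded hT bg).
have dl := lo_dom_linear hT a df dg.
have [_ ig] := integrable_operator_mul rQ bh bf.
have [_ ih] := integrable_operator_mul rQ bh bg.
have [mh _ _] := bh.
rewrite /pairing -cintegralZ // -cintegralD //; last exact: cintegrableZ.
apply: ae_eq_cintegral.
- by apply: cmeasurableM => //; exact: lo_measurable hT _ dl.
- apply: cmeasurableD.
  + apply: cmeasurableM; first exact: cmeasurable_cst.
    by apply: cmeasurableM => //; exact: lo_measurable hT _ df.
  + by apply: cmeasurableM => //; exact: lo_measurable hT _ dg.
- by apply: filterS (lo_linear hT a df dg) => x ->; rewrite mulrDl mulrA.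
Qed.

(** Both sides are linear and continuous under bounded convergence in each of
    the two functions separately, so the kernel formula extends from tensors of
    Hölder functions to all bounded functions on the two rectangles. *)
Lemma kernel_representation (B1 B2 : set X1 * set X2) (k : XX * XX -> R[i])
    (Mk : R) :
  balls d1 B1.1 -> balls d2 B1.2 -> balls d1 B2.1 -> balls d2 B2.2 ->
  cmeasurable k -> (forall z, cabs (k z) <= Mk) ->
  let Q := B1.1 `*` B1.2 in let Q' := B2.1 `*` B2.2 in
  (forall f1 f2 g1 g2, C0 d1 eta1 f1 -> C0 d2 eta2 f2 ->
     C0 d1 eta1 g1 -> C0 d2 eta2 g2 ->
     (forall x, ~ B2.1 x -> f1 x = 0) -> (forall x, ~ B2.2 x -> f2 x = 0) ->
     (forall x, ~ B1.1 x -> g1 x = 0) -> (forall x, ~ B1.2 x -> g2 x = 0) ->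
     pairing mu1 mu2 (T (tensor f1 f2)) (tensor g1 g2) =
     cintegral mu setT (fun x => cintegral mu setT (fun y =>
       k (x, y) * tensor f1 f2 y * tensor g1 g2 x))) ->
  forall M N f g, bounded_on Q' M f -> bounded_on Q N g ->
  pairing mu1 mu2 (T f) g =
  cintegral mu setT (fun x => kernel_op mu k f x * g x).
Proof.
move=> b11 b12 b21 b22 mk bk Q Q' rep.
have rQ : rectangles d1 d2 Q by exists B1.1, B1.2.
have rQ' : rectangles d1 d2 Q' by exists B2.1, B2.2.
have mQ := rectangle_measurable rQ; have mQ' := rectangle_measurable rQ'.
have fQ := rectangle_fin rQ; have fQ' := rectangle_fin rQ'.
have bs M (f : XX -> R[i]) : bounded_on Q' M f ->
  bounded_supp (rectangles d1 d2) f.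
  exact: bounded_supp_rectangle rQ'.
have kint M N (f g : XX -> R[i]) : bounded_on Q' M f -> bounded_on Q N g ->
    cintegrable mu setT (fun x => kernel_op mu k f x * g x).
  move=> bf bg; have [mf _ _] := bf.
  have bKf : bounded_on setT (2 * (Mk * M * fine (mu Q'))) (kernel_op mu k f).
    split; first exact: (cmeasurable_kernel_op sigma_finite_product mk mf).
      by move=> x; apply: (kernel_op_bounded).
    by move=> x [].
  have := bounded_onM bKf bg; rewrite setTI.
  exact: (bounded_on_cintegrable).
(* Extending one function at a time: the other one is a tensor of Hölder
   functions here, and an arbitrary bounded function below. *)
have left_ext (u : X1 -> R) (v : X2 -> R) :
    C0 d1 eta1 (fun x => (u x)%:C) -> C0 d2 eta2 (fun x => (v x)%:C) ->
    (forall x, ~ B1.1 x -> u x = 0) -> (forall x, ~ B1.2 x -> v x = 0) ->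
    let g := tensor (fun x => (u x)%:C) (fun x => (v x)%:C) in
    bounded_on Q 1 g -> forall M f, bounded_on Q' M f ->
    (exists M', bounded_on Q' M' f) /\ pairing mu1 mu2 (T f) g =
    cintegral mu setT (fun x => kernel_op mu k f x * g x).
  move=> Cu Cv u0 v0 g bg.
  apply: (class_holder_tensor hX1 hX2 he1 he2 b21 b22).
  - move=> a f h [[M bf] Ef] [[N bh] Eh]; split.
      by exists (cabs a * M + N); exact: bounded_onD.
    rewrite (pairing_linear_left _ rQ (bs _ _ bf) (bs _ _ bh) bg) Ef Eh.
    have [kf kh] := (kint _ _ _ _ bf bg, kint _ _ _ _ bh bg).
    rewrite -(cintegralZ a measurableT kf).
    rewrite -(cintegralD measurableT (cintegrableZ a measurableT kf) kh).
    apply: eq_cintegral => x _.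
    by rewrite (kernel_op_linear mQ' fQ' mk bk a x bf bh) mulrDl mulrA.
  - move=> M f_ f bf Pf fl.
    have bfl := bounded_on_cvg bf fl; split; first by exists M.
    apply: (@ccvg_unique _ (fun n => pairing mu1 mu2 (T (f_ n)) g)).
      apply: (lo_continuous hT rQ' bf bfl);
        last exact: bounded_supp_rectangle rQ bg.
      exact: aeW.
    under [X in ccvg X]eq_fun do rewrite (Pf _).2.
    apply: (@cintegral_dominated _ _ _ _ _ _
      (fun x => 2 * (Mk * M * fine (mu Q')) * 1 * \1_Q x)).
    + move=> n; apply: cmeasurableM; last by case: bg.
      by apply: (cmeasurable_kernel_op sigma_finite_product) => //;
        case: (bf n).
    + exact: (integrable_cst_indic).
    + move=> n x; rewrite cabsM -mulrA ler_pM ?cabs_ge0 //.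
        exact: (kernel_op_bounded).
      exact: bounded_on_le.
    + move=> x; apply: ccvgM; last exact: ccvg_cst.
      exact: (kernel_op_cvg mQ' fQ' mk bk x bf fl).
  - move=> u' v' Cu' Cv' u'0 v'0 bf; split; first by exists 1.
    rewrite rep //; first last.
    + by move=> x /v0 ->.
    + by move=> x /u0 ->.
    + by move=> x /v'0 ->.
    + by move=> x /u'0 ->.
    apply: eq_cintegral => x _.
    exact: (kernel_op_outer mQ' fQ' mk bk _ x bf).
move=> M N f g bf; move: N g.
suff right_ext N g : bounded_on Q N g ->
    (exists N', bounded_on Q N' g) /\ pairing mu1 mu2 (T f) g =
    cintegral mu setT (fun x => kernel_op mu k f x * g x).
  by move=> N g /right_ext[].
move: N g; apply: (class_holder_tensor hX1 hX2 he1 he2 b11 b12).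
- move=> a g h [[M1 bg] Eg] [[M2 bh] Eh]; split.
    by exists (cabs a * M1 + M2); exact: bounded_onD.
  rewrite (pairing_linear_right _ rQ (bs _ _ bf) bg bh) Eg Eh.
  have [kg kh] := (kint _ _ _ _ bf bg, kint _ _ _ _ bf bh).
  rewrite -(cintegralZ a measurableT kg).
  rewrite -(cintegralD measurableT (cintegrableZ a measurableT kg) kh).
  by apply: eq_cintegral => x _; rewrite mulrDr mulrCA.
- move=> N g_ g bg Pg gl.
  have bgl := bounded_on_cvg bg gl; split; first by exists N.
  have [mf _ _] := bf.
  apply: (@ccvg_unique _ (fun n => pairing mu1 mu2 (T f) (g_ n))).
    have [i1 _] := integrable_operator_mul rQ bgl (bs _ _ bf).
    apply: (cintegral_dominated _ i1).
    + move=> n; apply: cmeasurableM; last by case: (bg n).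
      exact: lo_measurable hT _ (lo_dom_bounded hT (bs _ _ bf)).
    + move=> n x; rewrite cabsM mulrCA ler_wpM2l ?cabs_ge0 //.
      exact: bounded_on_le.
    + by move=> x; apply: ccvgM => //; exact: ccvg_cst.
  under [X in ccvg X]eq_fun do rewrite (Pg _).2.
  apply: (@cintegral_dominated _ _ _ _ _ _
    (fun x => 2 * (Mk * M * fine (mu Q')) * N * \1_Q x)).
  + move=> n; apply: cmeasurableM; last by case: (bg n).
    exact: (cmeasurable_kernel_op sigma_finite_product).
  + exact: (integrable_cst_indic).
  + move=> n x; rewrite cabsM -mulrA ler_pM ?cabs_ge0 //.
      exact: (kernel_op_bounded).
    exact: bounded_on_le.
  + by move=> x; apply: ccvgM => //; exact: ccvg_cst.
- move=> u v Cu Cv u0 v0 bg; split; first by exists 1.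
  by have [] := left_ext u v Cu Cv u0 v0 bg _ _ bf.
Qed.

End Representation.

(** * Absorption: the mean oscillation is controlled by tests on sets *)

Section TestingSets.
Context {R : realType} {disp : measure_display} {X : measurableType disp}.
Variable mu : {measure set X -> \bar R}.
Implicit Types (E : set X) (w : X -> R) (u : X -> R[i]).

Lemma integrable_bounded_indic E w M : measurable E -> (mu E < +oo)%E ->
  measurable_fun setT w -> (forall x, E x -> `|w x| <= M) ->
  mu.-integrable setT (EFin \o (fun x => w x * \1_E x)).
Proof.
move=> mE fE mw wM.
apply: (le_integrable measurableT _ _ (integrable_cst_indic M mE fE)).
  by apply/measurable_EFinP; apply: measurable_funM => //;
    exact: measurable_indic.
move=> x _ /=; rewrite lee_fin indicE.
have [Ex|Ex] := pselect (E x).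
  by rewrite mem_set // !mulr1 (le_trans (wM x Ex)) // ler_norm.
by rewrite memNset // !mulr0 lexx.
Qed.

Lemma Rintegral_cst_indic E (c : R) : measurable E -> (mu E < +oo)%E ->
  Rintegral mu setT (fun x => c * \1_E x) = c * fine (mu E).
Proof.
move=> mE fE.
have i1 : mu.-integrable setT (EFin \o (\1_E : X -> R)).
  by apply: eq_integrable (integrable_cst_indic 1 mE fE) => // x _ /=;
    rewrite mul1r.
by rewrite (RintegralZl _ measurableT i1) /Rintegral integral_indic // setIT.
Qed.

Lemma L1_norm_by_sets_real E w (M N : R) : measurable E -> (mu E < +oo)%E ->
  measurable_fun setT w -> (forall x, `|w x| <= M) ->
  (forall B, measurable B -> B `<=` E ->
     `|Rintegral mu setT (fun x => w x * \1_B x)| <= N) ->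
  Rintegral mu setT (fun x => `|w x| * \1_E x) <= 2 * N.
Proof.
move=> mE fE mw wM hN.
pose P := E `&` [set x | 0 <= w x]; pose Q := E `\` [set x | 0 <= w x].
have mpos : measurable [set x | 0 <= w x].
  have := measurable_fun_ler (@measurable_cst _ _ X R setT 0) mw.
  move=> /(_ measurableT [set true] I); rewrite setTI.
  by congr (measurable _); apply/seteqP; split.
have mP : measurable P by exact: measurableI.
have mQ : measurable Q by exact: measurableD.
have fin A : measurable A -> A `<=` E -> (mu A < +oo)%E.
  by move=> mA AE; apply: le_lt_trans fE; apply: le_measure; rewrite ?inE.
have PE : P `<=` E by exact: subIsetl.
have QE : Q `<=` E by exact: subDsetl.
have iP := integrable_bounded_indic mP (fin _ mP PE) mw (fun x _ => wM x).
have iQ := integrable_bounded_indic mQ (fin _ mQ QE) mw (fun x _ => wM x).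
have -> : Rintegral mu setT (fun x => `|w x| * \1_E x) =
    Rintegral mu setT (fun x => w x * \1_P x) -
    Rintegral mu setT (fun x => w x * \1_Q x).
  rewrite -(RintegralB measurableT iP iQ); apply: eq_Rintegral => x _.
  rewrite !indicE in_setI in_setD.
  have [h|h] := boolP (0 <= w x).
    rewrite (mem_set (A := [set x | 0 <= w x]) h) ger0_norm //.
    by rewrite andbT andbF mulr0 subr0.
  rewrite (memNset (A := [set x | 0 <= w x])); last exact/negP.
  by rewrite andbF andbT mulr0 sub0r ltr0_norm ?mulNr // ltNge.
apply: le_trans (ler_norm _) _; apply: le_trans (ler_normB _ _) _.
by rewrite mulr2n mulrDl mul1r lerD // hN.
Qed.

(** The four sets where the real or the imaginary part has a given sign suffice
    as tests, so indicators are enough and no sign function is needed. *)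
Lemma L1_norm_by_sets E u (M N : R) : measurable E -> (mu E < +oo)%E ->
  cmeasurable u -> (forall x, cabs (u x) <= M) ->
  (forall B, measurable B -> B `<=` E ->
     cabs (cintegral mu setT (fun x => u x * cind R B x)) <= N) ->
  Rintegral mu setT (fun x => cabs (u x) * \1_E x) <= 4 * N.
Proof.
move=> mE fE mu_ uM hN; have [mr mi] := mu_.
have reM x : `|complex.Re (u x)| <= M by rewrite (le_trans (Re_le_cabs _)).
have imM x : `|complex.Im (u x)| <= M by rewrite (le_trans (Im_le_cabs _)).
have hr := L1_norm_by_sets_real mE fE mr reM (N := N).
have hi := L1_norm_by_sets_real mE fE mi imM (N := N).
have ir : mu.-integrable setT (EFin \o (fun x => `|complex.Re (u x)| * \1_E x)).
  apply: (integrable_bounded_indic (M := M)) => //; last by move=> x _;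
    rewrite normr_id.
  exact: measurableT_comp.
have ii : mu.-integrable setT (EFin \o (fun x => `|complex.Im (u x)| * \1_E x)).
  apply: (integrable_bounded_indic (M := M)) => //; last by move=> x _;
    rewrite normr_id.
  exact: measurableT_comp.
have iu : mu.-integrable setT (EFin \o (fun x => cabs (u x) * \1_E x)).
  apply: (integrable_bounded_indic (M := M)) => //;
    first exact: measurable_cabs.
  by move=> x _; rewrite ger0_norm ?cabs_ge0.
apply: (@le_trans _ _ (Rintegral mu setT (fun x => `|complex.Re (u x)| * \1_E x
  +
    `|complex.Im (u x)| * \1_E x))).
  apply: le_Rintegral => //; first exact: (integrableD measurableT ir ii).
  by move=> x _; rewrite -mulrDl ler_wpM2r // cabs_le_ReIm.
rewrite (RintegralD measurableT ir ii).
have -> : 4 * N = 2 * N + 2 * N by ring.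
apply: lerD.
- apply: hr => B mB BE; apply: le_trans (hN B mB BE).
  apply: le_trans (Re_le_cabs _); rewrite /cintegral /=.
  have -> : Rintegral mu setT (fun x => complex.Re (u x * cind R B x)) =
      Rintegral mu setT (fun x => complex.Re (u x) * \1_B x).
    by apply: eq_Rintegral => x _; rewrite ReM /= mulr0 subr0.
  exact: lexx.
- apply: hi => B mB BE; apply: le_trans (hN B mB BE).
  apply: le_trans (Im_le_cabs _); rewrite /cintegral /=.
  have -> : Rintegral mu setT (fun x => complex.Im (u x * cind R B x)) =
      Rintegral mu setT (fun x => complex.Im (u x) * \1_B x).
    by apply: eq_Rintegral => x _; rewrite ImM /= mulr0 add0r.
  exact: lexx.
Qed.

End TestingSets.

Section Absorption.
Context {R : realType} {disp : measure_display} {X : measurableType disp}.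
Variable mu : {measure set X -> \bar R}.
Variables (E F : set X) (b : X -> R[i]) (k : X * X -> R[i]) (Mb Mk N : R).
Hypothesis smu : sigma_finite setT mu.
Hypotheses (mE : measurable E) (mF : measurable F).
Hypotheses (fE : (mu E < +oo)%E) (fF : (mu F < +oo)%E).
Hypotheses (E0 : 0 < fine (mu E)) (F0 : 0 < fine (mu F)).
Hypotheses (mb : cmeasurable b) (bM : forall x, cabs (b x) <= Mb).
Hypotheses (mk : cmeasurable k) (kM : forall z, cabs (k z) <= Mk).
Hypothesis k1 : forall x y, E x -> F y -> cabs (k (x, y) - 1) <= 72^-1.

Local Notation Int f := (Rintegral mu setT f).
Local Notation cInt f := (cintegral mu setT f).

(** The commutator of multiplication by [b] with the integral operator of kernel
    [k], evaluated on the indicator of [A]. *)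
Definition kernel_commutator (A : set X) (x : X) : R[i] :=
  b x * kernel_op mu k (cind R A) x - kernel_op mu k (fun y => b y * cind R A
    y) x.

Hypothesis testing : forall A B, measurable A -> A `<=` F ->
  measurable B -> B `<=` E ->
  cabs (cInt (fun x => kernel_commutator A x * cind R B x)) <= N.

Let fin_sub (E' A : set X) : measurable E' -> (mu E' < +oo)%E ->
  measurable A -> A `<=` E' -> (mu A < +oo)%E.
Proof. by move=> mE' fE' mA AE; apply: le_lt_trans fE'; apply: le_measure;
  rewrite ?inE. Qed.

Let bind A (Q : set X) : measurable A -> A `<=` Q -> bounded_on Q 1 (cind R A).
Proof. exact: bounded_on_cind. Qed.

Let bb A (Q : set X) : measurable A -> A `<=` Q ->
  bounded_on Q (Mb * 1) (fun y => b y * cind R A y).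
Proof.
move=> mA AQ; have bT : bounded_on setT Mb b by split => // x [].
by have := bounded_onM bT (bind mA AQ); rewrite setTI.
Qed.

Let cint_cind A : measurable A -> (mu A < +oo)%E ->
  cInt (cind R A) = (fine (mu A))%:C.
Proof.
move=> mA fA; rewrite /cintegral /cind /=; apply: complex_eq => /=.
- by rewrite /Rintegral integral_indic // setIT.
- by rewrite /Rintegral integral0.
Qed.

(* The quantity to be absorbed is [S], the integral of [|b x - b y|] over [E x
   F]. *)
Let s x := Int (fun y => cabs (b x - b y) * \1_F y).
Let S := Int (fun x => s x * \1_E x).

Let osc_le x y : cabs (b x - b y) <= Mb + Mb.
Proof. by rewrite (le_trans (ler_cabsD _ _)) // cabsN lerD. Qed.

Let mosc x : measurable_fun setT (fun y => cabs (b x - b y)).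
Proof.
by apply: measurable_cabs; apply: cmeasurableB => //; exact: cmeasurable_cst.
Qed.

Let iosc x : mu.-integrable setT (EFin \o (fun y => cabs (b x - b y) * \1_F y)).
Proof.
apply: (integrable_bounded_indic (M := Mb + Mb)) => //.
by move=> y _; rewrite ger0_norm ?cabs_ge0.
Qed.

Let s_ge0 x : 0 <= s x.
Proof. by apply: Rintegral_ge0 => y _; rewrite mulr_ge0 ?cabs_ge0. Qed.

Let ms : measurable_fun setT s.
Proof.
pose h (z : X * X) : R[i] := (cabs (b z.1 - b z.2) * \1_F z.2)%:C.
have mh : cmeasurable h.
  apply: cmeasurable_real; apply: measurable_funM.
    apply: measurable_cabs; apply: cmeasurableB;
      [exact: (cmeasurable_comp mb measurable_fst)|exact: (cmeasurable_comp mb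
        measurable_snd)].
  by apply: (measurableT_comp (f := \1_F : X -> R)) => //;
    exact: measurable_indic.
by have [] := cmeasurable_cintegral smu mh.
Qed.

Let s_le x : s x <= (Mb + Mb) * fine (mu F).
Proof.
rewrite -Rintegral_cst_indic //; apply: le_Rintegral => //.
- exact: integrable_cst_indic.
- by move=> y _; rewrite ler_wpM2r.
Qed.

Let is_ : mu.-integrable setT (EFin \o (fun x => s x * \1_E x)).
Proof.
apply: (integrable_bounded_indic (M := (Mb + Mb) * fine (mu F))) => //.
by move=> x _; rewrite ger0_norm.
Qed.

(* What the commutator would be for the constant kernel 1. *)
Let main_part (A : set X) (x : X) : R[i] :=
  (fine (mu A))%:C * b x - cInt (fun y => b y * cind R A y).

Let error_part A x := kernel_commutator A x - main_part A x.

Let mcomm A : measurable A -> cmeasurable (kernel_commutator A).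
Proof.
move=> mA; apply: cmeasurableB.
- apply: cmeasurableM => //; apply: cmeasurable_kernel_op => //.
  exact: cmeasurable_cind.
- apply: cmeasurable_kernel_op => //; apply: cmeasurableM => //.
  exact: cmeasurable_cind.
Qed.

Let mmain A : cmeasurable (main_part A).
Proof.
apply: cmeasurableB; last exact: cmeasurable_cst.
by apply: cmeasurableM => //; exact: cmeasurable_cst.
Qed.

Let error_le A x : measurable A -> A `<=` F -> E x ->
  cabs (error_part A x) <= 36^-1 * s x.
Proof.
move=> mA AF Ex; have fA := fin_sub mF fF mA AF.
pose h y := (b x - b y) * (k (x, y) - 1) * cind R A y.
have i1 := kernel_op_integrable mF fF mk kM x (bind mA AF).
have i2 := kernel_op_integrable mF fF mk kM x (bb mA AF).
have i3 : cintegrable mu setT (cind R A).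
  exact: (bounded_on_cintegrable mF fF (bind mA AF)).
have i4 : cintegrable mu setT (fun y => b y * cind R A y).
  exact: (bounded_on_cintegrable mF fF (bb mA AF)).
have E1 : error_part A x = cInt h.
  rewrite /error_part /kernel_commutator /main_part /kernel_op -cint_cind //.
  rewrite [X in X - cInt (fun y => b y * _)]mulrC.
  rewrite -(cintegralZ (b x) measurableT i1) -(cintegralZ (b x) measurableT i3).
  have j1 := cintegrableZ (b x) measurableT i1.
  have j3 := cintegrableZ (b x) measurableT i3.
  rewrite -(cintegralB measurableT j1 i2) -(cintegralB measurableT j3 i4).
  rewrite -(cintegralB measurableT (cintegrableB measurableT j1 i2)
    (cintegrableB measurableT j3 i4)).
  by apply: eq_cintegral => y _; rewrite /h; ring.
have ih : cintegrable mu setT h.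
  have j1 := cintegrableZ (b x) measurableT i1.
  have j3 := cintegrableZ (b x) measurableT i3.
  apply: eq_cintegrable (cintegrableB measurableT (cintegrableB measurableT j1
    i2) (cintegrableB measurableT j3 i4)) => // y _.
  by rewrite /h; ring.
rewrite E1; apply: le_trans (cabs_cintegral measurableT ih) _.
have -> : 36^-1 * s x = 2 * (72^-1 * s x) by field.
rewrite ler_pM2l // -(RintegralZl _ measurableT (iosc x)).
apply: le_Rintegral => //; first exact: cintegrable_cabs.
  exact: (integrableZl measurableT _ (iosc x)).
move=> y _; rewrite /h !cabsM.
have [Ay|Ay] := pselect (A y); last first.
  rewrite /cind indicE memNset // cabs0 mulr0.
  by rewrite !mulr_ge0 ?cabs_ge0.
rewrite /cind !indicE !mem_set //; last exact: AF.
rewrite cabs_real normr1 !mulr1 mulrC ler_wpM2r ?cabs_ge0 //.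
by apply: k1 => //; exact: AF.
Qed.

Let N' := N + 18^-1 * S.

Let bcomm A B : measurable A -> A `<=` F -> measurable B -> B `<=` E ->
  cintegrable mu setT (fun x => kernel_commutator A x * cind R B x).
Proof.
move=> mA AF mB BE; have fB := fin_sub mE fE mB BE.
pose M := Mb * (2 * (Mk * 1 * fine (mu F))) + 2 * (Mk * (Mb * 1) * fine (mu F)).
apply: (bounded_on_cintegrable (Q := B) (M := M * 1)) => //.
rewrite -[X in bounded_on X]setTI; apply: bounded_onM; last exact: bind.
split=> [|x|x []//]; first exact: mcomm.
apply: le_trans (ler_cabsD _ _) _; rewrite cabsN cabsM lerD //.
- apply: ler_pM; rewrite ?cabs_ge0 //.
  exact: (kernel_op_bounded mF fF mk kM x (bind mA AF)).
- exact: (kernel_op_bounded mF fF mk kM x (bb mA AF)).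
Qed.

Let bmain A x : measurable A -> A `<=` F ->
  cabs (main_part A x) <= fine (mu A) * Mb + 2 * (Mb * 1 * fine (mu A)).
Proof.
move=> mA AF; have fA := fin_sub mF fF mA AF.
apply: le_trans (ler_cabsD _ _) _; rewrite cabsN cabsM lerD //.
- by rewrite cabs_real ger0_norm ?fine_ge0 // ler_wpM2l ?fine_ge0.
- by apply: cabs_cintegral_bounded_on => //; exact: bb.
Qed.

Let imain A B : measurable A -> A `<=` F -> measurable B -> B `<=` E ->
  cintegrable mu setT (fun x => main_part A x * cind R B x).
Proof.
move=> mA AF mB BE; have fB := fin_sub mE fE mB BE.
apply: (bounded_on_cintegrable (Q := B)
  (M := (fine (mu A) * Mb + 2 * (Mb * 1 * fine (mu A))) * 1)) => //.
rewrite -[X in bounded_on X]setTI; apply: bounded_onM; last exact: bind.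
by split=> [|x|x []//]; [exact: mmain|exact: bmain].
Qed.

Let main_test A B : measurable A -> A `<=` F -> measurable B -> B `<=` E ->
  cabs (cInt (fun x => main_part A x * cind R B x)) <= N'.
Proof.
move=> mA AF mB BE.
have ic := bcomm mA AF mB BE; have im := imain mA AF mB BE.
have Eerr x : error_part A x * cind R B x =
    kernel_commutator A x * cind R B x - main_part A x * cind R B x.
  by rewrite /error_part mulrBl.
have ierr : cintegrable mu setT (fun x => error_part A x * cind R B x).
  by apply: eq_cintegrable (cintegrableB measurableT ic im) => // x _;
    rewrite Eerr.
have -> : cInt (fun x => main_part A x * cind R B x) =
    cInt (fun x => kernel_commutator A x * cind R B x) -
    cInt (fun x => error_part A x * cind R B x).
  rewrite -(cintegralB measurableT ic ierr); apply: eq_cintegral => x _.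
  by rewrite Eerr opprB addrC subrK.
apply: le_trans (ler_cabsD _ _) _; rewrite cabsN lerD //; first exact: testing.
apply: le_trans (cabs_cintegral measurableT ierr) _.
have -> : 18^-1 * S = 2 * (36^-1 * S) by field.
rewrite ler_pM2l // -(RintegralZl _ measurableT is_).
apply: le_Rintegral => //; first exact: cintegrable_cabs.
  exact: (integrableZl measurableT _ is_).
move=> x _; rewrite cabsM.
have [Bx|Bx] := pselect (B x); last first.
  by rewrite /cind indicE memNset // cabs0 mulr0 !mulr_ge0.
rewrite /cind !indicE !mem_set //; last exact: BE.
by rewrite cabs_real normr1 !mulr1 error_le //; exact: BE.
Qed.

Let bE := cInt (fun y => b y * cind R E y).
Let bF := cInt (fun y => b y * cind R F y).
Let mE_ := fine (mu E).
Let mF_ := fine (mu F).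
Let v (y : X) : R[i] := bE - mE_%:C * b y.

Let ib A (Q : set X) : measurable Q -> (mu Q < +oo)%E -> measurable A ->
  A `<=` Q ->
  cintegrable mu setT (fun y => b y * cind R A y).
Proof. by move=> mQ fQ mA AQ;
  exact: (bounded_on_cintegrable mQ fQ (bb mA AQ)). Qed.

(* Testing on the whole of [E] exchanges the roles of [E] and [F]. *)
Let swap_means A : measurable A -> A `<=` F ->
  cInt (fun x => main_part A x * cind R E x) = cInt (fun y => v y * cind R A y).
Proof.
move=> mA AF; have fA := fin_sub mF fF mA AF.
have iE := ib mE fE mE (@subset_refl _ _); have iA := ib mF fF mA AF.
have jE : cintegrable mu setT (cind R E).
  exact: (bounded_on_cintegrable mE fE (bind mE (@subset_refl _ _))).
have jA : cintegrable mu setT (cind R A).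
  exact: (bounded_on_cintegrable mA fA (bind mA (@subset_refl _ _))).
transitivity ((fine (mu A))%:C * bE - cInt (fun y => b y * cind R A y) *
  mE_%:C).
  rewrite /mE_ -(cint_cind mE fE) -(cintegralZ _ measurableT iE) -(cintegralZ _
    measurableT jE).
  rewrite -(cintegralB measurableT (cintegrableZ _ measurableT iE)
    (cintegrableZ _ measurableT jE)).
  by apply: eq_cintegral => x _; rewrite /main_part mulrBl mulrA.
rewrite mulrC [X in _ - X]mulrC -(cint_cind mA fA).
rewrite -(cintegralZ _ measurableT iA) -(cintegralZ _ measurableT jA).
rewrite -(cintegralB measurableT (cintegrableZ _ measurableT jA) (cintegrableZ
  _ measurableT iA)).
by apply: eq_cintegral => x _; rewrite /v mulrBl mulrA.
Qed.

Let mv : cmeasurable v.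
Proof.
apply: cmeasurableB; first exact: cmeasurable_cst.
by apply: cmeasurableM => //; exact: cmeasurable_cst.
Qed.

Let bv y : cabs (v y) <= cabs bE + mE_ * Mb.
Proof.
apply: le_trans (ler_cabsD _ _) _; rewrite cabsN cabsM lerD2l.
by rewrite cabs_real ger0_norm ?fine_ge0 // ler_wpM2l ?fine_ge0.
Qed.

Let u_mean : Int (fun x => cabs (main_part F x) * \1_E x) <= 4 * N'.
Proof.
apply: (L1_norm_by_sets mE fE (mmain F) (fun x => bmain x mF (@subset_refl _
  _))).
by move=> B mB BE; exact: main_test.
Qed.

Let v_mean : Int (fun y => cabs (v y) * \1_F y) <= 4 * N'.
Proof.
apply: (L1_norm_by_sets mF fF mv bv) => A mA AF.
by rewrite -swap_means //; exact: main_test.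
Qed.

Let cross : cabs (mF_%:C * bE - mE_%:C * bF) <= N'.
Proof.
have <- : cInt (fun y => v y * cind R F y) = mF_%:C * bE - mE_%:C * bF.
  rewrite -(swap_means mF (@subset_refl _ _)).
  have iE := ib mE fE mE (@subset_refl _ _).
  have jE : cintegrable mu setT (cind R E).
    exact: (bounded_on_cintegrable mE fE (bind mE (@subset_refl _ _))).
  rewrite [X in _ - X]mulrC /mE_ -(cint_cind mE fE).
  rewrite -(cintegralZ _ measurableT iE) -(cintegralZ _ measurableT jE).
  rewrite -(cintegralB measurableT (cintegrableZ _ measurableT iE)
    (cintegrableZ _ measurableT jE)).
  by apply: eq_cintegral => x _; rewrite /main_part mulrBl mulrA.
by rewrite -(swap_means mF (@subset_refl _ _)); exact: main_test.
Qed.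

(* The difference [b x - b y] passes through the two means. *)
Let pointwise x y : mE_ * mF_ * cabs (b x - b y) <=
  mE_ * cabs (main_part F x) + N' + mF_ * cabs (v y).
Proof.
have pos r : 0 <= r -> `|r| = r :> R by move/ger0_norm.
have -> : mE_ * mF_ * cabs (b x - b y) = cabs (mE_%:C * main_part F x -
    (mF_%:C * bE - mE_%:C * bF) + mF_%:C * v y).
  have e0 : 0 <= mE_ by exact: ltW.
  have f0 : 0 <= mF_ by exact: ltW.
  rewrite -[mE_ in LHS](pos _ e0) -[mF_ in LHS](pos _ f0) -!cabs_real -!cabsM.
  by congr cabs; rewrite /main_part /v -/mF_ -/bF; ring.
apply: le_trans (ler_cabsD _ _) _; apply: lerD; last first.
  by rewrite cabsM cabs_real ger0_norm // ltW.
apply: le_trans (ler_cabsD _ _) _; rewrite cabsN lerD //.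
by rewrite cabsM cabs_real ger0_norm // ltW.
Qed.

Let oscillation : S <= 9 * N'.
Proof.
have iu : mu.-integrable setT (EFin \o (fun x => cabs (main_part F x) * \1_E
  x)).
  apply: integrable_bounded_indic => //; first exact: measurable_cabs (mmain F).
  by move=> x _; rewrite ger0_norm ?cabs_ge0 //; exact: bmain.
have iv : mu.-integrable setT (EFin \o (fun x => cabs (v x) * \1_F x)).
  apply: integrable_bounded_indic => //; first exact: measurable_cabs mv.
  by move=> x _; rewrite ger0_norm ?cabs_ge0 //; exact: bv.
have s_bound x : mE_ * s x <= mE_ * cabs (main_part F x) + 5 * N'.
  rewrite -(ler_pM2l F0) -/mF_ mulrA -(RintegralZl _ measurableT (iosc x)).
  have ic := integrable_cst_indic (mE_ * cabs (main_part F x) + N') mF fF.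
  have iZ := integrableZl measurableT mF_ iv.
  apply: (@le_trans _ _ (Int (fun y => (mE_ * cabs (main_part F x) + N') * \1_F
    y +
      mF_ * (cabs (v y) * \1_F y)))).
    apply: le_Rintegral => //.
    - exact: (integrableZl measurableT _ (iosc x)).
    - exact: (integrableD measurableT ic iZ).
    - move=> y _; rewrite !mulrA -mulrDl ler_wpM2r // [_ * mE_]mulrC.
      exact: pointwise.
  rewrite (RintegralD measurableT ic iZ) (RintegralZl _ measurableT iv).
  rewrite Rintegral_cst_indic // -/mF_ mulrC -mulrDr ler_pM2l //.
  by have := v_mean; set q := Int _; set w := _ * cabs _; lra.
rewrite -(ler_pM2l E0) -/mE_ -(RintegralZl _ measurableT is_).
have ic := integrable_cst_indic (5 * N') mE fE.
have iZ := integrableZl measurableT mE_ iu.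
apply: (@le_trans _ _ (Int (fun x => mE_ * (cabs (main_part F x) * \1_E x) +
    5 * N' * \1_E x))).
  apply: le_Rintegral => //.
  - exact: (integrableZl measurableT _ is_).
  - exact: (integrableD measurableT iZ ic).
  - by move=> x _; rewrite !mulrA -mulrDl ler_wpM2r.
rewrite (RintegralD measurableT iZ ic) (RintegralZl _ measurableT iu).
rewrite Rintegral_cst_indic // -/mE_ [5 * N' * _]mulrC -mulrDr ler_pM2l //.
by have := u_mean; set q := Int _; lra.
Qed.

(** A kernel close to the constant 1 on [E x F] reproduces the difference [b x -
    b y] up to an error proportional to its mean over [E x F]. The tests bound
    that mean by a multiple of [N] plus half of itself ([oscillation]: the error
    constant [1/72] makes [9 * 18^-1 = 1/2]); it is finite because [b] is
    bounded, so it can be absorbed. The test with the whole of [F] then gives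
    the oscillation on [E]. *)
Lemma absorption :
  Int (fun x => cabs ((fine (mu F))%:C * b x - cInt (fun y => b y * cind R F y))
    * \1_E x) <= 8 * N.
Proof.
have := oscillation; have := u_mean; rewrite /N' /main_part -/bF.
by set q := Int _; lra.
Qed.

End Absorption.

(** * Weights *)

Lemma holder_on {R : realType} {disp : measure_display} {X : measurableType
  disp}
    (mu : {measure set X -> \bar R}) (D : set X) (u v : X -> R) (p q : R) :
  measurable D -> measurable_fun setT u -> measurable_fun setT v ->
  (forall x, 0 <= u x) -> (forall x, 0 <= v x) ->
  0 < p -> 0 < q -> p^-1 + q^-1 = 1 ->
  (\int[mu]_(x in D) (u x * v x)%:E <=
   poweR (\int[mu]_(x in D) (u x `^ p)%:E) p^-1 *
   poweR (\int[mu]_(x in D) (v x `^ q)%:E) q^-1)%E.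
Proof.
move=> mD mu_ mv u0 v0 p0 q0 pq.
have mD1 : measurable_fun setT (\1_D : X -> R) by exact: measurable_indic.
have := hoelder mu (measurable_funM mu_ mD1) (measurable_funM mv mD1) p0 q0 pq.
have power (w : X -> R) r : 0 < r -> (forall x, 0 <= w x) ->
    Lnorm mu r%:E (EFin \o (fun x => w x * \1_D x)) =
    poweR (\int[mu]_(x in D) (w x `^ r)%:E)%E r^-1.
  move=> r0 w0; rewrite Lnorm.unlock /=; congr (poweR _ _).
  rewrite [RHS]integral_mkcond; apply: eq_integral => x _.
  rewrite patchE indicE /= ger0_norm ?mulr_ge0 //.
  by case: (x \in D) => /=; rewrite ?mulr1 ?mulr0 ?powR0 ?gt_eqF.
move=> h; have {h} := le_trans _ h; rewrite !power //; apply.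
rewrite Lnorm1 integral_mkcond; apply: ge0_le_integral => //.
- by move=> x _; rewrite patchE; case: ifP => // _; rewrite lee_fin mulr_ge0.
- apply/(measurable_restrictT _ mD).1; apply: measurable_funTS.
  by apply/measurable_EFinP; exact: measurable_funM.
- apply: measurableT_comp => //; apply/measurable_EFinP.
  by apply: measurable_funM; apply: measurable_funM.
- move=> x _; rewrite patchE /= indicE; case: (x \in D) => /=.
    by rewrite !mulr1 lee_fin ler_norm.
  by rewrite lee_fin.
Qed.

Lemma holder_powers {R : realType} {disp : measure_display} {X : measurableType
  disp}
    (mu : {measure set X -> \bar R}) (D : set X) (u v : X -> R) (p q : R) :
  measurable D -> measurable_fun setT u -> measurable_fun setT v ->
  (forall x, 0 <= u x) -> (forall x, 0 <= v x) ->
  0 < p -> 0 < q -> p^-1 + q^-1 = 1 ->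
  (\int[mu]_(x in D) (u x `^ p^-1 * v x `^ q^-1)%:E <=
   poweR (\int[mu]_(x in D) (u x)%:E) p^-1 *
   poweR (\int[mu]_(x in D) (v x)%:E) q^-1)%E.
Proof.
move=> mD mu_ mv u0 v0 p0 q0 pq.
have mpow (w : X -> R) r : measurable_fun setT w ->
  measurable_fun setT (fun x => w x `^ r).
  by move=> mw; exact: (measurableT_comp (measurable_powR r) mw).
have inv (w : X -> R) r : 0 < r -> (forall x, 0 <= w x) ->
    (\int[mu]_(x in D) ((w x `^ r^-1) `^ r)%:E = \int[mu]_(x in D) (w x)%:E)%E.
  by move=> r0 w0; apply: eq_integral => x _;
    rewrite -powRrM mulVf ?gt_eqF // powRr1.
rewrite -(inv u p p0 u0) -(inv v q q0 v0).
exact: holder_on (mpow _ p^-1 mu_) (mpow _ q^-1 mv)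
  (fun x => powR_ge0 _ _) (fun x => powR_ge0 _ _) p0 q0 pq.
Qed.

Section Weights.
Context {R : realType} {disp1 disp2 : measure_display}.
Context {X1 : measurableType disp1} {X2 : measurableType disp2}.
Variables (d1 : X1 -> X1 -> R) (d2 : X2 -> X2 -> R).
Variables (mu1 : {sigma_finite_measure set X1 -> \bar R}).
Variables (mu2 : {sigma_finite_measure set X2 -> \bar R}).
Variables (A0 theta1 theta2 : R).
Local Notation XX := (X1 * X2)%type.
Local Notation mu := (mu1 \x mu2)%E.
Hypothesis hX1 : homogeneous_space d1 mu1 A0 theta1.
Hypothesis hX2 : homogeneous_space d2 mu2 A0 theta2.
Variable p : R.
Hypothesis p1 : 1 < p.

Let p0 : 0 < p. Proof. exact: lt_trans ltr01 p1. Qed.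
Let pm1 : 0 < p - 1. Proof. by rewrite subr_gt0. Qed.
Let q := p / (p - 1).
Let q0 : 0 < q. Proof. exact: divr_gt0. Qed.
Let pn0 : p != 0. Proof. by rewrite gt_eqF. Qed.
Let pm1n0 : p - 1 != 0. Proof. by rewrite gt_eqF. Qed.
Let qV : q^-1 = (p - 1) / p. Proof. by rewrite /q invf_div. Qed.
Let pq : p^-1 + q^-1 = 1.
Proof. by rewrite qV; field. Qed.

(** The weight in the dual Lebesgue space of [w]. *)
Definition dual_weight (w : XX -> R) (x : XX) : R := w x `^ (- (p - 1)^-1).

Lemma measurable_of_rectangles (f : XX -> R) :
  (forall Q, rectangles d1 d2 Q -> measurable_fun Q f) -> measurable_fun setT f.
Proof.
move=> hf; have [[[ o1 o2] _]|XX0] := pselect (nonempty [set: XX]); last first.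
  rewrite (_ : setT = set0); first exact: measurable_fun_set0.
  by apply/seteqP; split => // x _; apply: XX0; exists x.
rewrite -(bigcup_rectangle d1 d2 o1 o2).
have rQ n : rectangles d1 d2 (qball d1 o1 n.+1%:R `*` qball d2 o2 n.+1%:R).
  by exists (qball d1 o1 n.+1%:R), (qball d2 o2 n.+1%:R); split => //;
    [exists o1, n.+1%:R|exists o2, n.+1%:R].
apply/measurable_fun_bigcup => n; last exact: hf.
exact: rectangle_measurable hX1 hX2 _ (rQ n).
Qed.

Lemma measurable_weight w : Ap_weight d1 d2 mu1 mu2 p w ->
  measurable_fun setT w.
Proof.
move=> hw; apply: measurable_of_rectangles => Q rQ.
by apply/measurable_EFinP; exact: measurable_int (Ap_loc hw rQ).
Qed.

Lemma measurable_powR_fun (w : XX -> R) r :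
  measurable_fun setT w -> measurable_fun setT (fun x => w x `^ r).
Proof. by move=> mw; exact: (measurableT_comp (measurable_powR r) mw). Qed.

Lemma rectangle_gt0 Q : rectangles d1 d2 Q -> 0 < fine (mu Q).
Proof.
move=> [_ [_ [[c1 [r1 [r10 ->]]] [c2 [r2 [r20 ->]]] ->]]].
rewrite (rectangle_measure hX1 hX2) //= mulr_gt0 //.
- exact: (qball_gt0 hX1).
- exact: (qball_gt0 hX2).
Qed.

Lemma rectangle_fineK Q : rectangles d1 d2 Q -> (fine (mu Q))%:E = mu Q.
Proof.
by move=> rQ; rewrite fineK // ge0_fin_numE //; exact: (rectangle_fin hX1 hX2).
Qed.

Let dual_power w x : dual_weight w x `^ q^-1 = w x `^ (- p^-1).
Proof.
rewrite /dual_weight -powRrM qV; congr (_ `^ _).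
by field; rewrite ?pn0 ?pm1n0.
Qed.

Let le_poweR (r : R) (x y : \bar R) : 0 <= r -> (0 <= x)%E -> (x <= y)%E ->
  (poweR x r <= poweR y r)%E.
Proof.
move=> r0 x0 xy; apply: gt0_ler_poweR => //; rewrite in_itv /= ?x0 ?leey //.
by rewrite (le_trans x0 xy).
Qed.

Let integral_rectangle1 Q (f : XX -> R) : rectangles d1 d2 Q ->
  measurable_fun setT f -> (forall x, 0 <= f x) ->
  {ae mu, forall x, f x = 1} ->
  (\int[mu]_(x in Q) (f x)%:E)%E = mu Q.
Proof.
move=> rQ mf f0 f1; have mQ := rectangle_measurable hX1 hX2 rQ.
rewrite -[RHS]mul1e -[RHS](integral_cst mu mQ 1%E).
apply: ge0_ae_eq_integral => //.
- by apply/measurable_EFinP; exact: measurable_funTS.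
- by move=> x _; rewrite lee_fin.
- by apply: filterS f1 => x -> _.
Qed.

(** The A_p condition in terms of finite positive numbers. Hölder's inequality
    for the product [1] of two powers of [w] bounds the measure of [Q] by both
    integrals, so neither vanishes; the A_p product then forces both to be
    finite. *)
Lemma Ap_real w : Ap_weight d1 d2 mu1 mu2 p w -> exists2 A : R, 0 <= A &
  forall Q, rectangles d1 d2 Q -> exists L s : R, [/\ 0 < L, 0 < s,
    (\int[mu]_(x in Q) (w x)%:E)%E = L%:E,
    (\int[mu]_(x in Q) (dual_weight w x)%:E)%E = s%:E &
    L `^ p^-1 * s `^ ((p - 1) / p) <= A * fine (mu Q)].
Proof.
move=> hw; have w0 := Ap_ge0 hw; have mw := measurable_weight hw.
have md : measurable_fun setT (dual_weight w) by exact: measurable_powR_fun.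
have [A hA] : exists A : R, (Ap_const d1 d2 mu1 mu2 p w <= A%:E)%E.
  have := Ap_fin hw; case: (Ap_const _ _ _ _ _ _) => [r _|//|_].
    by exists r.
  by exists 0; rewrite leNye.
exists (`|A| `^ p^-1); first exact: powR_ge0.
move=> Q rQ; have mQ := rectangle_measurable hX1 hX2 rQ.
have m0 := rectangle_gt0 rQ; have mE := rectangle_fineK rQ.
set m := fine (mu Q) in m0 mE *.
have iL := Ap_loc hw rQ.
have LE : (\int[mu]_(x in Q) (w x)%:E)%E = (Rintegral mu Q w)%:E.
  by rewrite /Rintegral fineK //; exact: integrable_fin_num.
have L0' : 0 <= Rintegral mu Q w by exact: Rintegral_ge0.
set L := Rintegral mu Q w in LE L0'.
set s := (\int[mu]_(x in Q) (dual_weight w x)%:E)%E.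
have s0' : (0 <= s)%E by apply: integral_ge0 => x _; rewrite lee_fin powR_ge0.
have hold : (m%:E <= poweR L%:E p^-1 * poweR s q^-1)%E.
  have := holder_powers mu mQ mw md w0 (fun x => powR_ge0 _ _) p0 q0 pq.
  rewrite LE -/s (integral_rectangle1 rQ) -?mE //.
  - by apply: measurable_funM; exact: measurable_powR_fun.
  - by move=> x; rewrite mulr_ge0 ?powR_ge0.
  - apply: filterS (Ap_gt0 hw) => x wx; rewrite dual_power.
    by rewrite -powRD ?(gt_eqF wx) ?implybT // subrr powRr0.
have L0 : 0 < L.
  rewrite lt_neqAle L0' andbT; apply/eqP => L00; move: hold.
  by rewrite -L00 poweR_EFin powR0 ?invr_eq0 // mul0e lee_fin leNgt m0.
have sup : (mean_ge0 mu1 mu2 Q w *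
    poweR (mean_ge0 mu1 mu2 Q (dual_weight w)) (p - 1) <= A%:E)%E.
  by apply: le_trans hA; apply: ereal_sup_ubound; exists Q.
rewrite /mean_ge0 LE -mE -/s inver gt_eqF // -EFinM in sup.
have sfin : s \is a fin_num.
  rewrite ge0_fin_numE // ltNge leye_eq; apply/eqP => soo; move: sup.
  rewrite soo gt0_muley ?lte_fin ?invr_gt0 // poweRyr // gt0_muley ?leye_eq //.
  by rewrite lte_fin mulr_gt0 // invr_gt0.
have sE : s = (fine s)%:E by rewrite fineK.
have s0 : 0 < fine s.
  rewrite lt_neqAle fine_ge0 // andbT; apply/eqP => s00; move: hold.
  rewrite sE -s00 [in X in (_ * X)%E]poweR_EFin powR0 ?invr_eq0 ?gt_eqF //.
  by rewrite mule0 lee_fin leNgt m0.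
exists L, (fine s); split => //.
rewrite sE -EFinM lee_fin in sup.
have mi0 : 0 < m^-1 by rewrite invr_gt0.
have mx0 : 0 <= m^-1 * L by rewrite mulr_ge0 // ltW.
have my0 : 0 <= m^-1 * fine s by rewrite mulr_ge0 // ltW.
have {}sup : (m^-1 * L) `^ p^-1 * (m^-1 * fine s) `^ ((p - 1) / p) <= `|A| `^
  p^-1.
  rewrite powRrM -powRM ?powR_ge0 //.
  apply: ge0_ler_powR; rewrite ?nnegrE //.
  - by rewrite invr_ge0 ltW.
  - exact: mulr_ge0 mx0 (powR_ge0 _ _).
  - exact: le_trans sup (ler_norm _).
have {sup} := ler_wpM2r (ltW m0) sup; apply: le_trans.
rewrite !powRM ?(ltW L0) ?(ltW s0) ?(ltW mi0) //.
have -> : (m^-1) `^ p^-1 = m `^ (- p^-1)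
  by rewrite -(powR_inv1 (ltW m0)) -powRrM mulN1r.
have -> : (m^-1) `^ ((p - 1) / p) = m `^ (- ((p - 1) / p)).
  by rewrite -(powR_inv1 (ltW m0)) -powRrM mulN1r.
have e1 : m `^ (- p^-1) * m `^ (- ((p - 1) / p)) * m = 1.
  have pw : m `^ (- p^-1) * m `^ (- ((p - 1) / p)) = m^-1.
    rewrite -powRD ?(gt_eqF m0) ?implybT // -opprD -qV pq.
    by rewrite powR_inv1 // ltW.
  by rewrite pw mulVf ?gt_eqF.
rewrite le_eqVlt; apply/orP; left; apply/eqP.
have reorder (a b c d e : R) : a * b * (c * d * e) = c * a * (d * b) * e
  by ring.
transitivity (L `^ p^-1 * fine s `^ ((p - 1) / p) *
  (m `^ (- p^-1) * m `^ (- ((p - 1) / p)) * m)); first by rewrite e1 mulr1.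
exact: reorder.
Qed.

(** On a rectangle, the three averages of [nu], of the dual weight of [l1] and
    of [l2] satisfy a reverse product inequality, because the corresponding
    powers have pointwise product 1. Combined with the A_p conditions, it
    replaces the first weight and the dual of the second one by [nu]. *)
Lemma weights_bloom (l1 l2 : XX -> R) (G : R) :
  Ap_weight d1 d2 mu1 mu2 p l1 -> Ap_weight d1 d2 mu1 mu2 p l2 -> 0 <= G ->
  let nu := fun x => l1 x `^ p^-1 * l2 x `^ (- p^-1) in
  exists2 C : R, 0 < C & forall Q Qt Q',
    rectangles d1 d2 Q -> rectangles d1 d2 Qt -> rectangles d1 d2 Q' ->
    Q `<=` Q' -> Qt `<=` Q' -> fine (mu Q') <= G * fine (mu Q) ->
    exists t s : R, [/\ 0 < t, 0 < s, (\int[mu]_(x in Qt) (l1 x)%:E)%E = t%:E,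
      (\int[mu]_(x in Q) (dual_weight l2 x)%:E)%E = s%:E &
      ((t `^ p^-1 * s `^ ((p - 1) / p))%:E <= C%:E * \int[mu]_(x in Q) (nu
        x)%:E)%E].
Proof.
move=> h1 h2 G0 nu.
have [A1 A10 hA1] := Ap_real h1; have [A2 A20 hA2] := Ap_real h2.
exists (1 + A1 * A2 * G); first by rewrite ltr_pwDl // !mulr_ge0.
move=> Q Qt Q' rQ rQt rQ' QQ' QtQ' mQQ'.
have mQ := rectangle_measurable hX1 hX2 rQ.
have mQt := rectangle_measurable hX1 hX2 rQt.
have mQ' := rectangle_measurable hX1 hX2 rQ'.
have [t [_ [t0 _ tE _ _]]] := hA1 Qt rQt.
have [L1 [s1 [L10 s10 _ s1E _]]] := hA1 Q rQ.
have [L' [s' [L'0 s'0 L'E s'E hA1']]] := hA1 Q' rQ'.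
have [L2 [s [L20 s0 L2E sE hA2']]] := hA2 Q rQ.
have l10 := Ap_ge0 h1; have l20 := Ap_ge0 h2.
have m1 := measurable_weight h1; have m2 := measurable_weight h2.
have md1 : measurable_fun setT (dual_weight l1) by exact: measurable_powR_fun.
have m0 := rectangle_gt0 rQ; have mE := rectangle_fineK rQ.
set m := fine (mu Q) in m0 mE mQQ' hA2' *.
exists t, s; split=> //.
have mnu : measurable_fun setT nu.
  by apply: measurable_funM; exact: measurable_powR_fun.
have nu0 x : 0 <= nu x by rewrite mulr_ge0 ?powR_ge0.
set n := (\int[mu]_(x in Q) (nu x)%:E)%E.
have n0 : (0 <= n)%E by apply: integral_ge0 => x _; rewrite lee_fin.
have tL' : t <= L'.
  rewrite -lee_fin -tE -L'E; apply: ge0_subset_integral => //.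
  - by apply/measurable_EFinP; exact: measurable_funTS.
  - by move=> x _; rewrite lee_fin.
have s1s' : s1 <= s'.
  rewrite -lee_fin -s1E -s'E; apply: ge0_subset_integral => //.
  - by apply/measurable_EFinP; exact: measurable_funTS.
  - by move=> x _; rewrite lee_fin powR_ge0.
pose Z x := dual_weight l1 x `^ ((p - 1) / p) * l2 x `^ p^-1.
have mZ : measurable_fun setT Z.
  by apply: measurable_funM; exact: measurable_powR_fun.
have Z0 x : 0 <= Z x by rewrite mulr_ge0 ?powR_ge0.
have ZE : (\int[mu]_(x in Q) (Z x)%:E <=
    (s1 `^ ((p - 1) / p) * L2 `^ p^-1)%:E)%E.
  rewrite EFinM -!poweR_EFin -s1E -L2E /Z -qV.
  apply: holder_powers => //; last by rewrite addrC.
  by move=> x; exact: powR_ge0.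
set z := s1 `^ ((p - 1) / p) * L2 `^ p^-1 in ZE.
have z0 : 0 < z by rewrite mulr_gt0 // powR_gt0.
have CS : (m%:E <= poweR n 2^-1 * poweR z%:E 2^-1)%E.
  have half : (2 : R)^-1 + 2^-1 = 1 by field.
  have := holder_powers mu mQ mnu mZ nu0 Z0 (ltr0n _ 2) (ltr0n _ 2) half.
  rewrite (integral_rectangle1 rQ); last 3 first.
  - by apply: measurable_funM; exact: measurable_powR_fun.
  - by move=> x; rewrite mulr_ge0 ?powR_ge0.
  - apply: filterS2 (Ap_gt0 h1) (Ap_gt0 h2) => x l1x l2x.
    rewrite -powRM // (_ : nu x * Z x = 1) ?powR1 //.
    rewrite /nu /Z -qV dual_power mulrACA.
    rewrite -!powRD ?(gt_eqF l1x) ?(gt_eqF l2x) ?implybT //.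
    by rewrite subrr addNr !powRr0 mulr1.
  rewrite -mE => h; apply: le_trans h _; apply: lee_pmul => //;
    rewrite ?poweR_ge0 //.
  apply: le_poweR; [by rewrite invr_ge0| |exact: ZE].
  by apply: integral_ge0 => x _; rewrite lee_fin.
(* Only a finite integral of [nu] is of interest. *)
case: n n0 CS => [n|_ _|//]; last first.
  by rewrite gt0_muley ?leey // lte_fin ltr_pwDl // !mulr_ge0.
rewrite lee_fin => n0; rewrite !poweR_EFin -EFinM lee_fin -powRM ?(ltW z0) //
  => CS.
have mz : m ^+ 2 <= n * z.
  rewrite -powR_mulrn ?(ltW m0) //.
  have -> : n * z = ((n * z) `^ 2^-1) `^ 2%:R.
    by rewrite -powRrM mulVf // powRr1 // mulr_ge0 // ltW.
  by apply: ge0_ler_powR; rewrite ?nnegrE ?powR_ge0 // ltW.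
rewrite -EFinM lee_fin.
(* The factor [z] is finite and positive, so it may be multiplied in. *)
suff : t `^ p^-1 * s `^ ((p - 1) / p) * z <= A1 * A2 * G * (n * z).
  rewrite [leRHS]mulrA ler_pM2r // => h; apply: le_trans h _.
  by rewrite ler_wpM2r // lerDr.
apply: (@le_trans _ _ (A1 * A2 * G * m ^+ 2)); last first.
  by rewrite ler_wpM2l // !mulr_ge0.
have b1 : t `^ p^-1 * s1 `^ ((p - 1) / p) <= A1 * (G * m).
  apply: (@le_trans _ _ (L' `^ p^-1 * s' `^ ((p - 1) / p))).
    apply: ler_pM; rewrite ?powR_ge0 //.
    - by apply: ge0_ler_powR; rewrite ?nnegrE ?invr_ge0 // ltW.
    - by apply: ge0_ler_powR; rewrite ?nnegrE -?qV ?invr_ge0 // ltW.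
  by apply: le_trans hA1' _; rewrite ler_wpM2l.
have -> : t `^ p^-1 * s `^ ((p - 1) / p) * z =
   (t `^ p^-1 * s1 `^ ((p - 1) / p)) * (L2 `^ p^-1 * s `^ ((p - 1) / p)).
  by rewrite /z; ring.
have -> : A1 * A2 * G * m ^+ 2 = (A1 * (G * m)) * (A2 * m) by ring.
by apply: ler_pM; rewrite ?mulr_ge0 ?powR_ge0.
Qed.

End Weights.

(** * The kernel is nearly constant on separated rectangles *)

Section KernelOnSeparatedRectangles.
Context {R : realType} {disp1 disp2 : measure_display}.
Context {X1 : measurableType disp1} {X2 : measurableType disp2}.
Variables (d1 : X1 -> X1 -> R) (d2 : X2 -> X2 -> R).
Variables (mu1 : {sigma_finite_measure set X1 -> \bar R}).
Variables (mu2 : {sigma_finite_measure set X2 -> \bar R}).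
Variables (A0 theta1 theta2 delta : R).
Local Notation XX := (X1 * X2)%type.
Hypothesis hX1 : homogeneous_space d1 mu1 A0 theta1.
Hypothesis hX2 : homogeneous_space d2 mu2 A0 theta2.
Hypothesis hdelta : 0 < delta.
Variable K : XX -> XX -> R[i].

Local Notation m1 x r := (fine (mu1 (qball d1 x r))).
Local Notation m2 x r := (fine (mu2 (qball d2 x r))).

(** The homogeneous condition is applied at the scale [A r]. Moving the four
    variables one at a time, each step gains [A ^ - delta] over the size bound,
    which the homogeneous condition compares with the value at the centres. *)
Lemma kernel_nearly_constant (C eps : R) :
  journe_kernel d1 d2 mu1 mu2 A0 delta C K ->
  homogeneous_condition d1 d2 mu1 mu2 K -> 0 < eps ->
  exists t c : R, [/\ 0 < t, 0 < c & forall c1 c2 r1 r2, 0 < r1 -> 0 < r2 ->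
    exists c1' c2', [/\ d1 c1 c1' < t * r1, d2 c2 c2' < t * r2,
      4 * A0 ^+ 3 * r1 <= d1 c1 c1', 4 * A0 ^+ 3 * r2 <= d2 c2 c2' &
      0 < cabs (K (c1, c2) (c1', c2')) /\
      (cabs (K (c1, c2) (c1', c2')))^-1 <= c * (m1 c1 r1 * m2 c2 r2) /\
      forall x y, (qball d1 c1 r1 `*` qball d2 c2 r2) x ->
        (qball d1 c1' r1 `*` qball d2 c2' r2) y ->
        [/\ x.1 <> y.1, x.2 <> y.2 & cabs (K x y - K (c1, c2) (c1', c2')) <=
          eps * cabs (K (c1, c2) (c1', c2'))]]].
Proof.
move=> jk [c0 [Cbar [c00 Cbar0 hK]]] eps0.
have [G1 G11 sep1] := separated_balls hX1 hdelta.
have [G2 G21 sep2] := separated_balls hX2 hdelta.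
have A00 : 0 < A0 by exact: lt_le_trans (quasi_constant_ge1 hX1).
have G10 : 0 < G1 by exact: lt_le_trans G11.
have G20 : 0 < G2 by exact: lt_le_trans G21.
(* [M] is chosen so that four errors of relative size [A ^ - delta <= 1 / M] add
   up to at most [eps]. *)
pose M := 4 * (1 + `|C|) * (G1 * G2) * c0 / eps.
have M0 : 0 < M by rewrite divr_gt0 // !mulr_gt0 // ltr_pwDl.
pose A := 4 * A0 ^+ 3 + M `^ delta^-1.
have A4 : 4 * A0 ^+ 3 <= A by rewrite lerDl powR_ge0.
have Agt0 : 0 < A by apply: lt_le_trans A4; rewrite mulr_gt0 // exprn_gt0.
have AM : A `^ (- delta) <= M^-1.
  rewrite powRN lef_pV2 ?posrE ?powR_gt0 //.
  have -> : M = (M `^ delta^-1) `^ delta.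
    by rewrite -powRrM mulVf ?gt_eqF // powRr1 // ltW.
  apply: ge0_ler_powR; rewrite ?nnegrE ?powR_ge0 //; [exact: ltW|exact: ltW|].
  by rewrite lerDr mulr_ge0 // exprn_ge0 // ltW.
have [D1 D11 dbl1] := doubling_scale hX1 A.
have [D2 D21 dbl2] := doubling_scale hX2 A.
exists (Cbar * A), (c0 * (D1 * D2)); split.
- by rewrite mulr_gt0.
- by rewrite !mulr_gt0 // (lt_le_trans ltr01).
move=> c1 c2 r1 r2 r10 r20.
have Ar1 : 0 < A * r1 by rewrite mulr_gt0.
have Ar2 : 0 < A * r2 by rewrite mulr_gt0.
have [c1' [c2' [[far1 near1] [far2 near2] low]]] := hK c1 c2 _ _ Ar1 Ar2.
exists c1', c2'.
rewrite /qball /= in far1 near1 far2 near2.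
have {}near1 : A * r1 <= d1 c1 c1' by rewrite leNgt; apply/negP.
have {}near2 : A * r2 <= d2 c2 c2' by rewrite leNgt; apply/negP.
set W1 := m1 c1 (A * r1) in low; set W2 := m2 c2 (A * r2) in low.
have W10 : 0 < W1 := qball_gt0 hX1 c1 Ar1.
have W20 : 0 < W2 := qball_gt0 hX2 c2 Ar2.
set K0 := K (c1, c2) (c1', c2') in low *.
have K0gt0 : 0 < cabs K0.
  by apply: lt_le_trans low; rewrite invr_gt0 !mulr_gt0.
split.
- by rewrite -mulrA.
- by rewrite -mulrA.
- by apply: le_trans near1; rewrite ler_wpM2r // ltW.
- by apply: le_trans near2; rewrite ler_wpM2r // ltW.
split=> //; split.
  apply: (@le_trans _ _ (c0 * W1 * W2)).
    by rewrite -[leRHS]invrK lef_pV2 // posrE ?invr_gt0 ?mulr_gt0.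
  rewrite -!mulrA ler_pM2l //.
  have -> : D1 * (D2 * (m1 c1 r1 * m2 c2 r2)) = (D1 * m1 c1 r1) * (D2 * m2 c2
    r2) by ring.
  by apply: ler_pM; rewrite ?(ltW W10) ?(ltW W20) //; [exact: dbl1|exact: dbl2].
move=> [x1 x2] [y1 y2] [/= cx1 cx2] [/= cy1 cy2].
have cc1 := qball_center hX1 c1 r10; have cc2 := qball_center hX2 c2 r20.
have cc1' := qball_center hX1 c1' r10; have cc2' := qball_center hX2 c2' r20.
have S1 := sep1 A c1 c1' r1 A4 r10 near1.
have S2 := sep2 A c2 c2' r2 A4 r20 near2.
have [x1y1 _ _] := S1 _ _ cx1 cy1; have [x2y2 _ _] := S2 _ _ cx2 cy2.
split=> //.
pose B := (1 + `|C|) * (G1 * A `^ (- delta) / W1 * (G2 / W2)).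
have CC : C <= 1 + `|C| by rewrite (le_trans (ler_norm C)) // lerDr.
have C10 : 0 <= 1 + `|C| by rewrite addr_ge0.
have Ad := powR_ge0 A (- delta).
have bound1 g V : 0 <= g -> 0 <= V -> g <= G1 * A `^ (- delta) / W1 ->
  V <= G2 / W2 ->
    C * (g * V) <= B.
  move=> g0 V0 gl Vl; apply: (@le_trans _ _ ((1 + `|C|) * (g * V))).
    by rewrite ler_wpM2r // mulr_ge0.
  by rewrite ler_wpM2l // ler_pM.
have bound2 g V : 0 <= g -> 0 <= V -> g <= G2 * A `^ (- delta) / W2 ->
  V <= G1 / W1 ->
    C * (V * g) <= B.
  move=> g0 V0 gl Vl; apply: (@le_trans _ _ ((1 + `|C|) * (V * g))).
    by rewrite ler_wpM2r // mulr_ge0.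
  have -> : B = (1 + `|C|) * (G1 / W1 * (G2 * A `^ (- delta) / W2))
    by rewrite /B; ring.
  by rewrite ler_wpM2l // ler_pM.
have gain_ge0 (disp : measure_display) (X : measurableType disp) d
    (mu : {measure set X -> \bar R}) x y z z' : 0 <= gain d mu delta x y z z'.
  by rewrite /gain divr_ge0 ?powR_ge0 // mulr_ge0 ?powR_ge0 // /vol fine_ge0.
have volV_ge0 (disp : measure_display) (X : measurableType disp) d
    (mu : {measure set X -> \bar R}) x y : 0 <= (vol d mu x y)^-1.
  by rewrite invr_ge0 /vol fine_ge0.
have e1 : cabs (K (c1, c2) (c1', c2') - K (x1, c2) (c1', c2')) <= B.
  have [n1 _ g1] := S1 _ _ cc1 cc1'; have [n2 v2 _] := S2 _ _ cc2 cc2'.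
  have [ne gl] := g1 c1 x1 cx1.
  apply: le_trans (jk_mixed_x1 jk n1 n2 ne) _; exact: bound1.
have e2 : cabs (K (x1, c2) (c1', c2') - K (x1, x2) (c1', c2')) <= B.
  have [n1 v1 _] := S1 _ _ cx1 cc1'; have [n2 _ g2] := S2 _ _ cc2 cc2'.
  have [ne gl] := g2 c2 x2 cx2.
  apply: le_trans (jk_mixed_x2 jk n1 n2 ne) _; exact: bound2.
have e3 : cabs (K (x1, x2) (c1', c2') - K (x1, x2) (y1, c2')) <= B.
  have [n1 _ g1] := S1 _ _ cx1 cc1'; have [n2 v2 _] := S2 _ _ cx2 cc2'.
  have [ne gl] := g1 c1' y1 cy1.
  apply: le_trans (jk_mixed_y1 jk n1 n2 ne) _; exact: bound1.
have e4 : cabs (K (x1, x2) (y1, c2') - K (x1, x2) (y1, y2)) <= B.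
  have [n1 v1 _] := S1 _ _ cx1 cy1; have [n2 _ g2] := S2 _ _ cx2 cc2'.
  have [ne gl] := g2 c2' y2 cy2.
  apply: le_trans (jk_mixed_y2 jk n1 n2 ne) _; exact: bound2.
have Beps : 4 * B <= eps * cabs K0.
  apply: (@le_trans _ _ (eps * (c0 * W1 * W2)^-1)); last by rewrite ler_pM2l.
  have B' : B <= (1 + `|C|) * (G1 * M^-1 / W1 * (G2 / W2)).
    rewrite /B ler_wpM2l // ler_wpM2r ?divr_ge0 ?(ltW G20) ?(ltW W20) //.
    by rewrite ler_wpM2r ?invr_ge0 ?(ltW W10) // ler_wpM2l // ltW.
  apply: (@le_trans _ _ (4 * ((1 + `|C|) * (G1 * M^-1 / W1 * (G2 / W2))))).
    by rewrite ler_wpM2l.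
  rewrite le_eqVlt; apply/orP; left; apply/eqP; rewrite /M.
  have n1 : 1 + `|C| != 0 by rewrite gt_eqF // ltr_pwDl.
  by field; rewrite ?n1 ?gt_eqF.
have -> : K (x1, x2) (y1, y2) - K0 =
   - (K0 - K (x1, c2) (c1', c2') + (K (x1, c2) (c1', c2') - K (x1, x2) (c1',
     c2')) +
     (K (x1, x2) (c1', c2') - K (x1, x2) (y1, c2')) +
     (K (x1, x2) (y1, c2') - K (x1, x2) (y1, y2))) by ring.
rewrite cabsN; apply: le_trans Beps.
have -> : 4 * B = B + B + B + B by ring.
apply: le_trans (ler_cabsD _ _) _; apply: lerD => //.
apply: le_trans (ler_cabsD _ _) _; apply: lerD => //.
by apply: le_trans (ler_cabsD _ _) _; apply: lerD.
Qed.

Lemma measurable_off_diagonal (D1 : int -> set (set X1)) (D2 : int ->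
  set (set X2)) :
  dyadic_system d1 D1 -> dyadic_system d2 D2 ->
  measurable (@off_diagonal disp1 disp2 X1 X2).
Proof.
move=> hD1 hD2.
have -> : @off_diagonal disp1 disp2 X1 X2 =
    (fun z : XX * XX => (z.1.1, z.2.1)) @^-1` (~` [set w | w.1 = w.2]) `&`
    (fun z : XX * XX => (z.1.2, z.2.2)) @^-1` (~` [set w | w.1 = w.2]) by [].
have mfst : measurable_fun setT (fun z : XX * XX => (z.1.1, z.2.1)).
  by apply: measurable_fun_pair; [exact: (measurableT_comp measurable_fst)|
    exact: (measurableT_comp measurable_fst)].
have msnd : measurable_fun setT (fun z : XX * XX => (z.1.2, z.2.2)).
  by apply: measurable_fun_pair; [exact: (measurableT_comp measurable_snd)|
    exact: (measurableT_comp measurable_snd)].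
apply: measurableI.
- rewrite -[X in measurable X]setTI; apply: mfst => //; apply: measurableC.
  exact: measurable_diagonal hX1 hD1.
- rewrite -[X in measurable X]setTI; apply: msnd => //; apply: measurableC.
  exact: measurable_diagonal hX2 hD2.
Qed.

End KernelOnSeparatedRectangles.

Lemma disjoint_supp_separated {R : realType} {disp : measure_display}
    {X : measurableType disp} (d : X -> X -> R) (mu : {measure set X -> \bar R})
    (A0 theta : R) (c c' : X) (r : R) (f g : X -> R[i]) :
  homogeneous_space d mu A0 theta -> 0 < r -> 4 * A0 ^+ 3 * r <= d c c' ->
  (forall x, ~ qball d c' r x -> f x = 0) ->
  (forall x, ~ qball d c r x -> g x = 0) -> disjoint_supp d f g.
Proof.
move=> hX r0 far f0 g0; have qm := hs_quasi_metric hX.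
have A01 := quasi_constant_ge1 hX; have A00 : 0 < A0 by exact: lt_le_trans A01.
apply/seteqP; split=> // x [fx gx].
have [y xy fy] := fx r r0; have [z xz gz] := gx r r0.
have c'y : qball d c' r y by apply: contrapT => /f0.
have cz : qball d c r z by apply: contrapT => /g0.
rewrite /qball /= in xy xz c'y cz.
have h1 : d c x < A0 * (r + r).
  apply: le_lt_trans (qm_triangle qm c x z) _; rewrite ltr_pM2l // ltrD //.
  by rewrite (qm_sym qm).
have h2 : d x c' < A0 * (r + r).
  apply: le_lt_trans (qm_triangle qm x c' y) _; rewrite ltr_pM2l // ltrD //.
  by rewrite (qm_sym qm).
have h3 : d c c' < A0 * (A0 * (r + r) + A0 * (r + r)).
  apply: le_lt_trans (qm_triangle qm c c' x) _; rewrite ltr_pM2l //.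
  exact: ltrD.
have : 4 * A0 ^+ 3 * r < A0 * (A0 * (r + r) + A0 * (r + r)) :=
  le_lt_trans far h3.
apply/negP; rewrite -leNgt.
have -> : A0 * (A0 * (r + r) + A0 * (r + r)) = 4 * A0 ^+ 2 * r by ring.
rewrite ler_pM2r // ler_pM2l // (exprS _ 2) ler_peMl // exprn_ge0 //.
exact: ltW.
Qed.

(** * Testing the commutator *)

Section WeightedTest.
Context {R : realType} {disp1 disp2 : measure_display}.
Context {X1 : measurableType disp1} {X2 : measurableType disp2}.
Variables (d1 : X1 -> X1 -> R) (d2 : X2 -> X2 -> R).
Variables (mu1 : {sigma_finite_measure set X1 -> \bar R}).
Variables (mu2 : {sigma_finite_measure set X2 -> \bar R}).
Variables (A0 theta1 theta2 : R).
Local Notation XX := (X1 * X2)%type.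
Local Notation mu := (mu1 \x mu2)%E.
Hypothesis hX1 : homogeneous_space d1 mu1 A0 theta1.
Hypothesis hX2 : homogeneous_space d2 mu2 A0 theta2.
Variable p : R.
Hypothesis p1 : 1 < p.

Let p0 : 0 < p. Proof. exact: lt_trans ltr01 p1. Qed.
Let pm1 : 0 < p - 1. Proof. by rewrite subr_gt0. Qed.
Let pn0 : p != 0. Proof. by rewrite gt_eqF. Qed.
Let pm1n0 : p - 1 != 0. Proof. by rewrite gt_eqF. Qed.

(** Hölder's inequality with the weight distributed over the two factors. *)
Lemma weighted_L1_bound (w : XX -> R) (h : XX -> R[i]) (Q : set XX) (N s : R) :
  Ap_weight d1 d2 mu1 mu2 p w -> cmeasurable h -> rectangles d1 d2 Q ->
  (wLp_norm mu1 mu2 p w h <= N%:E)%E ->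
  (\int[mu]_(x in Q) (dual_weight p w x)%:E)%E = s%:E ->
  (\int[mu]_(x in Q) (cabs (h x))%:E <= (N * s `^ ((p - 1) / p))%:E)%E.
Proof.
move=> hw mh rQ hN sE.
have w0 := Ap_ge0 hw; have mw := measurable_weight hX1 hX2 hw.
have mQ := rectangle_measurable hX1 hX2 rQ.
have mc : measurable_fun setT (fun x => cabs (h x))
  by exact: measurable_cabs mh.
have mu_ : measurable_fun setT (fun x => cabs (h x) `^ p * w x).
  by apply: measurable_funM => //; exact: measurable_powR_fun.
have u0 x : 0 <= cabs (h x) `^ p * w x by rewrite mulr_ge0 ?powR_ge0.
have md : measurable_fun setT (dual_weight p w) by exact: measurable_powR_fun.
have q0 : 0 < p / (p - 1) by rewrite divr_gt0.
have pq : p^-1 + (p / (p - 1))^-1 = 1 by field; rewrite ?pn0 ?pm1n0.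
have := holder_powers mu mQ mu_ md u0 (fun x => powR_ge0 _ _) p0 q0 pq.
rewrite sE invf_div poweR_EFin.
have <- : (\int[mu]_(x in Q) (cabs (h x))%:E = \int[mu]_(x in Q)
    ((cabs (h x) `^ p * w x) `^ p^-1 * dual_weight p w x `^ ((p - 1) /
      p))%:E)%E.
  apply: ge0_ae_eq_integral => //.
  - by apply/measurable_EFinP; exact: measurable_funTS.
  - apply/measurable_EFinP; apply: measurable_funTS.
    by apply: measurable_funM; exact: measurable_powR_fun.
  - by move=> x _; rewrite lee_fin cabs_ge0.
  - by move=> x _; rewrite lee_fin mulr_ge0 ?powR_ge0.
  - apply: filterS (Ap_gt0 hw) => x wx _; congr (_%:E).
    rewrite powRM ?powR_ge0 // -powRrM mulfV // powRr1 ?cabs_ge0 //.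
    rewrite /dual_weight -powRrM.
    have -> : - (p - 1)^-1 * ((p - 1) / p) = - p^-1 by field;
      rewrite ?pn0 ?pm1n0.
    by rewrite -mulrA -powRD ?(gt_eqF wx) ?implybT // subrr powRr0 mulr1.
move=> le; apply: le_trans le _; rewrite EFinM; apply: lee_pmul.
- exact: poweR_ge0.
- by rewrite lee_fin powR_ge0.
- apply: le_trans hN; rewrite /wLp_norm; apply: gt0_ler_poweR.
  + by rewrite invr_ge0 ltW.
  + by rewrite in_itv /= leey andbT integral_ge0 // => x _; rewrite lee_fin.
  + by rewrite in_itv /= leey andbT integral_ge0 // => x _; rewrite lee_fin.
  + apply: ge0_subset_integral => //; first exact/measurable_EFinP.
    by move=> x _; rewrite lee_fin.
- exact: lexx.
Qed.

Lemma wLp_norm_normalized_indicator (w : XX -> R) (Q A : set XX) (t : R) :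
  Ap_weight d1 d2 mu1 mu2 p w -> rectangles d1 d2 Q -> measurable A ->
    A `<=` Q ->
  0 < t -> (\int[mu]_(x in Q) (w x)%:E)%E = t%:E ->
  (wLp_norm mu1 mu2 p w (fun x => ((t `^ p^-1)^-1)%:C * cind R A x)%R <= 1)%E.
Proof.
move=> hw rQ mA AQ t0 tE.
have w0 := Ap_ge0 hw; have mw := measurable_weight hX1 hX2 hw.
have mQ := rectangle_measurable hX1 hX2 rQ.
have ti0 : 0 <= t^-1 by rewrite invr_ge0 ltW.
have pw : (t `^ p^-1)^-1 `^ p = t^-1.
  by rewrite -powRN -powRrM mulNr mulVf // powR_inv1 // ltW.
rewrite /wLp_norm -[leRHS](poweR1r p^-1); apply: gt0_ler_poweR.
- by rewrite invr_ge0 ltW.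
- rewrite in_itv /= leey andbT integral_ge0 // => x _.
  by rewrite lee_fin mulr_ge0 ?powR_ge0.
- by rewrite in_itv /= leey lee_fin ler01.
have <- : (t^-1%:E * \int[mu]_(x in Q) (w x)%:E)%E = 1%E.
  by rewrite tE -EFinM mulVf ?gt_eqF.
rewrite -ge0_integralZl //; last 2 first.
- by apply/measurable_EFinP; exact: measurable_funTS.
- by move=> x _; rewrite lee_fin.
rewrite [leRHS]integral_mkcond; apply: ge0_le_integral => //.
- by move=> x _; rewrite lee_fin mulr_ge0 ?powR_ge0.
- apply/measurable_EFinP; apply: measurable_funM => //;
  apply: measurable_powR_fun.
  apply: measurable_cabs; apply: cmeasurableM; first exact: cmeasurable_cst.
  exact: cmeasurable_cind.
- apply: (measurable_restrictT (fun x => (t^-1%:E * (w x)%:E)%E) mQ).1;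
  apply: measurable_funTS.
  by apply: measurable_funeM; exact/measurable_EFinP.
move=> x _; rewrite patchE.
have [Ax|Ax] := pselect (A x).
  rewrite mem_set; last exact: AQ.
  rewrite /cind indicE mem_set // cabsM !cabs_real normr1 mulr1.
  by rewrite ger0_norm ?invr_ge0 ?powR_ge0 // pw -EFinM.
rewrite /cind indicE memNset // mulr0 cabs0 powR0 // mul0r.
by case: ifP => // _; rewrite -EFinM lee_fin mulr_ge0.
Qed.

Lemma cmeasurable_L1loc (b : XX -> R[i]) : L1loc d1 d2 mu1 mu2 b ->
  cmeasurable b.
Proof.
move=> hb; split; apply: (measurable_of_rectangles hX1 hX2) => Q rQ;
  have [hr hi] := hb Q rQ; apply/measurable_EFinP.
- exact: measurable_int hr.
- exact: measurable_int hi.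
Qed.

End WeightedTest.

Lemma kernel_op_scale {R : realType} {disp : measure_display} {X :
  measurableType disp}
    (mu : {measure set X -> \bar R}) (k : X * X -> R[i]) (a : R[i]) (f : X ->
      R[i]) x :
  cintegrable mu setT (fun y => k (x, y) * f y) ->
  kernel_op mu (fun z => a * k z) f x = a * kernel_op mu k f x.
Proof.
by move=> ki; rewrite /kernel_op -cintegralZ //; apply: eq_cintegral => y _;
  rewrite mulrA.
Qed.

Section CommutatorTest.
Context {R : realType} {disp1 disp2 : measure_display}.
Context {X1 : measurableType disp1} {X2 : measurableType disp2}.
Variables (d1 : X1 -> X1 -> R) (d2 : X2 -> X2 -> R).
Variables (mu1 : {sigma_finite_measure set X1 -> \bar R}).
Variables (mu2 : {sigma_finite_measure set X2 -> \bar R}).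
Variables (A0 theta1 theta2 : R).
Local Notation XX := (X1 * X2)%type.
Local Notation mu := (mu1 \x mu2)%E.
Hypothesis hX1 : homogeneous_space d1 mu1 A0 theta1.
Hypothesis hX2 : homogeneous_space d2 mu2 A0 theta2.
Variables (dom : set (XX -> R[i])) (T : (XX -> R[i]) -> XX -> R[i]).
Hypothesis hT : linear_operator d1 d2 mu1 mu2 dom T.
Variables (p : R) (l1 l2 : XX -> R).
Hypothesis p1 : 1 < p.
Hypothesis h1 : Ap_weight d1 d2 mu1 mu2 p l1.
Hypothesis h2 : Ap_weight d1 d2 mu1 mu2 p l2.
Variables (Q Q' : set XX) (k : XX * XX -> R[i]) (Mk : R) (K0 : R[i]).
Hypotheses (rQ : rectangles d1 d2 Q) (rQ' : rectangles d1 d2 Q').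
Hypotheses (mk : cmeasurable k) (kM : forall z, cabs (k z) <= Mk).
Hypothesis K00 : 0 < cabs K0.
Hypothesis kK0 : forall x y, Q x -> Q' y ->
  cabs (k (x, y) - K0) <= 72^-1 * cabs K0.
Hypothesis representation : forall M N f g, bounded_on Q' M f ->
  bounded_on Q N g ->
  pairing mu1 mu2 (T f) g = cintegral mu setT (fun x => kernel_op mu k f x * g
    x).
Variables (b : XX -> R[i]) (N t s : R).
Hypothesis hb : L1loc d1 d2 mu1 mu2 b.
Hypothesis hN : commutator_norm mu1 mu2 p l1 l2 dom T b = N%:E.
Hypothesis t0 : 0 < t.
Hypothesis tE : (\int[mu]_(x in Q') (l1 x)%:E)%E = t%:E.
Hypothesis sE : (\int[mu]_(x in Q) (dual_weight p l2 x)%:E)%E = s%:E.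
Variables (E F : set XX) (n : R).
Hypotheses (mE : measurable E) (mF : measurable F) (EQ : E `<=` Q) (FQ' : F
  `<=` Q').
Hypotheses (E0 : 0 < fine (mu E)) (F0 : 0 < fine (mu F)).
Hypotheses (bE : forall x, E x -> cabs (b x) <= n) (bF : forall x, F x ->
  cabs (b x) <= n).

Let tau := t `^ p^-1.
Let tau0 : 0 < tau. Proof. exact: powR_gt0. Qed.
Let mQ := rectangle_measurable hX1 hX2 rQ.
Let mQ' := rectangle_measurable hX1 hX2 rQ'.
Let fQ := rectangle_fin hX1 hX2 rQ.
Let fQ' := rectangle_fin hX1 hX2 rQ'.
Let bt x : R[i] := b x * cind R (E `|` F) x.
Let nn : R := `|n|.
Let mb := cmeasurable_L1loc hX1 hX2 hb.

Let btE x : E x -> bt x = b x.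
Proof. by move=> Ex; rewrite /bt /cind indicE mem_set ?mulr1 //; left. Qed.

Let btF x : F x -> bt x = b x.
Proof. by move=> Fx; rewrite /bt /cind indicE mem_set ?mulr1 //; right. Qed.

Let mbt : cmeasurable bt.
Proof. by apply: cmeasurableM => //; apply: cmeasurable_cind;
  exact: measurableU. Qed.

Let btn x : cabs (bt x) <= nn.
Proof.
have [Ex|nE] := pselect (E x).
  by rewrite btE // (le_trans (bE Ex)) // ler_norm.
have [Fx|nF] := pselect (F x).
  by rewrite btF // (le_trans (bF Fx)) // ler_norm.
have nEF : ~ (E `|` F) x by case.
by rewrite /bt /cind indicE memNset // mulr0 cabs0 /nn.
Qed.

Let bbt A P : measurable A -> A `<=` P ->
  bounded_on P (nn * 1) (fun y => bt y * cind R A y).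
Proof.
move=> mA AP; have bT : bounded_on setT nn bt by split => // x [].
by have := bounded_onM bT (bounded_on_cind mA AP); rewrite setTI.
Qed.

Let bscale (P : set XX) M (a : R[i]) (f : XX -> R[i]) : bounded_on P M f ->
  bounded_on P (cabs a * M) (fun x => a * f x).
Proof.
move=> [mf fM fP]; split.
- by apply: cmeasurableM => //; exact: cmeasurable_cst.
- by move=> x; rewrite cabsM ler_wpM2l ?cabs_ge0.
- by move=> x /fP ->; rewrite mulr0.
Qed.

Let k1 (z : XX * XX) : R[i] := K0^-1 * k z.

Let K0n0 : K0 != 0.
Proof. by apply/eqP => K0E; move: K00; rewrite K0E cabs0 ltxx. Qed.

Let test A B : measurable A -> A `<=` F -> measurable B -> B `<=` E ->
  cabs (cintegral mu setT (fun x => kernel_commutator mu bt k1 A x * cind R B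
    x))
  <= 2 * (tau * s `^ ((p - 1) / p) * N) / cabs K0.
Proof.
move=> mA AF mB BE.
have AQ' : A `<=` Q' by move=> x /AF /FQ'.
have BQ : B `<=` Q by move=> x /BE /EQ.
pose f y : R[i] := (tau^-1)%:C * cind R A y.
have bf : bounded_on Q' _ f := bscale (tau^-1)%:C (bounded_on_cind mA AQ').
have btf : bounded_on Q' _ (fun y => (tau^-1)%:C * (bt y * cind R A y)) :=
  bscale (tau^-1)%:C (bbt mA AQ').
have bfE : (fun y => b y * f y) = (fun y => (tau^-1)%:C * (bt y * cind R A y)).
  apply/funext => y; rewrite /f.
  have [Ay|Ay] := pselect (A y); first by rewrite (btF (AF y Ay)) [LHS]mulrCA.
  by rewrite /cind indicE memNset // !mulr0.
have sf : bounded_supp (rectangles d1 d2) f := bounded_supp_rectangle rQ' bf.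
have sbf := bounded_supp_rectangle rQ' btf.
have df := lo_dom_bounded hT sf.
have dbf := lo_dom_bounded hT sbf; rewrite -bfE in sbf dbf btf.
have bg : bounded_on Q 1 (cind R B) := bounded_on_cind mB BQ;
  have bbg := bbt mB BQ.
pose h := commutator b T f.
have mh : cmeasurable h.
  apply: cmeasurableB; last exact: lo_measurable hT _ dbf.
  by apply: cmeasurableM => //; exact: lo_measurable hT _ df.
have hnorm : (wLp_norm mu1 mu2 p l2 h <= N%:E)%E.
  rewrite -hN; apply: ereal_sup_ubound; exists f => //; split => //.
  exact: (wLp_norm_normalized_indicator hX1 hX2 p1 h1 rQ' mA AQ' t0 tE).
have hint := weighted_L1_bound hX1 hX2 p1 h2 mh rQ hnorm sE.
have [_ i1] := integrable_operator_mul hX1 hX2 hT rQ bbg sf.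
have [_ i2] := integrable_operator_mul hX1 hX2 hT rQ bg sbf.
have hE x : h x * cind R B x = T f x * (bt x * cind R B x) -
    T (fun y => b y * f y) x * cind R B x.
  rewrite /h /commutator mulrBl; congr (_ - _).
  have [Bx|Bx] := pselect (B x);
    first by rewrite (btE (BE x Bx)) [b x * T f x]mulrC mulrA.
  by rewrite /cind indicE memNset // !mulr0.
have ih : cintegrable mu setT (fun x => h x * cind R B x).
  by apply: eq_cintegrable (cintegrableB measurableT i1 i2) => // x _;
    rewrite hE.
have J1 : cintegral mu setT (fun x => h x * cind R B x) =
    cintegral mu setT (fun x => kernel_op mu k f x * (bt x * cind R B x)) -
    cintegral mu setT (fun x => kernel_op mu k (fun y => b y * f y) x * cind R
      B x).
  rewrite -(representation bf bbg) -(representation btf bg) /pairing.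
  rewrite -(cintegralB measurableT i1 i2).
  by apply: eq_cintegral => x _; exact: hE.
have J2 : cabs (cintegral mu setT (fun x => h x * cind R B x)) <=
    2 * (N * s `^ ((p - 1) / p)).
  apply: le_trans (cabs_cintegral measurableT ih) _; rewrite ler_pM2l //.
  have ia := cintegrable_cabs measurableT ih.
  rewrite -lee_fin /Rintegral fineK; last exact: integrable_fin_num.
  apply: le_trans hint; rewrite [leRHS]integral_mkcond;
    apply: ge0_le_integral => //.
  - by move=> x _; rewrite lee_fin cabs_ge0.
  - exact: measurable_int ia.
  - apply: (measurable_restrictT (fun x => (cabs (h x))%:E) mQ).1;
    apply: measurable_funTS.
    by apply/measurable_EFinP; exact: measurable_cabs mh.
  - move=> x _; rewrite patchE cabsM.
    have [Bx|Bx] := pselect (B x).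
      rewrite mem_set; last exact: BQ.
      by rewrite /cind indicE mem_set // cabs_real normr1 mulr1.
    rewrite /cind indicE memNset // cabs0 mulr0.
    by case: ifP => // _; rewrite lee_fin cabs_ge0.
have kint M g x : bounded_on Q' M g ->
  cintegrable mu setT (fun y => k (x, y) * g y).
  exact: (kernel_op_integrable mQ' fQ' mk kM).
have kint' M N0 g h' : bounded_on Q' M g -> bounded_on Q N0 h' ->
    cintegrable mu setT (fun x => kernel_op mu k g x * h' x).
  move=> bg' bh'; have [mg _ _] := bg'.
  have bKf : bounded_on setT (2 * (Mk * M * fine (mu Q'))) (kernel_op mu k g).
    split; first exact: (cmeasurable_kernel_op (sigma_finite_product hX1 hX2)
      mk mg).
      by move=> x; exact: (kernel_op_bounded mQ' fQ' mk kM).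
    by move=> x [].
  have := bounded_onM bKf bh'; rewrite setTI.
  exact: bounded_on_cintegrable.
have E1 x : kernel_commutator mu bt k1 A x * cind R B x = (tau%:C * K0^-1) *
    (kernel_op mu k f x * (bt x * cind R B x) -
     kernel_op mu k (fun y => b y * f y) x * cind R B x).
  have iA := kint _ _ x (bounded_on_cind mA AQ').
  have ibA := kint _ _ x (bbt mA AQ').
  have kf : kernel_op mu k f x = (tau^-1)%:C * kernel_op mu k (cind R A) x.
    rewrite /kernel_op -(cintegralZ _ measurableT iA).
    by apply: eq_cintegral => y _; rewrite /f mulrCA.
  have kbf : kernel_op mu k (fun y => b y * f y) x =
      (tau^-1)%:C * kernel_op mu k (fun y => bt y * cind R A y) x.
    rewrite bfE /kernel_op -(cintegralZ _ measurableT ibA).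
    by apply: eq_cintegral => y _; rewrite mulrCA.
  rewrite kf kbf /kernel_commutator /k1 !kernel_op_scale //.
  have tt : tau%:C * (tau^-1)%:C = 1 :> R[i].
    by rewrite -rmorphM /= mulfV ?gt_eqF.
  set u := kernel_op mu k _ x; set v := kernel_op mu k _ x.
  transitivity (tau%:C * (tau^-1)%:C * (K0^-1 * (bt x * u - v) * cind R B x)).
    by rewrite tt mul1r; ring.
  by ring.
rewrite (eq_cintegral _ (fun x _ => E1 x)).
have j1 := kint' _ _ _ _ bf bbg; have j2 := kint' _ _ _ _ btf bg.
rewrite (cintegralZ _ measurableT (cintegrableB measurableT j1 j2)).
rewrite (cintegralB measurableT j1 j2) -J1 !cabsM cabsV cabs_real gtr0_norm //.
have -> : 2 * (tau * s `^ ((p - 1) / p) * N) / cabs K0 =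
   tau / cabs K0 * (2 * (N * s `^ ((p - 1) / p))) by ring.
by rewrite ler_wpM2l // divr_ge0 // ltW.
Qed.

(** The function [b] enters the tests only through its values on [E] and [F],
    where it is bounded, so it may be replaced there by the bounded function
    [bt] and the kernel by its quotient with [K0]. *)
Lemma commutator_oscillation :
  Rintegral mu setT (fun x => cabs ((fine (mu F))%:C * b x -
    cintegral mu setT (fun y => b y * cind R F y)) * \1_E x) <=
  16 * (tau * s `^ ((p - 1) / p) * N) / cabs K0.
Proof.
have fE : (mu E < +oo)%E by apply: le_lt_trans fQ; apply: le_measure;
  rewrite ?inE.
have fF : (mu F < +oo)%E by apply: le_lt_trans fQ'; apply: le_measure;
  rewrite ?inE.
have mk1 : cmeasurable k1 by apply: cmeasurableM => //; exact: cmeasurable_cst.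
have k1M z : cabs (k1 z) <= cabs K0^-1 * Mk
  by rewrite cabsM ler_wpM2l ?cabs_ge0.
have k11 x y : E x -> F y -> cabs (k1 (x, y) - 1) <= 72^-1.
  move=> Ex Fy; have -> : k1 (x, y) - 1 = K0^-1 * (k (x, y) - K0).
    by rewrite /k1 mulrBr mulVf.
  rewrite cabsM cabsV mulrC ler_pdivrMr //.
  by apply: kK0; [exact: EQ|exact: FQ'].
have := absorption (sigma_finite_product hX1 hX2) mE mF fE fF E0 F0 mbt btn
  mk1 k1M k11 test.
have -> : 8 * (2 * (tau * s `^ ((p - 1) / p) * N) / cabs K0) =
  16 * (tau * s `^ ((p - 1) / p) * N) / cabs K0 by ring.
have -> : cintegral mu setT (fun y => bt y * cind R F y) =
    cintegral mu setT (fun y => b y * cind R F y).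
  apply: eq_cintegral => y _.
  have [Fy|Fy] := pselect (F y); first by rewrite btF.
  by rewrite /cind indicE memNset // !mulr0.
rewrite [X in X <= _ -> _](_ : _ = Rintegral mu setT (fun x => cabs ((fine (mu
  F))%:C * b x -
    cintegral mu setT (fun y => b y * cind R F y)) * \1_E x)) //.
apply: eq_Rintegral => x _; rewrite indicE.
have [Ex|Ex] := pselect (E x); first by rewrite btE.
by rewrite memNset // !mulr0.
Qed.

End CommutatorTest.

(** * From bounded truncations to the theorem *)

Section Truncation.
Context {R : realType} {disp : measure_display} {X : measurableType disp}.
Variables (mu : {measure set X -> \bar R}) (Q : set X) (b : X -> R[i]).
Hypotheses (mQ : measurable Q) (fQ : (mu Q < +oo)%E) (mb : cmeasurable b).

Definition sublevel (n : nat) : set X := Q `&` [set x | cabs (b x) <= n%:R].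

Lemma measurable_sublevel n : measurable (sublevel n).
Proof.
apply: measurableI => //.
have := measurable_fun_ler (measurable_cabs mb) (@measurable_cst _ _ X R setT
  n%:R).
move=> /(_ measurableT [set true] I); rewrite setTI.
by congr (measurable _); apply/seteqP; split.
Qed.

Lemma bigcup_sublevel : \bigcup_n sublevel n = Q.
Proof.
apply/seteqP; split=> [x [n _ []]//|x Qx].
exists (Num.truncn (cabs (b x))).+1 => //; split=> //=.
by rewrite ltW // truncnS_gt.
Qed.

Lemma nondecreasing_sublevel : nondecreasing_seq sublevel.
Proof.
move=> m n mn; rewrite subsetEset => x [Qx /= h]; split=> //=.
by rewrite (le_trans h) // ler_nat.
Qed.

Lemma sublevel_half : 0 < fine (mu Q) -> exists k : nat, forall n, (k <= n)%N ->
  fine (mu Q) / 2 <= fine (mu (sublevel n)).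
Proof.
move=> m0; have mS := measurable_sublevel.
have : (fun n => mu (sublevel n)) @ \oo --> mu Q.
  rewrite -[in X in _ --> X]bigcup_sublevel; apply: nondecreasing_cvg_mu => //.
    by rewrite bigcup_sublevel.
  exact: nondecreasing_sublevel.
have Qf : mu Q \is a fin_num by rewrite ge0_fin_numE.
rewrite -[mu Q in X in _ -> X]fineK // -[in X in X -> _](fineK Qf).
move=> /fine_cvg /cvgrPdist_lt /(_ (fine (mu Q) / 2)); rewrite divr_gt0 //.
move=> /(_ isT) [k _ hk]; exists k => n kn.
have /= := hk n kn; rewrite ltr_norml => /andP[_ h]; lra.
Qed.

(** Monotone convergence along the sublevel sets of [b] exhausting [Q]. *)
Lemma sublevel_limit (beta : R[i]) (c : R) (k : nat) :
  (forall n, (k <= n)%N ->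
    Rintegral mu setT (fun x => cabs (b x - beta) * \1_(sublevel n) x) <= c) ->
  (\int[mu]_(x in Q) (cabs (b x - beta))%:E <= c%:E)%E.
Proof.
move=> hc; have mS := measurable_sublevel.
have mg : measurable_fun setT (fun x => cabs (b x - beta)).
  by apply: measurable_cabs; apply: cmeasurableB => //; exact: cmeasurable_cst.
have cv := @ge0_nondecreasing_set_cvg_integral _ _ _ sublevel
  (fun x => (cabs (b x - beta))%:E) mu nondecreasing_sublevel mS
  (fun n => measurable_funTS ((measurable_EFinP _ _).2 mg)).
have {cv} := cv (fun _ x _ => cabs_ge0 _); rewrite bigcup_sublevel => cv.
rewrite -(cvg_lim _ cv) //; apply: lime_le; first by apply/cvg_ex; eexists;
  exact: cv.
exists k => // n /= kn.
have fS : (mu (sublevel n) < +oo)%E.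
  by apply: le_lt_trans fQ; apply: le_measure; rewrite ?inE //; exact: subIsetl.
have := hc n kn; rewrite -lee_fin /Rintegral fineK.
  apply: le_trans; rewrite [leLHS]integral_mkcond; apply: ge0_le_integral => //.
  - by move=> x _; rewrite patchE; case: ifP => // _; rewrite lee_fin cabs_ge0.
  - apply: (measurable_restrictT (fun x => (cabs (b x - beta))%:E) (mS n)).1.
    by apply: measurable_funTS; exact/measurable_EFinP.
  - apply/measurable_EFinP; apply: measurable_funM => //;
    exact: measurable_indic.
  - move=> x _; rewrite patchE indicE; case: (x \in _); first by rewrite mulr1.
    by rewrite mulr0.
apply: integrable_fin_num => //.
apply: (integrable_bounded_indic (M := n%:R + cabs beta)) => //.
move=> x [_ /= bx]; rewrite ger0_norm ?cabs_ge0 //.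
by rewrite (le_trans (ler_cabsD _ _)) // cabsN lerD2r.
Qed.

(** The mean is, up to a constant, the best constant approximation. *)
Lemma mean_oscillation (beta : R[i]) (c : R) : 0 < fine (mu Q) ->
  cintegrable mu Q b ->
  (\int[mu]_(x in Q) (cabs (b x - beta))%:E <= c%:E)%E ->
  (\int[mu]_(x in Q) (cabs (b x - cmean mu Q b))%:E <= (3 * c)%:E)%E.
Proof.
move=> m0 ib hc.
have icst (z : R[i]) : cintegrable mu Q (fun=> z).
  apply: (cintegrable_le mQ (h := fun=> cabs z)) => //.
  apply: measurable_bounded_integrable => //.
  by exists (cabs z); split; [exact: num_real|move=> y zy x _;
    rewrite /= ger0_norm ?cabs_ge0 // ltW].
have icb := cintegrableB mQ ib (icst beta).
have ia := cintegrable_cabs mQ icb.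
pose J := Rintegral mu Q (fun x => cabs (b x - beta)).
have JE : (\int[mu]_(x in Q) (cabs (b x - beta))%:E)%E = J%:E.
  by rewrite /J /Rintegral fineK //; exact: integrable_fin_num.
have Jc : J <= c by rewrite -lee_fin -JE.
have ccst (z : R[i]) : cintegral mu Q (fun=> z) = (fine (mu Q))%:C * z.
  by case: z => z1 z2; apply: complex_eq;
    rewrite /cintegral /= Rintegral_cst //; ring.
set mean := cmean mu Q b.
have dist_mean : cabs (beta - mean) <= (fine (mu Q))^-1 * (2 * J).
  have -> : beta - mean = - ((fine (mu Q))^-1%:C * cintegral mu Q (fun x => b x
    - beta)).
    rewrite (cintegralB mQ ib (icst beta)) ccst /mean /cmean mulrBr mulrA
      -rmorphM /=.
    by rewrite mulVf ?gt_eqF // mul1r opprB.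
  rewrite cabsN cabsM cabs_real ger0_norm ?invr_ge0 ?fine_ge0 //.
  by rewrite ler_wpM2l ?invr_ge0 ?fine_ge0 //; exact: cabs_cintegral.
have im := cintegrable_cabs mQ (cintegrableB mQ ib (icst mean)).
rewrite (_ : (\int[mu]_(x in Q) _)%E =
    (Rintegral mu Q (fun x => cabs (b x - mean)))%:E); last first.
  by rewrite /Rintegral fineK //; exact: integrable_fin_num.
rewrite lee_fin.
have [icr _] := icst (cabs (beta - mean))%:C.
apply: (@le_trans _ _ (Rintegral mu Q (fun x => cabs (b x - beta) + cabs (beta
  - mean)))).
  apply: le_Rintegral => //; first exact: (integrableD mQ ia icr).
  by move=> x _; apply: le_trans (ler_cabsD _ _); rewrite addrA subrK.
rewrite (RintegralD mQ ia icr) Rintegral_cst // -/J.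
have -> : 3 * c = c + 2 * c by ring.
apply: lerD => //; apply: (@le_trans _ _ (2 * J)); last by rewrite ler_pM2l.
by rewrite -ler_pdivlMr // mulrC.
Qed.

End Truncation.

Section LowerBound.
Context {R : realType} {disp1 disp2 : measure_display}.
Context {X1 : measurableType disp1} {X2 : measurableType disp2}.
Variables (d1 : X1 -> X1 -> R) (d2 : X2 -> X2 -> R).
Variables (mu1 : {sigma_finite_measure set X1 -> \bar R}).
Variables (mu2 : {sigma_finite_measure set X2 -> \bar R}).
Variables (A0 theta1 theta2 eta1 eta2 delta : R).
Local Notation XX := (X1 * X2)%type.
Local Notation mu := (mu1 \x mu2)%E.
Hypothesis hX1 : homogeneous_space d1 mu1 A0 theta1.
Hypothesis hX2 : homogeneous_space d2 mu2 A0 theta2.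
Variables (D1 : int -> set (set X1)) (D2 : int -> set (set X2)).
Hypothesis hD1 : dyadic_system d1 D1.
Hypothesis hD2 : dyadic_system d2 D2.
Hypothesis heta1 : 0 < eta1 <= theta1.
Hypothesis heta2 : 0 < eta2 <= theta2.
Hypothesis hdelta : 0 < delta.
Variables (dom : set (XX -> R[i])) (T : (XX -> R[i]) -> XX -> R[i]).
Variable K : XX -> XX -> R[i].
Hypothesis hT : linear_operator d1 d2 mu1 mu2 dom T.
Variable CK : R.
Hypothesis hCK : journe_kernel d1 d2 mu1 mu2 A0 delta CK K.
Hypothesis hrep : full_kernel_representation d1 d2 mu1 mu2 eta1 eta2 K
  (operator_form mu1 mu2 T).
Hypothesis hK : homogeneous_condition d1 d2 mu1 mu2 K.
Variables (p : R) (l1 l2 : XX -> R).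
Hypothesis p1 : 1 < p.
Hypothesis h1 : Ap_weight d1 d2 mu1 mu2 p l1.
Hypothesis h2 : Ap_weight d1 d2 mu1 mu2 p l2.
Let nu := fun x => l1 x `^ p^-1 * l2 x `^ (- p^-1).

Local Notation rect c1 c2 r1 r2 := (qball d1 c1 r1 `*` qball d2 c2 r2).

Let rectP c1 c2 r1 r2 : 0 < r1 -> 0 < r2 -> rectangles d1 d2 (rect c1 c2 r1 r2).
Proof.
by move=> r10 r20; exists (qball d1 c1 r1), (qball d2 c2 r2); split => //;
  [exists c1, r1|exists c2, r2].
Qed.

(** Cutting the kernel off outside the product of the two rectangles makes it
    bounded and measurable everywhere without affecting the kernel formula
    there; the separation makes the supports disjoint, as that formula requires. *)
Let local_kernel c1 c2 c1' c2' r1 r2 : 0 < r1 -> 0 < r2 ->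
  4 * A0 ^+ 3 * r1 <= d1 c1 c1' -> 4 * A0 ^+ 3 * r2 <= d2 c2 c2' ->
  (forall x y, rect c1 c2 r1 r2 x -> rect c1' c2' r1 r2 y ->
    [/\ x.1 <> y.1, x.2 <> y.2 & cabs (K x y - K (c1, c2) (c1', c2')) <=
          72^-1 * cabs (K (c1, c2) (c1', c2'))]) ->
  exists k : XX * XX -> R[i], exists Mk : R,
  [/\ cmeasurable k, (forall z, cabs (k z) <= Mk),
     (forall x y, rect c1 c2 r1 r2 x -> rect c1' c2' r1 r2 y ->
       k (x, y) = K x y) &
     forall M N f g, bounded_on (rect c1' c2' r1 r2) M f ->
       bounded_on (rect c1 c2 r1 r2) N g ->
       pairing mu1 mu2 (T f) g =
       cintegral mu setT (fun x => kernel_op mu k f x * g x)].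
Proof.
move=> r10 r20 far1 far2 close.
set Q := rect c1 c2 r1 r2 in close *; set Q' := rect c1' c2' r1 r2 in close *.
set K0 := K (c1, c2) (c1', c2') in close *.
have rQ : rectangles d1 d2 Q := rectP _ _ r10 r20.
have rQ' : rectangles d1 d2 Q' := rectP _ _ r10 r20.
have mQ := rectangle_measurable hX1 hX2 rQ.
have mQ' := rectangle_measurable hX1 hX2 rQ'.
pose k (z : XX * XX) := K z.1 z.2 * cind R (Q `*` Q') z.
have mk : cmeasurable k.
  apply: (cmeasurable_mul_cind (f := fun z : XX * XX => K z.1 z.2)).
    exact: measurableX.
  apply: (cmeasurable_onS _ _ (jk_measurable hCK)).
    exact: (measurable_off_diagonal hX1 hX2 hD1 hD2).
  by move=> [x y] [/= Qx Qy]; have [? ? _] := close x y Qx Qy; split.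
have kE x y : Q x -> Q' y -> k (x, y) = K x y.
  by move=> Qx Qy; rewrite /k /cind indicE mem_set ?mulr1 //; split.
have kM z : cabs (k z) <= 2 * cabs K0.
  case: z => x y; have [[Qx Qy]|nQ] := pselect ((Q `*` Q') (x, y)).
    rewrite kE //; have [_ _ h] := close x y Qx Qy.
    have -> : K x y = K x y - K0 + K0 by rewrite subrK.
    have := ler_cabsD (K x y - K0) K0; have := cabs_ge0 K0; lra.
  by rewrite /k /cind indicE memNset // mulr0 cabs0 mulr_ge0 ?cabs_ge0.
exists k, (2 * cabs K0); split => //.
apply: (kernel_representation hX1 hX2 heta1 heta2 hT
  (B1 := (qball d1 c1 r1, qball d2 c2 r2)) (B2 := (qball d1 c1' r1,
    qball d2 c2' r2)) _ _ _ _ mk kM).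
- by exists c1, r1.
- by exists c2, r2.
- by exists c1', r1.
- by exists c2', r2.
move=> f1 f2 g1 g2 Cf1 Cf2 Cg1 Cg2 /= f10 f20 g10 g20.
have s1 := disjoint_supp_separated hX1 r10 far1 f10 g10.
have s2 := disjoint_supp_separated hX2 r20 far2 f20 g20.
have := hrep Cf1 Cf2 Cg1 Cg2 s1 s2; rewrite /operator_form => ->.
apply: eq_cintegral => x _; apply: eq_cintegral => y _.
have [Qx|Qx] := pselect (Q x); last first.
  have -> : tensor g1 g2 x = 0.
    by rewrite /tensor; have /not_andP[/g10|/g20] := Qx => ->;
      rewrite ?mulr0 ?mul0r.
  by rewrite !mulr0.
have [Qy|Qy] := pselect (Q' y); last first.
  have -> : tensor f1 f2 y = 0.
    by rewrite /tensor; have /not_andP[/f10|/f20] := Qy => ->;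
      rewrite ?mulr0 ?mul0r.
  by rewrite !mulr0 !mul0r.
by rewrite kE.
Qed.

(** For each rectangle: choose the partner rectangle, truncate [b] on the
    partner at a fixed level that keeps half of the measure, so that the
    constant [beta] does not vary, and let only the truncation on [Q] tend to
    infinity. *)
Lemma rectangle_lower_bound : exists2 C : R, 0 < C & forall (b : XX ->
  R[i]) (N : R),
  L1loc d1 d2 mu1 mu2 b -> commutator_norm mu1 mu2 p l1 l2 dom T b = N%:E ->
  forall Q, rectangles d1 d2 Q -> 0 <= N /\
    (0 < \int[mu]_(x in Q) (nu x)%:E)%E /\
    (\int[mu]_(x in Q) (cabs (b x - cmean mu Q b))%:E <=
     (C * N)%:E * \int[mu]_(x in Q) (nu x)%:E)%E.
Proof.
have e0 : 0 < (72^-1 : R) by rewrite invr_gt0.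
have [t [c [t0 c0 hclose]]] := kernel_nearly_constant hX1 hX2 hdelta hCK hK e0.
have [s1 [G1 [s10 G11 cmp1]]] := comparable_balls hX1 t.
have [s2 [G2 [s20 G21 cmp2]]] := comparable_balls hX2 t.
have G0 : 0 < G1 * G2 by rewrite mulr_gt0 // (lt_le_trans ltr01).
have [C C0 bloom] := weights_bloom hX1 hX2 p1 h1 h2 (ltW G0).
have cG : 0 < c * (G1 * G2) by exact: mulr_gt0.
exists (96 * (c * (G1 * G2)) * C); first by rewrite mulr_gt0 // mulr_gt0.
move=> b N hb hN Q rQ.
have [B1 [B2 [[c1 [r1 [r10 B1E]]] [c2 [r2 [r20 B2E]]] QE]]] := rQ.
have {B1 B2 B1E B2E}QE : Q = rect c1 c2 r1 r2 by rewrite QE B1E B2E.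
have [c1' [c2' [near1 near2 far1 far2 [K00 [Kinv close]]]]] :=
  hclose c1 c2 r1 r2 r10 r20.
have [k [Mk [mk kM kE rep]]] := local_kernel r10 r20 far1 far2 close.
set K0 := K (c1, c2) (c1', c2') in K00 Kinv close.
rewrite -QE in kE rep close.
set Q' := rect c1' c2' r1 r2 in kE rep close.
have rQ' : rectangles d1 d2 Q' := rectP _ _ r10 r20.
pose Q'' := rect c1 c2 (s1 * r1) (s2 * r2).
have rQ'' : rectangles d1 d2 Q'' by apply: rectP; exact: mulr_gt0.
have [sub1 sub1' le1 le1'] := cmp1 c1 c1' r1 r10 near1.
have [sub2 sub2' le2 le2'] := cmp2 c2 c2' r2 r20 near2.
have mQ := rectangle_measurable hX1 hX2 rQ.
have mQ' := rectangle_measurable hX1 hX2 rQ'.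
have fQ := rectangle_fin hX1 hX2 rQ; have fQ' := rectangle_fin hX1 hX2 rQ'.
have Qgt0 := rectangle_gt0 hX1 hX2 rQ; have Q'gt0 := rectangle_gt0 hX1 hX2 rQ'.
have QQ'' : Q `<=` Q'' by rewrite QE => x [? ?]; split;
  [exact: sub1|exact: sub2].
have Q'Q'' : Q' `<=` Q'' by move=> x [? ?]; split; [exact: sub1'|exact: sub2'].
have Q''E : fine (mu Q'') = fine (mu1 (qball d1 c1 (s1 * r1))) *
    fine (mu2 (qball d2 c2 (s2 * r2))).
  by rewrite (rectangle_measure hX1 hX2) // mulr_gt0.
have QmE : fine (mu Q) = fine (mu1 (qball d1 c1 r1)) * fine (mu2 (qball d2 c2
  r2)).
  by rewrite QE (rectangle_measure hX1 hX2).
have Q'mE : fine (mu Q') = fine (mu1 (qball d1 c1' r1)) * fine (mu2 (qball d2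
  c2' r2)).
  by rewrite (rectangle_measure hX1 hX2).
have Q''Q : fine (mu Q'') <= G1 * G2 * fine (mu Q).
  by rewrite Q''E QmE mulrACA; apply: ler_pM; rewrite ?fine_ge0.
have QQ' : fine (mu Q) <= G1 * G2 * fine (mu Q').
  apply: (@le_trans _ _ (fine (mu Q''))).
    apply: fine_le.
    - by rewrite ge0_fin_numE.
    - by rewrite ge0_fin_numE //; exact: (rectangle_fin hX1 hX2 rQ'').
    - by apply: le_measure; rewrite ?inE //;
      exact: (rectangle_measurable hX1 hX2 rQ'').
  by rewrite Q''E Q'mE mulrACA; apply: ler_pM; rewrite ?fine_ge0.
have [tau [s [tau0 s0 tE sE hnu]]] :=
  bloom Q Q' Q'' rQ rQ' rQ'' QQ'' Q'Q'' Q''Q.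
have {}sE : (\int[mu]_(x in Q) (dual_weight p l2 x)%:E)%E = s%:E := sE.
set S := tau `^ p^-1 * s `^ ((p - 1) / p) in hnu.
have S0 : 0 < S by rewrite mulr_gt0 // powR_gt0.
have mb := cmeasurable_L1loc hX1 hX2 hb.
have [kF hF] := sublevel_half mQ' fQ' mb Q'gt0.
have [kE' hE] := sublevel_half mQ fQ mb Qgt0.
pose F := sublevel Q' b kF.
have mF : measurable F := measurable_sublevel mQ' mb kF.
have F2 : fine (mu Q') / 2 <= fine (mu F) := hF kF (leqnn _).
have F0 : 0 < fine (mu F) by apply: lt_le_trans F2; rewrite divr_gt0.
set mf := fine (mu F) in F2 F0.
pose I := cintegral mu setT (fun y => b y * cind R F y).
pose beta := (mf^-1)%:C * I.
have kK0 x y : Q x -> Q' y -> cabs (k (x, y) - K0) <= 72^-1 * cabs K0.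
  by move=> Qx Qy; rewrite kE //; have [_ _] := close x y Qx Qy.
have osc n : (maxn kE' kF <= n)%N ->
    mf * Rintegral mu setT (fun x => cabs (b x - beta) * \1_(sublevel Q b n) x)
      <=
    16 * (S * N) / cabs K0.
  rewrite geq_max => /andP[nE nF].
  have mE := measurable_sublevel mQ mb n.
  have En0 : 0 < fine (mu (sublevel Q b n)).
    by apply: lt_le_trans (hE n nE); rewrite divr_gt0.
  have fE : (mu (sublevel Q b n) < +oo)%E.
    by apply: le_lt_trans fQ; apply: le_measure; rewrite ?inE //;
      exact: subIsetl.
  have bE x : sublevel Q b n x -> cabs (b x) <= n%:R by case.
  have bF x : F x -> cabs (b x) <= n%:R.
    by move=> [_ /= h]; rewrite (le_trans h) // ler_nat.
  have EQ : sublevel Q b n `<=` Q by exact: subIsetl.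
  have FQ' : F `<=` Q' by exact: subIsetl.
  have := commutator_oscillation hX1 hX2 hT p1 h1 h2 rQ rQ' mk kM K00 kK0 rep
    hb hN
    tau0 tE sE mE mF EQ FQ' En0 F0 bE bF.
  rewrite -/S -/mf -/I; apply: le_trans.
  have ii : mu.-integrable setT (EFin \o (fun x => cabs (b x - beta) *
    \1_(sublevel Q b n) x)).
    apply: (integrable_bounded_indic (M := n%:R + cabs beta)) => //.
      by apply: measurable_cabs; apply: cmeasurableB => //;
        exact: cmeasurable_cst.
    move=> x /bE bx; rewrite ger0_norm ?cabs_ge0 //.
    by rewrite (le_trans (ler_cabsD _ _)) // cabsN lerD2r.
  rewrite -(RintegralZl _ measurableT ii).
  rewrite (@eq_Rintegral _ _ _ _ _ (fun x => cabs (mf%:C * b x - I) *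
    \1_(sublevel Q b n) x)) //.
  move=> x _; rewrite mulrA; congr (_ * _).
  have -> : mf%:C * b x - I = mf%:C * (b x - beta).
    by rewrite mulrBr /beta mulrA -rmorphM /= mulfV ?gt_eqF // mul1r.
  by rewrite cabsM cabs_real gtr0_norm.
have N0 : 0 <= N.
  have : 0 <= 16 * (S * N) / cabs K0.
    have h := osc _ (leqnn (maxn kE' kF)); apply: le_trans h.
    rewrite mulr_ge0 ?(ltW F0) //.
    by apply: Rintegral_ge0 => x _; rewrite mulr_ge0 ?cabs_ge0.
  by rewrite pmulr_lge0 ?invr_gt0 // pmulr_rge0 // pmulr_rge0.
have bound : (\int[mu]_(x in Q) (cabs (b x - beta))%:E <=
    (32 * (c * (G1 * G2)) * (S * N))%:E)%E.
  apply: (sublevel_limit mQ fQ mb (k := maxn kE' kF)) => n hn.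
  rewrite -(ler_pM2l F0); apply: le_trans (osc n hn) _.
  have SN : 0 <= S * N by rewrite mulr_ge0 // ltW.
  apply: (@le_trans _ _ (16 * (S * N) * (c * (G1 * G2 * (2 * mf))))).
    apply: ler_wpM2l; first exact: mulr_ge0.
    apply: le_trans Kinv _; rewrite -QmE ler_pM2l //.
    apply: le_trans QQ' _; rewrite ler_pM2l //.
    by rewrite mulrC -ler_pdivrMr.
  by rewrite le_eqVlt; apply/orP; left; apply/eqP; ring.
have nu_gt0 : (0 < \int[mu]_(x in Q) (nu x)%:E)%E.
  rewrite lt0e; apply/andP; split; last first.
    by apply: integral_ge0 => x _; rewrite lee_fin mulr_ge0 ?powR_ge0.
  by apply/eqP => n0; move: hnu; rewrite -/nu n0 mule0 lee_fin leNgt S0.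
split=> //; split=> //.
have mo := mean_oscillation mQ fQ Qgt0 (hb Q rQ) bound.
apply: le_trans mo _.
set a := 96 * (c * (G1 * G2)) * N.
have a0 : 0 <= a by rewrite mulr_ge0 // mulr_ge0 // ltW.
have -> : 3 * (32 * (c * (G1 * G2)) * (S * N)) = a * S by rewrite /a; ring.
have -> : 96 * (c * (G1 * G2)) * C * N = a * C by rewrite /a; ring.
by rewrite !EFinM -[leRHS]muleA; apply: lee_wpmul2l; rewrite ?lee_fin.
Qed.

End LowerBound.

(** The zero function is admissible, so the supremum is not over the empty set. *)
Lemma commutator_norm_ge0 {R : realType} {disp1 disp2 : measure_display}
    {X1 : measurableType disp1} {X2 : measurableType disp2}
    (d1 : X1 -> X1 -> R) (d2 : X2 -> X2 -> R)
    (mu1 : {sigma_finite_measure set X1 -> \bar R})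
    (mu2 : {sigma_finite_measure set X2 -> \bar R})
    (dom : set (X1 * X2 -> R[i])) (T : (X1 * X2 -> R[i]) -> X1 * X2 -> R[i])
    (p : R) (l1 l2 : X1 * X2 -> R) (b : X1 * X2 -> R[i]) (Q : set (X1 * X2)) :
  linear_operator d1 d2 mu1 mu2 dom T -> rectangles d1 d2 Q -> 0 < p ->
  (0 <= commutator_norm mu1 mu2 p l1 l2 dom T b)%E.
Proof.
move=> hT rQ p0; pose z : X1 * X2 -> R[i] := fun=> 0.
have dz : dom z.
  apply: (lo_dom_bounded hT); exists Q, 0; split=> //; split.
  - exact: (cmeasurable_cst (0 : R[i])).
  - by move=> x; rewrite cabs0.
  - by [].
apply: (@le_trans _ _ (wLp_norm mu1 mu2 p l2 (commutator b T z))).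
  exact: poweR_ge0.
apply: ereal_sup_ubound; exists z => //; split => //.
- by rewrite (_ : (fun x => _) = z) //; apply/funext => x; rewrite mulr0.
- rewrite /wLp_norm (eq_integral (fun=> 0%E)).
    by rewrite integral0 poweR0r ?invr_eq0 ?gt_eqF // lee_fin.
  by move=> x _; rewrite cabs0 powR0 ?gt_eqF // mul0r.
Qed.

Theorem theorem8p4 (R : realType) (disp1 disp2 : measure_display)
  (X1 : measurableType disp1) (X2 : measurableType disp2)
  (d1 : X1 -> X1 -> R) (d2 : X2 -> X2 -> R)
  (mu1 : {sigma_finite_measure set X1 -> \bar R})
  (mu2 : {sigma_finite_measure set X2 -> \bar R})
  (A0 theta1 theta2 : R)
  (hX1 : homogeneous_space d1 mu1 A0 theta1)
  (hX2 : homogeneous_space d2 mu2 A0 theta2)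
  (D1 : int -> set (set X1)) (D2 : int -> set (set X2))
  (hD1 : dyadic_system d1 D1) (hD2 : dyadic_system d2 D2)
  (eta1 eta2 delta : R)
  (heta1 : 0 < eta1 <= theta1) (heta2 : 0 < eta2 <= theta2)
  (hdelta : 0 < delta)
  (dom : set (X1 * X2 -> R[i]))
  (T : (X1 * X2 -> R[i]) -> X1 * X2 -> R[i])
  (K : X1 * X2 -> X1 * X2 -> R[i])
  (hT : journe_operator d1 d2 mu1 mu2 A0 delta eta1 eta2 D1 D2 dom T K)
  (hK : homogeneous_condition d1 d2 mu1 mu2 K)
  (p : R) (hp : 1 < p) (lambda1 lambda2 : X1 * X2 -> R)
  (hlambda1 : Ap_weight d1 d2 mu1 mu2 p lambda1)
  (hlambda2 : Ap_weight d1 d2 mu1 mu2 p lambda2) :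
  let nu := fun x => lambda1 x `^ p^-1 * lambda2 x `^ (- p^-1) in
  exists C : R, forall b : X1 * X2 -> R[i],
    L1loc d1 d2 mu1 mu2 b ->
    (commutator_norm mu1 mu2 p lambda1 lambda2 dom T b < +oo)%E ->
    bmo d1 d2 mu1 mu2 nu b /\
    (bmo_norm d1 d2 mu1 mu2 nu b <=
       C%:E * commutator_norm mu1 mu2 p lambda1 lambda2 dom T b)%E.
Proof.
move=> nu; have [CK hCK] := jo_kernel hT.
have [C C0 low] := rectangle_lower_bound hX1 hX2 hD1 hD2 heta1 heta2 hdelta
  (jo_linear hT) hCK (jo_representation hT) hK hp hlambda1 hlambda2.
exists C => b hb fin.
have fin' : (C%:E * commutator_norm mu1 mu2 p lambda1 lambda2 dom T b < +oo)%E.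
  case: (commutator_norm _ _ _ _ _ _ _ _) fin => [N _|//|_];
    first by rewrite -EFinM ltry.
  by rewrite gt0_muleNy ?lte_fin.
suff le : (bmo_norm d1 d2 mu1 mu2 nu b <=
    C%:E * commutator_norm mu1 mu2 p lambda1 lambda2 dom T b)%E.
  by split=> //; split=> //; exact: le_lt_trans le fin'.
apply: ge_ereal_sup => _ [Q rQ <-].
have nu0 x : 0 <= nu x by rewrite mulr_ge0 ?powR_ge0.
have osc0 : (0 <= \int[mu1 \x mu2]_(x in Q) (cabs (b x - cmean (mu1 \x mu2) Q
  b))%:E)%E.
  by apply: integral_ge0 => x _; rewrite lee_fin cabs_ge0.
case E : (commutator_norm mu1 mu2 p lambda1 lambda2 dom T b) fin => [N| |] //=
  _.
  have [N0 [n0 le]] := low b N hb E Q rQ.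
  move: le n0; rewrite -/nu;
    case: (\int[_]_(x in Q) (nu x)%:E)%E => [n le n0| _ _|//].
    rewrite lte_fin in n0.
    rewrite inver gt_eqF // -EFinM lee_pdivrMl //.
    by rewrite muleC.
  (* An infinite integral of [nu] makes the quotient vanish. *)
  by rewrite invey mul0e -EFinM lee_fin mulr_ge0 // ltW.
have := commutator_norm_ge0 lambda1 lambda2 b (jo_linear hT) rQ (lt_trans ltr01
  hp).
by rewrite E.
Qed.
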